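(* Let $e_1$ and $e_2$ be two unit vectors in $\mathbb{R}^3$, $e_1\ne\pm e_2$, and let $e=\lambda_1e_1+\lambda_2e_2$, $\lambda_1>0$, $\lambda_2>0$, $|e|=1$. Let $\Gamma=\{v=\mu_1e_1+\mu_2e_2 : |v|=1,\ \mu_1\ge0,\ \mu_2\ge0\}$, and let $K$ be a closed set with $\{e_1,e_2\}\subset K\subset\Gamma$. Then there exist a convex body $C\subset\mathbb{R}^3$ and a ridge point $r_0\in\partial C$ such that the tangent cone to $C$ at $r_0$ is given by the inequalities $(r-r_0,e_1)\le0$, $(r-r_0,e_2)\le0$, and the measure $\nu_t=\nu_{t,e,r_0,C}$ converges weakly as $t\to0$ to a measure $\nu_*$ on $S^2$ with $\operatorname{spt}\nu_*=K$.
   Context: A convex body is a convex compact set with nonempty interior. $(\cdot,\cdot)$ is the scalar product in $\mathbb{R}^3$. The tangent cone to $C$ at $r_0\in\partial C$ is the closure of the union of all rays with vertex $r_0$ through points of $C\setminus\{r_0\}$; $r_0$ is a ridge point if the tangent cone at $r_0$ is a dihedral angle, i.e. given by two inequalities as in the claim with $e_1\neq\pm e_2$. $|A|$ denotes the area (2-dimensional Lebesgue/Hausdorff measure) of a Borel set $A$ contained in a plane or in the convex surface $\partial C$. $\partial'C$ is the set of regular points of $\partial C$ (points with a unique plane of support); it has full measure in $\partial C$. For $r\in\partial'C$, $n_r$ is the outward unit normal to $C$ at $r$. For $t>0$ put $B_t=C\cap\{r:(r-r_0,e)=-t\}$ and $S_t=\partial C\cap\{r:(r-r_0,e)\ge -t\}$.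 For all sufficiently small $t>0$ one has $|B_t|>0$, and the measure $\nu_t=\nu_{t,e,r_0,C}$ on $S^2$ is defined by $\nu_t(A)=\frac{1}{|B_t|}\,|\{r\in S_t\cap\partial'C : n_r\in A\}|$ for Borel sets $A\subset S^2$. Weak convergence $\nu_t\to\nu_*$ as $t\to0$ means $\int_{S^2}f\,d\nu_t\to\int_{S^2}f\,d\nu_*$ for every continuous function $f$ on $S^2$. $\operatorname{spt}$ denotes the (closed) support of a measure. *)

(* Defs.v *)
From HB Require Import structures.
From mathcomp Require Import all_boot all_order all_algebra.
From mathcomp Require Import all_classical all_reals all_analysis.

Set Implicit Arguments.
Unset Strict Implicit.
Unset Printing Implicit Defensive.

Import Order.TTheory GRing.Theory Num.Theory.
Import numFieldNormedType.Exports.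

Local Open Scope classical_set_scope.
Local Open Scope ring_scope.

(* The canonical norm on ['rV[R]_3] is the sup norm: it only provides the
   topology. All metric notions below use the Euclidean norm. *)
Definition dot (R : realType) (u v : 'rV[R]_3) : R := \sum_(i < 3) u 0 i * v 0 i.

Definition enorm (R : realType) (u : 'rV[R]_3) : R := Num.sqrt (dot u u).

Definition sphere (R : realType) : set 'rV[R]_3 := [set v | enorm v = 1].
Arguments sphere R : clear implicits.

Definition boundary (R : realType) (C : set 'rV[R]_3) : set 'rV[R]_3 :=
  closure C `\` C°.

Definition convex_body (R : realType) (C : set 'rV[R]_3) : Prop :=
  [/\ @convex_set R 'rV[R]_3 C, compact C & C° !=set0].

Definition ray (R : realType) (r0 x : 'rV[R]_3) : set 'rV[R]_3 :=
  [set r0 + s *: (x - r0) | s in [set s : R | 0 <= s]].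

Definition tangent_cone (R : realType) (C : set 'rV[R]_3) (r0 : 'rV[R]_3) :
    set 'rV[R]_3 :=
  closure (\bigcup_(x in C `\ r0) ray r0 x).

Definition dihedral (R : realType) (r0 e1 e2 : 'rV[R]_3) : set 'rV[R]_3 :=
  [set r | dot (r - r0) e1 <= 0 /\ dot (r - r0) e2 <= 0].

Definition ridge_point (R : realType) (C : set 'rV[R]_3) (r0 : 'rV[R]_3) : Prop :=
  boundary C r0 /\
  exists e1 e2 : 'rV[R]_3,
    [/\ enorm e1 = 1, enorm e2 = 1, e1 <> e2, e1 <> - e2 &
        tangent_cone C r0 = dihedral r0 e1 e2].

(* Two-dimensional Hausdorff measure on R^3, for the Euclidean distance. The
   factor [pi / 4] is the area of a disc of diameter 1, so that on Borel subsets
   of a plane [area] is the Lebesgue measure of the plane. *)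
Definition diam (R : realType) (U : set 'rV[R]_3) : \bar R :=
  (* 0 is added because [ereal_sup set0 = -oo] *)
  ereal_sup (0%E |` [set (enorm (p.1 - p.2))%:E | p in U `*` U]).

Definition area_delta (R : realType) (delta : R) (A : set 'rV[R]_3) : \bar R :=
  ereal_inf [set (\sum_(i <oo) ((pi / 4)%:E * (diam (U i) ^+ 2)))%E |
             U in [set U : (set 'rV[R]_3)^nat |
                   A `<=` \bigcup_i U i /\
                   forall i, (diam (U i) <= delta%:E)%E]].

Definition area (R : realType) (A : set 'rV[R]_3) : \bar R :=
  ereal_sup [set area_delta delta A | delta in [set delta : R | 0 < delta]].

Definition outward_unit_normals (R : realType) (C : set 'rV[R]_3) (r : 'rV[R]_3) :
    set 'rV[R]_3 :=
  [set n | enorm n = 1 /\ forall x, C x -> dot (x - r) n <= 0].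

Definition support_plane (R : realType) (C : set 'rV[R]_3) (r : 'rV[R]_3)
    (P : set 'rV[R]_3) : Prop :=
  exists2 n, outward_unit_normals C r n & P = [set x | dot (x - r) n = 0].

Definition regular_points (R : realType) (C : set 'rV[R]_3) : set 'rV[R]_3 :=
  [set r | boundary C r /\ exists! P, support_plane C r P].

(* Only meaningful at a regular point of a convex body [C], where
   [outward_unit_normals C r] is a singleton. *)
Definition normal (R : realType) (C : set 'rV[R]_3) (r : 'rV[R]_3) : 'rV[R]_3 :=
  xget 0 (outward_unit_normals C r).

Definition slice (R : realType) (C : set 'rV[R]_3) (r0 e : 'rV[R]_3) (t : R) :
    set 'rV[R]_3 :=
  C `&` [set r | dot (r - r0) e = - t].

Definition cap (R : realType) (C : set 'rV[R]_3) (r0 e : 'rV[R]_3) (t : R) :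
    set 'rV[R]_3 :=
  boundary C `&` [set r | - t <= dot (r - r0) e].

Definition nu (R : realType) (C : set 'rV[R]_3) (r0 e : 'rV[R]_3) (t : R)
    (A : set 'rV[R]_3) : \bar R :=
  ((area (slice C r0 e t))^-1 *
   area [set r | (cap C r0 e t `&` regular_points C) r /\ A (normal C r)])%E.

(* R^3 with its Borel sigma-algebra. A measure on the sphere is represented by a
   Borel measure on R^3 for which the complement of the sphere is null. *)
Definition borelR3 (R : realType) := g_sigma_algebraType (@open 'rV[R]_3).
Arguments borelR3 R : clear implicits.

Definition weak_cvg (R : realType) (T : Type) (F : set_system T)
    (mu_ : T -> {measure set (borelR3 R) -> \bar R})
    (mu : {measure set (borelR3 R) -> \bar R}) : Prop :=
  forall f : 'rV[R]_3 -> R, {within sphere R, continuous f} ->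
    (\int[mu_ t]_(x in sphere R) (f x)%:E)%E @[t --> F]
      --> (\int[mu]_(x in sphere R) (f x)%:E)%E.

Definition spt (R : realType) (mu : {measure set (borelR3 R) -> \bar R}) :
    set 'rV[R]_3 :=
  [set x | forall U : set 'rV[R]_3, open U -> U x -> (0 < mu U)%E].

(* Main.v *)
Require Import Defs.
From HB Require Import structures.
From mathcomp Require Import all_boot all_order all_algebra.
From mathcomp Require Import all_classical all_reals all_analysis.
From mathcomp Require Import measurable_realfun.
From mathcomp Require Import ring lra.

Set Implicit Arguments.
Unset Strict Implicit.
Unset Printing Implicit Defensive.

Import Order.TTheory GRing.Theory Num.Theory.
Import numFieldNormedType.Exports.

Local Open Scope classical_set_scope.
Local Open Scope ring_scope.

(** In orthonormal coordinates (x, y, z) along [e1 - e2], [e1 + e2] and the edge,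
    take [r0 = 0] and, near the edge, let the body lie below the graph
    y = - g(x, z) of the homogeneous function
      g(x, z) = sup over k in S of k x + (q^2 + 1 - k^2 / 2) z^2,
    where S is the compact set of the slopes k in [-q, q] for which the unit
    vector along (k, 1, 0) lies in K. Since g(s^2 x, s z) = s^2 g(x, z), the cap and
    the slice at level t = s^2 have charts on one fixed planar domain: their areas
    are of order s^3, and at the point of parameter (x, z) the normal
    (k, 1, O(s)) tends to (k, 1, 0), k being the slope attaining the supremum.
    Completing the square, that k is the point of S nearest to x / z^2; hence all
    limit normals lie in K, and each point of K has neighbourhoods of positive limit
    mass. The convergence of areas is the Lipschitz bound for Hausdorff measure,
    applied on thin windows of slopes, where the surface is almost flat. *)

(** An envelope of planes through the edge would show only the two extreme slopes: for x > 0 the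
    slope q wins, for x < 0 the slope - q. The term - k^2 / 2 lets parabolas of smaller |k| rise
    faster along the edge, and this alone makes intermediate slopes active. The scaling (s^2, s) has
    a second effect: the cap becomes long along the edge and thin across it, so the component of the
    normal along the edge dies out. The envelope has kinks wherever several slopes are active, and S
    may be any compact set, so differentiating the surface is avoided. Its increment between two
    points is controlled by slopes active at these two points, which is exactly what a Lipschitz
    comparison of Hausdorff measures asks for. On planes the Hausdorff measure is shown to be a
    multiple c of Lebesgue measure for some positive real c, by crude covering bounds in place of
    the isodiametric inequality. The measure to be computed is a quotient of two areas, so c
    cancels. *)

Section continuity.
Context {R : realType} {T : topologicalType}.
Implicit Types f g : T -> R.

Lemma continuous_add f g :
  continuous f -> continuous g -> continuous (fun x => f x + g x).
Proof. by move=> cf cg x; apply: (@continuousD R R T f g x); [exact: cf|exact: cg]. Qed.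

Lemma continuous_mul f g :
  continuous f -> continuous g -> continuous (fun x => f x * g x).
Proof. by move=> cf cg x; apply: (@continuousM R T f g x); [exact: cf|exact: cg]. Qed.

Lemma continuous_opp f : continuous f -> continuous (fun x => - f x).
Proof. by move=> cf x; apply: (@continuousN R R T f x); exact: cf. Qed.

Lemma continuous_const (c : R) : continuous (fun _ : T => c).
Proof. by move=> x; exact: cst_continuous. Qed.

Lemma continuous_abs f : continuous f -> continuous (fun x => `|f x|).
Proof.
by move=> cf x; apply: (@continuous_comp _ _ _ f (fun y : R => `|y|)); [exact: cf|exact: norm_continuous].
Qed.

Lemma continuous_pow f n : continuous f -> continuous (fun x => f x ^+ n).
Proof.
by move=> cf x; apply: (@continuous_comp _ _ _ f (fun y : R => y ^+ n)); [exact: cf|exact: exprn_continuous].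
Qed.
End continuity.

(** * Euclidean geometry of R^3 *)

Section euclidean.
Context {R : realType}.
Implicit Types (u v w : 'rV[R]_3) (c : R).

Lemma dotE u v : dot u v = u 0 0 * v 0 0 + u 0 1 * v 0 1 + u 0 2%:R * v 0 2%:R.
Proof.
rewrite /dot !big_ord_recl big_ord0 addr0 addrA.
by congr (_ * _ + _ * _ + _ * _); congr (_ _ _); apply: val_inj.
Qed.

Lemma dotC u v : dot u v = dot v u.
Proof. by apply: eq_bigr => i _; rewrite mulrC. Qed.

Lemma dotDl u v w : dot (u + v) w = dot u w + dot v w.
Proof. by rewrite -big_split; apply: eq_bigr => i _; rewrite !mxE mulrDl. Qed.

Lemma dotZl c u v : dot (c *: u) v = c * dot u v.
Proof. by rewrite mulr_sumr; apply: eq_bigr => i _; rewrite !mxE mulrA. Qed.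

Lemma dotNl u v : dot (- u) v = - dot u v.
Proof. by rewrite -scaleN1r dotZl mulN1r. Qed.

Lemma dotBl u v w : dot (u - v) w = dot u w - dot v w.
Proof. by rewrite dotDl dotNl. Qed.

Lemma dot0l u : dot 0 u = 0.
Proof. by rewrite -[0](scale0r 0) dotZl mul0r. Qed.

Lemma dotDr u v w : dot w (u + v) = dot w u + dot w v.
Proof. by rewrite !(dotC w) dotDl. Qed.

Lemma dotZr c u v : dot v (c *: u) = c * dot v u.
Proof. by rewrite !(dotC v) dotZl. Qed.

Lemma dotNr u v : dot v (- u) = - dot v u.
Proof. by rewrite !(dotC v) dotNl. Qed.

Lemma dotBr u v w : dot w (u - v) = dot w u - dot w v.
Proof. by rewrite dotDr dotNr. Qed.

Lemma dot0r u : dot u 0 = 0.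
Proof. by rewrite dotC dot0l. Qed.

Definition dot_lin := (dotDl, dotDr, dotZl, dotZr, dotNl, dotNr, dot0l, dot0r).

Lemma dotvv_ge0 u : 0 <= dot u u.
Proof. by apply: sumr_ge0 => i _; rewrite -expr2 sqr_ge0. Qed.

Lemma dotvv_eq0 u : (dot u u == 0) = (u == 0).
Proof.
apply/eqP/eqP => [|->]; last by rewrite dot0l.
move=> /eqP; rewrite psumr_eq0 => [/allP u0|i _]; last by rewrite -expr2 sqr_ge0.
apply/rowP => i; have := u0 i; rewrite mem_index_enum => /(_ isT)/=.
by rewrite mxE mulf_eq0 orbb => /eqP.
Qed.

Lemma enorm_ge0 u : 0 <= enorm u.
Proof. exact: sqrtr_ge0. Qed.

Lemma sqr_enorm u : enorm u ^+ 2 = dot u u.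
Proof. by rewrite sqr_sqrtr// dotvv_ge0. Qed.

Lemma enorm0 : enorm 0 = 0 :> R.
Proof. by rewrite /enorm dot0l sqrtr0. Qed.

Lemma enorm_eq0 u : (enorm u == 0) = (u == 0).
Proof. by rewrite -dotvv_eq0 -sqr_enorm sqrf_eq0. Qed.

Lemma enormN u : enorm (- u) = enorm u.
Proof. by rewrite /enorm dotNl dotNr opprK. Qed.

Lemma enormB u v : enorm (u - v) = enorm (v - u).
Proof. by rewrite -enormN opprB. Qed.

Lemma enormZ c u : enorm (c *: u) = `|c| * enorm u.
Proof. by rewrite /enorm dotZl dotZr mulrA -expr2 sqrtrM ?sqr_ge0// sqrtr_sqr. Qed.

Lemma enorm_le c u : 0 <= c -> (enorm u <= c) = (dot u u <= c ^+ 2).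
Proof. by move=> c0; rewrite -sqr_enorm ler_sqr// nnegrE ?enorm_ge0. Qed.

Lemma cauchy_schwarz u v : dot u v <= enorm u * enorm v.
Proof.
have [uv|uv] := leP (dot u v) 0; first by rewrite (le_trans uv)// mulr_ge0 ?enorm_ge0.
rewrite -ler_sqr ?nnegrE ?mulr_ge0 ?enorm_ge0//; last exact: ltW.
rewrite exprMn !sqr_enorm !dotE.
set a := u 0 0; set b := u 0 1; set c := u 0 2%:R.
set x := v 0 0; set y := v 0 1; set z := v 0 2%:R.
(* Lagrange's identity: the defect is the squared length of the cross product. *)
rewrite -subr_ge0 (_ : _ - _ =
  (a * y - b * x) ^+ 2 + (a * z - c * x) ^+ 2 + (b * z - c * y) ^+ 2); last by ring.
by rewrite !addr_ge0 ?sqr_ge0.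
Qed.

Lemma enormD u v : enorm (u + v) <= enorm u + enorm v.
Proof.
rewrite enorm_le ?addr_ge0 ?enorm_ge0// dotDl !dotDr (dotC v u).
have := cauchy_schwarz u v; rewrite sqrrD -!sqr_enorm; lra.
Qed.

Lemma enorm_triangle u v w : enorm (u - w) <= enorm (u - v) + enorm (v - w).
Proof. by rewrite (le_trans _ (enormD _ _))// addrA subrK. Qed.

Lemma abs_dot_le u v : `|dot u v| <= enorm u * enorm v.
Proof.
rewrite ler_norml cauchy_schwarz andbT lerNl -dotNl.
by rewrite (le_trans (cauchy_schwarz _ _))// enormN.
Qed.

Lemma norm_le_enorm u : `|u| <= enorm u.
Proof.
rewrite -[`|u|]/(mx_norm u) mx_normrE; apply/bigmax_leP; split; first exact: enorm_ge0.
move=> -[i j] _ /=; rewrite ord1 -(@ger0_norm _ (enorm u)) ?enorm_ge0//.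
rewrite -ler_sqr ?nnegrE// -!normrX !ger0_norm ?sqr_ge0// sqr_enorm.
rewrite /dot (bigD1 j)//= -expr2 lerDl.
by apply: sumr_ge0 => k _; rewrite -expr2 sqr_ge0.
Qed.

Lemma dot_continuous u : continuous (fun v => dot v u).
Proof.
rewrite (_ : (fun v => _) = fun v : 'rV[R]_3 =>
  v 0 0 * u 0 0 + v 0 1 * u 0 1 + v 0 2%:R * u 0 2%:R); last first.
  by apply/funext => v; rewrite dotE.
do 2?[apply: continuous_add]; apply: continuous_mul;
  solve [move=> ?; exact: coord_continuous | exact: continuous_const].
Qed.

Lemma enorm_continuous : continuous (fun v : 'rV[R]_3 => enorm v).
Proof.
rewrite (_ : (fun v => _) = fun v : 'rV[R]_3 => Num.sqrt
  (v 0 0 * v 0 0 + v 0 1 * v 0 1 + v 0 2%:R * v 0 2%:R)); last first.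
  by apply/funext => v; rewrite /enorm dotE.
move=> v; apply: continuous_comp; last exact: sqrt_continuous.
move: v; do 2?[apply: continuous_add]; apply: continuous_mul;
  by move=> ?; exact: coord_continuous.
Qed.

(** Bridge from the topology, which comes from the sup norm, to Euclidean distances: the Euclidean
    norm dominates the sup norm. *)
Lemma open_enormP (U : set 'rV[R]_3) u : open U -> U u ->
  exists2 eps : R, 0 < eps & forall v, enorm (v - u) < eps -> U v.
Proof.
rewrite openE => /[apply] /nbhs_ballP[eps /= e0 uU]; exists eps => // v vu.
apply: uU; rewrite -ball_normE /= -normrN opprB.
exact: le_lt_trans (norm_le_enorm _) vu.
Qed.
End euclidean.

(** * Hausdorff measure of planar sets *)

Section hausdorff.
Context {R : realType}.
Implicit Types (A B U : set 'rV[R]_3) (delta : R).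
Local Open Scope ereal_scope.

Lemma diam_ge0 U : 0 <= diam U.
Proof. by apply: ereal_sup_ubound; left. Qed.

Lemma diam_ubound U x y : U x -> U y -> (enorm (x - y))%:E <= diam U.
Proof. by move=> Ux Uy; apply: ereal_sup_ubound; right; exists (x, y). Qed.

Lemma diam_le U (r : \bar R) : 0 <= r ->
  (forall x y, U x -> U y -> (enorm (x - y))%:E <= r) -> diam U <= r.
Proof.
move=> r0 Ur; apply: ge_ereal_sup => _ [->//|[[x y]/= [Ux Uy] <-]].
exact: Ur.
Qed.

Lemma diam0 : diam (set0 : set 'rV[R]_3) = 0.
Proof. by apply/eqP; rewrite eq_le diam_ge0 andbT; apply: diam_le. Qed.

Definition diam_cost U : \bar R := (pi / 4)%:E * diam U ^+ 2.

Lemma diam_cost_ge0 U : 0 <= diam_cost U.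
Proof.
by rewrite mule_ge0 ?sqreD_ge0// ?lee_fin ?divr_ge0 ?pi_ge0//; rewrite expe_ge0 ?diam_ge0.
Qed.

Let discrete := g_sigma_algebraType [set: set 'rV[R]_3].

(* Turning the diameter constraint into an infinite cost makes [area_delta] an
   instance of the library's outer measure construction. *)
Let cost delta (U : set discrete) : \bar R :=
  if @diam R U <= delta%:E then diam_cost U else +oo.

Let cost0 delta : (0 <= delta)%R -> cost delta set0 = 0.
Proof. by move=> d0; rewrite /cost /diam_cost diam0 lee_fin d0 expe2 !mule0. Qed.

Let cost_ge0 delta U : 0 <= cost delta U.
Proof. by rewrite /cost; case: ifP => // _; exact: diam_cost_ge0. Qed.

Let area_delta_ext delta A : area_delta delta A = mu_ext (cost delta) A.
Proof.
apply/eqP; rewrite eq_le; apply/andP; split; apply: le_ereal_inf_tmp => _ [U /= [] HU1 HU2 <-].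
  have [Ud|/existsNP[i /negP Ui]] := pselect (forall i, diam (U i) <= delta%:E); last first.
    rewrite (@eseries_pinfty _ _ _ i) ?leey// => [n _|].
      by rewrite gt_eqF// (lt_le_trans _ (cost_ge0 _ _)).
    by rewrite /cost (negbTE Ui).
  apply: ereal_inf_lbound; exists U => //; apply: eq_eseriesr => i _.
  by rewrite /cost Ud.
apply: ereal_inf_lbound; exists U.
  by split=> // i; apply: sub_sigma_algebra.
by apply: eq_eseriesr => i _; rewrite /cost HU2.
Qed.

Lemma area_delta_ge0 delta A : 0 <= area_delta delta A.
Proof. by rewrite area_delta_ext; apply: mu_ext_ge0. Qed.

Lemma area_delta_subadditive delta (F : (set 'rV[R]_3)^nat) :
  area_delta delta (\bigcup_n F n) <= \sum_(i <oo) area_delta delta (F i).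
Proof.
rewrite area_delta_ext (eq_eseriesr (fun i _ => area_delta_ext delta (F i))).
exact: mu_ext_sigma_subadditive.
Qed.

Lemma le_area_delta delta A B : A `<=` B -> area_delta delta A <= area_delta delta B.
Proof. by move=> AB; rewrite !area_delta_ext; exact: le_mu_ext. Qed.

Lemma area_delta_le_area delta A : (0 < delta)%R -> area_delta delta A <= area A.
Proof. by move=> d0; apply: ereal_sup_ubound; exists delta. Qed.

Let area0 : area (set0 : set 'rV[R]_3) = 0.
Proof.
apply/eqP; rewrite eq_le; apply/andP; split.
  apply: ge_ereal_sup => _ [d /= d0 <-]; rewrite area_delta_ext mu_ext0//.
  exact/cost0/ltW.
by rewrite (le_trans _ (area_delta_le_area _ (@ltr01 R)))// area_delta_ge0.
Qed.

Let area_ge0 A : 0 <= area A.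
Proof.
by rewrite (le_trans _ (area_delta_le_area _ (@ltr01 R)))// area_delta_ge0.
Qed.

Let le_area : {homo @area R : A B / A `<=` B >-> A <= B}.
Proof.
move=> A B AB; apply: ge_ereal_sup => _ [d /= d0 <-].
by rewrite (le_trans (le_area_delta d AB))// area_delta_le_area.
Qed.

Let area_subadditive : sigma_subadditive (@area R).
Proof.
move=> F; apply: ge_ereal_sup => _ [d /= d0 <-].
rewrite (le_trans (area_delta_subadditive _ _))//.
by apply: lee_nneseries => [i _ _|i _]; [exact: area_delta_ge0|exact: area_delta_le_area].
Qed.

HB.instance Definition _ := isOuterMeasure.Build R 'rV[R]_3 (@area R)
  area0 area_ge0 le_area area_subadditive.

(** A cover of one image is pulled back to the parameters and pushed to the other image, where its
    pieces are at most [c] times as wide. Comparing two parametrisations over the same [E] spares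
    naming an inverse map. *)
Lemma area_lipschitz T (F G : T -> 'rV[R]_3) (E : set T) (c : R) : (0 < c)%R ->
  (forall x y, E x -> E y -> (enorm (F x - F y) <= c * enorm (G x - G y))%R) ->
  area (F @` E) <= (c ^+ 2)%:E * area (G @` E).
Proof.
move=> c0 FG.
have c20 : (0 < c ^+ 2)%R by rewrite exprn_gt0.
apply: ge_ereal_sup => _ [d /= d0 <-].
rewrite -lee_pdivrMl//.
(* Mesh [d / c] on the side of [G] becomes mesh [d] on the side of [F]. *)
apply: le_trans (area_delta_le_area _ (divr_gt0 d0 c0)).
apply: le_ereal_inf_tmp => _ [U /= [GEU Ud] <-].
rewrite lee_pdivrMl// -nneseriesZl//; last by move=> i _; exact: diam_cost_ge0.
pose V i := F @` (E `&` G @^-1` U i).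
have VU i : diam (V i) <= c%:E * diam (U i).
  apply: diam_le => [|_ _ [x [Ex Ux] <-] [y [Ey Uy] <-]].
    by rewrite mule_ge0 ?diam_ge0// lee_fin ltW.
  have /(lee_wpmul2l _) : (enorm (G x - G y))%:E <= diam (U i) by exact: diam_ubound.
  move=> /(_ c%:E (ltW c0)); apply: le_trans.
  by rewrite -EFinM lee_fin FG.
apply: (@le_trans _ _ (\sum_(i <oo) diam_cost (V i))).
  apply: ereal_inf_lbound; exists V => //; split.
    move=> _ [x Ex <-]; have [i _ Ui] := GEU _ (imageP G Ex).
    by exists i => //; exists x.
  move=> i; rewrite (le_trans (VU i))// -lee_pdivlMl// muleC -EFinM mulrC.
  by rewrite mulrC; exact: Ud.
apply: lee_nneseries => i _; first by move=> _; exact: diam_cost_ge0.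
rewrite muleCA /diam_cost lee_wpmul2l ?lee_fin ?divr_ge0 ?pi_ge0//.
rewrite (@le_trans _ _ ((c%:E * diam (U i)) ^+ 2))//.
  by rewrite !expe2 lee_pmul ?diam_ge0.
by rewrite !expe2 expr2 EFinM muleACA.
Qed.

Lemma area_isometry T (F G : T -> 'rV[R]_3) (E : set T) :
  (forall x y, E x -> E y -> enorm (F x - F y) = enorm (G x - G y)) ->
  area (F @` E) = area (G @` E).
Proof.
move=> FG; apply/eqP; rewrite eq_le; apply/andP; split.
  have := @area_lipschitz _ F G E 1 ltr01; rewrite expr1n mul1e; apply=> x y Ex Ey.
  by rewrite mul1r FG.
have := @area_lipschitz _ G F E 1 ltr01; rewrite expr1n mul1e; apply=> x y Ex Ey.
by rewrite mul1r FG.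
Qed.

End hausdorff.

(** * Borel sets are Caratheodory measurable for the area *)

Section caratheodory_criterion.
Context {R : realType}.
Implicit Types (A B U X : set 'rV[R]_3) (d : R).
Local Open Scope ereal_scope.

Lemma ge_area_delta d d' A : (d <= d')%R -> area_delta d' A <= area_delta d A.
Proof.
move=> dd'; apply: ereal_inf_le_tmp => _ [U [AU Ud] <-]; exists U => //; split=> // i.
by rewrite (le_trans (Ud i))// lee_fin.
Qed.

(** A piece of diameter below [eps] cannot meet both sets, so a fine cover of the union splits into
    a cover of [A] and a cover of [B]. *)
Lemma area_separated A B (eps : R) : (0 < eps)%R ->
  (forall x y, A x -> B y -> (eps <= enorm (x - y))%R) ->
  area A + area B <= area (A `|` B).
Proof.
move=> e0 AB.
have H d : (0 < d)%R -> (d < eps)%R ->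
    area_delta d A + area_delta d B <= area (A `|` B).
  move=> d0 de; apply: le_trans (area_delta_le_area _ d0).
  apply: le_ereal_inf_tmp => _ [U [ABU Ud] <-].
  pose V i := if `[< U i `&` A !=set0 >] then U i else set0.
  pose W i := if `[< U i `&` A !=set0 >] then set0 else U i.
  rewrite (eq_eseriesr (g := fun i => diam_cost (V i) + diam_cost (W i))).
    rewrite nneseriesD; try by move=> ? _ _; exact: diam_cost_ge0.
    apply: leeD; apply: ereal_inf_lbound.
      exists V => //; split=> [x Ax|i]; last first.
        by rewrite /V; case: ifP => // _; rewrite diam0 lee_fin ltW.
      have [i _ Uix] := ABU x (or_introl Ax); exists i => //.
      by rewrite /V; case: asboolP => // -[]; exists x.
    exists W => //; split=> [x Bx|i]; last first.
      by rewrite /W; case: ifP => // _; rewrite diam0 lee_fin ltW.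
    have [i _ Uix] := ABU x (or_intror Bx); exists i => //.
    rewrite /W; case: asboolP => // -[y [Uy Ay]].
    have := le_trans (diam_ubound Uy Uix) (Ud i); rewrite lee_fin leNgt.
    by rewrite (lt_le_trans de)// AB.
  move=> i _; have c0 : diam_cost (set0 : set 'rV[R]_3) = 0.
    by rewrite /diam_cost diam0 expe2 !mule0.
  by rewrite /V /W -/(diam_cost _); case: ifP; rewrite c0 ?adde0 ?add0e.
(* Independent meshes let the two suprema be taken one after the other; the subtractions involved
   require finite areas, whence the case distinction below. *)
have H2 d1 d2 : (0 < d1)%R -> (0 < d2)%R ->
    area_delta d1 A + area_delta d2 B <= area (A `|` B).
  move=> d10 d20; pose d : R := Num.min (Num.min d1 d2) (eps / 2)%R.
  apply: le_trans (H d _ _).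
  - by apply: leeD; apply: ge_area_delta; rewrite /d !ge_min lexx ?orbT.
  - by rewrite /d !lt_min d10 d20 divr_gt0.
  - by rewrite /d gt_min ltr_pdivrMr// ltr_pMr// ltr1n orbT.
have [Moo|] := ltP (area (A `|` B)) +oo; last by rewrite leye_eq => /eqP ->; rewrite leey.
have Afin A' : A' `<=` A `|` B -> area A' \is a fin_num.
  move=> A'AB; rewrite ge0_fin_numE ?outer_measure_ge0// (le_lt_trans _ Moo)//.
  exact: le_outer_measure.
have Adfin d A' : (0 < d)%R -> A' `<=` A `|` B -> area_delta d A' \is a fin_num.
  move=> d0 /Afin A'fin; rewrite ge0_fin_numE ?area_delta_ge0//.
  by rewrite (le_lt_trans (area_delta_le_area _ d0))// ltey_eq A'fin.
rewrite -leeBrDr ?Afin//; apply: ge_ereal_sup => _ [d1 /= d10 <-].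
rewrite leeBrDr ?Afin// addeC -leeBrDr ?Adfin//.
apply: ge_ereal_sup => _ [d2 /= d20 <-].
by rewrite leeBrDr ?Adfin// addeC H2.
Qed.

Section layers.
Variable phi : 'rV[R]_3 -> R.
Hypothesis phi_lip : forall x y, (`|phi x - phi y| <= enorm (x - y))%R.

Let r n : R := n.+1%:R^-1.

Let r_decr m n : (m < n)%N -> (r n < r m)%R.
Proof. by move=> mn; rewrite /r ltf_pV2 ?posrE// ltr_nat ltnS. Qed.

Let r_noninc m n : (m <= n)%N -> (r n <= r m)%R.
Proof. by rewrite leq_eqVlt => /predU1P[->//|/r_decr/ltW]. Qed.

Let area_phi_separated A B a b : (b < a)%R ->
  A `<=` [set x | a <= phi x]%R -> B `<=` [set x | phi x <= b]%R ->
  area A + area B <= area (A `|` B).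
Proof.
move=> ba Aa Bb; apply: (@area_separated _ _ (a - b)); first by rewrite subr_gt0.
move=> x y /Aa/= ax /Bb/= yb; rewrite (le_trans _ (phi_lip _ _))//.
by rewrite (le_trans _ (ler_norm _))// lerB.
Qed.

Variable X : set 'rV[R]_3.
Hypothesis Xoo : area X < +oo.

(* Layers of the same parity are at positive distance from one another, hence the
   areas of all layers are summable. *)
Let ring k := X `&` [set x | r k.+1 <= phi x < r k]%R.

Let area_rings p n : \sum_(k < n) area (ring (k.*2 + p)) <= area X.
Proof.
suff: \sum_(k < n) area (ring (k.*2 + p)) <= area (\bigcup_(k < n) ring (k.*2 + p)).
  by move=> /le_trans; apply; apply: le_outer_measure => x [k _ []].
elim: n => [|n IHn]; first by rewrite big_ord0 outer_measure_ge0.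
rewrite big_ord_recr/= (bigcup_mkord n.+1 (fun k => ring (k.*2 + p))) big_ord_recr/=.
rewrite -(bigcup_mkord n (fun k => ring (k.*2 + p))).
apply: le_trans (leeD2r _ IHn) _.
have [->|n0] := eqVneq n 0%N.
  by rewrite bigcup_mkord big_ord0 outer_measure0 add0e set0U.
(* The earlier rings lie where [phi] is at least [r (2n + p - 1)], the new one where it is below
   [r (2n + p)]: the skipped ring of the other parity is the gap. *)
apply: (@area_phi_separated _ _ (r (n.*2 + p).-1) (r (n.*2 + p))).
- by apply: r_decr; rewrite prednK ?addn_gt0 ?double_gt0 ?lt0n ?n0.
- move=> x [k /= kn [_ /= /andP[kx _]]]; rewrite (le_trans _ kx)// r_noninc//.
  rewrite -ltnS prednK ?addn_gt0 ?double_gt0 ?lt0n ?n0//.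
  by rewrite -2!addSn leq_add2r -doubleS leq_double.
- by move=> x [_ /= /andP[_ /ltW]].
Qed.

Let sum_area_rings_lt : \sum_(0 <= k <oo) area (ring k) < +oo.
Proof.
apply: (@le_lt_trans _ _ (area X + area X)); last by rewrite lte_add_pinfty.
apply: lime_le; first by apply: is_cvg_nneseries => *; exact: outer_measure_ge0.
near=> n; apply: (@le_trans _ _ (\sum_(0 <= k < n.*2) area (ring k))).
  rewrite [leRHS](@big_cat_nat _ _ _ n)//=; last by rewrite -addnn leq_addr.
  by rewrite leeDl// sume_ge0// => *; exact: outer_measure_ge0.
suff -> : \sum_(0 <= k < n.*2) area (ring k) =
    \sum_(k < n) area (ring (k.*2 + 0)) + \sum_(k < n) area (ring (k.*2 + 1)).
  by apply: leeD; exact: area_rings.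
elim: (n) => [|m IHm]; first by rewrite double0 big_geq// !big_ord0 adde0.
rewrite doubleS !big_nat_recr//= IHm !big_ord_recr/= addn0 addn1.
by rewrite -!addeA; congr (_ + _); rewrite addeCA.
Unshelve. all: by end_near. Qed.

(** The part of [X] where [phi] is at least [r n] is at positive distance from the part where [phi]
    is not positive. What remains lies in the layers beyond [n], whose total area is the tail of a
    convergent series. *)
Lemma area_layers :
  area (X `&` [set x | 0 < phi x]%R) + area (X `&` ~` [set x | 0 < phi x]%R) <= area X.
Proof.
set P := [set x | _]; pose S n := X `&` [set x | r n <= phi x]%R.
have tail n : area (X `&` P) + area (X `&` ~` P) <=
    area X + \sum_(n <= k <oo) area (ring k).
  have XP : area (X `&` P) <= area (S n) + \sum_(n <= k <oo) area (ring k).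
    apply: (@le_trans _ _ (area (S n `|` \bigcup_(k in ~` `I_n) ring k))).
      apply: le_outer_measure => x [Xx /= px].
      have [rx|xr] := leP (r n) (phi x); [by left|right].
      have [m rm] : exists m, (r m <= phi x)%R.
        have [m _ /(_ m (leqnn m))/= xm] : \forall m \near \oo, (r m <= phi x)%R.
          have := @cvgr_le R _ _ _ (fun m => r m) 0 (@cvg_harmonic R) _ px.
          exact.
        by exists m.
      have [k /andP[nk]] : exists k, (n <= k)%N && (r k.+1 <= phi x < r k)%R.
        have ex : exists m, (r m <= phi x)%R by exists m.
        case: (ex_minnP ex) => k rk kmin.
        have nk : (n < k)%N.
          by rewrite ltnNge; apply: contraTN xr => /r_noninc rkn; rewrite -leNgt (le_trans rkn).
        exists k.-1; rewrite (ltn_predK nk) rk/= -ltnS (ltn_predK nk) nk/= ltNge.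
        by apply: contraL isT => /kmin; rewrite -ltnS (ltn_predK nk) ltnn.
      by move=> kx; exists k => //=; apply/negP; rewrite -leqNgt.
    apply: le_trans (outer_measureU2 _ _ _) _; apply: leeD => //.
    exact: outer_measure_sigma_subadditive_tail.
  apply: le_trans (leeD2r _ XP) _; rewrite addeAC leeD2r//.
  apply: (@le_trans _ _ (area (S n `|` (X `&` ~` P)))).
    apply: (@area_phi_separated _ _ (r n) 0%R); first by rewrite invr_gt0.
      by move=> x [].
    by move=> x [_ /= /negP]; rewrite -leNgt.
  by apply: le_outer_measure => x [] [].
have c0 := nneseries_tail_cvg sum_area_rings_lt (fun k _ => outer_measure_ge0 _ (ring k)).
have cX : (area X + \sum_(n <= k <oo) area (ring k)) @[n --> \oo] --> area X.
  rewrite -[X in _ --> X]adde0; apply: cvgeD => //; last exact: cvg_cst.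
  by rewrite fin_num_adde_defl.
rewrite -(cvg_lim (@ereal_hausdorff R) cX); apply: lime_ge; first by apply/cvg_ex; exists (area X).
by near=> n; exact: tail.
Unshelve. all: by end_near. Qed.

End layers.

(* Caratheodory's criterion, applied to the distance to the complement of [U]. *)
Lemma area_caratheodory_open U : open U -> (@area R).-caratheodory U.
Proof.
move=> oU; apply: le_caratheodory_measurable => X.
have [Xoo|] := ltP (area X) +oo; last first.
  by rewrite leye_eq => /eqP Xoo; rewrite [leRHS]Xoo leey.
(* The whole space is set apart: its complement is empty, and [inf] of the empty set is 0 instead of
   infinite. *)
have [UT|] := eqVneq U setT.
  by rewrite UT setIT setCT setI0 outer_measure0 adde0.
move=> /setTPn[y0 Uy0]; have Un0 : ~` U !=set0 by exists y0.
pose D x : set R := [set enorm (x - y) | y in ~` U].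
have D0 x : D x !=set0 by case: Un0 => y Uy; exists (enorm (x - y)), y.
have Dlb x : has_lbound (D x) by exists 0%R => _ [y _ <-]; exact: enorm_ge0.
have step x y : (inf (D x) - enorm (x - y) <= inf (D y))%R.
  apply: lb_le_inf => // _ [z Uz <-]; rewrite lerBlDl.
  rewrite (le_trans _ (enorm_triangle _ y _))//.
  by apply: ge_inf => //; exists z.
rewrite (_ : U = [set x | 0 < inf (D x)]%R).
  apply: area_layers => // x y.
  have := step x y; have := step y x; rewrite enormB ler_norml; lra.
apply/seteqP; split=> [x Ux /=|x /=].
  have [e e0 eU] := open_enormP oU Ux; rewrite (lt_le_trans e0)//.
  apply: lb_le_inf => // _ [y Uy <-]; rewrite leNgt.
  by apply/negP => xy; apply: Uy; apply: eU; rewrite enormB.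
move=> x0; apply: contrapT => Ux; move: x0; apply/negP; rewrite -leNgt.
by apply: ge_inf => //; exists x => //; rewrite subrr enorm0.
Qed.

Lemma borel_caratheodory (A : set (borelR3 R)) :
  measurable A -> (@area R).-caratheodory A.
Proof.
apply: smallest_sub => [|U oU]; last exact: area_caratheodory_open.
split; first exact: caratheodory_measurable_set0.
  by move=> B mB; rewrite setTD; exact: caratheodory_measurable_setC.
by move=> F mF; exact: caratheodory_measurable_bigcup.
Qed.

Let area_sigma_additive : semi_sigma_additive (@area R : set (borelR3 R) -> \bar R).
Proof.
move=> F mF tF mUF; apply: (@caratheodory_measure_sigma_additive R 'rV[R]_3 (@area R)).
- by move=> i; exact: borel_caratheodory.
- by [].
- exact: borel_caratheodory.
Qed.

Definition hausdorff2 (A : set (borelR3 R)) : \bar R := area A.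

HB.instance Definition _ := isMeasure.Build _ _ _ hausdorff2
  (outer_measure0 (@area R)) (outer_measure_ge0 (@area R)) area_sigma_additive.

End caratheodory_criterion.

(** * Translation-invariant measures on the line and on the plane *)

Section translation_invariance_line.
Context {R : realType}.
Variable mu : {measure set (measurableTypeR R) -> \bar R}.
Variable k : R.
Hypothesis mu1 : mu `]0%R, 1%R]%classic = k%:E.
Hypothesis muT : forall (A : set (measurableTypeR R)) x, measurable A ->
  mu ((fun s : R => s + x) @^-1` A) = mu A.
Local Open Scope ereal_scope.

Let k_ge0 : (0 <= k)%R.
Proof. by rewrite -lee_fin -mu1. Qed.

Let mu_itv a b : mu `]a, b]%classic = mu `]0%R, (b - a)%R]%classic.
Proof.
rewrite -(@muT `]a, b]%classic a) //; congr (mu _); apply/seteqP; split => s /=;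
  rewrite !in_itv/=; lra.
Qed.

Let mu_add (x y : R) : (0 <= x)%R -> (0 <= y)%R ->
  mu `]0%R, (x + y)%R]%classic = mu `]0%R, x]%classic + mu `]0%R, y]%classic.
Proof.
move=> x0 y0; have -> : mu `]0%R, y]%classic = mu `]x, (x + y)%R]%classic.
  by rewrite (mu_itv x) addrAC subrr add0r.
rewrite -measureU//; last first.
  by apply/seteqP; split => s //=; rewrite !in_itv/= => -[/andP[? ?] /andP[? ?]]; lra.
congr (mu _); apply/seteqP; split => s /=; rewrite !in_itv/=.
  by move=> /andP[s0 sxy]; have [sx|sx] := leP s x; [left|right]; rewrite ?s0 ?sx.
by move=> [|] /andP[? ?]; apply/andP; split; lra.
Qed.

Let mu_natmul n (x : R) : (0 <= x)%R ->
  mu `]0%R, (n%:R * x)%R]%classic = n%:R%:E * mu `]0%R, x]%classic.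
Proof.
move=> x0; elim: n => [|n IHn].
  by rewrite !mul0r mul0e set_itv_ge ?measure0// bnd_simp ltxx.
rewrite -natr1 mulrDl mul1r mu_add ?mulr_ge0// IHn.
by rewrite EFinD ge0_muleDl ?mul1e// lee_fin.
Qed.

Let mu_le (x y : R) : (x <= y)%R -> mu `]0%R, x]%classic <= mu `]0%R, y]%classic.
Proof.
move=> xy; apply: le_measure; rewrite ?inE// => s /=; rewrite !in_itv/=.
by move=> /andP[-> /le_trans->].
Qed.

Let mu_nat n : mu `]0%R, n%:R]%classic = (n%:R * k)%:E.
Proof. by rewrite -[n%:R%R]mulr1 mu_natmul// mu1 EFinM mulr1. Qed.

Let mu_len (x : R) : (0 <= x)%R -> mu `]0%R, x]%classic = (x * k)%:E.
Proof.
move=> x0; have fin : mu `]0%R, x]%classic \is a fin_num.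
  rewrite ge0_fin_numE ?measure_ge0//.
  have xn : (x <= (Num.truncn x).+1%:R)%R by rewrite ltW// truncnS_gt.
  by rewrite (le_lt_trans (mu_le xn))// mu_nat ltry.
rewrite -(fineK fin); congr EFin; set F := fine _.
(* The length of [n] adjacent copies of the interval lies between two consecutive integers, at which
   the measure is known; so [n] times the error stays below [k] for every [n]. *)
have step n : (`|F - x * k| * n%:R <= k)%R.
  have nx0 : (0 <= n%:R * x)%R by rewrite mulr_ge0.
  have := mu_natmul n x0; rewrite -(fineK fin) -/F -EFinM => mnx.
  have h1 : (Num.truncn (n%:R * x))%:R%:E * k%:E <= (n%:R * F)%:E.
    by rewrite -EFinM -mu_nat -mnx; apply: mu_le; rewrite truncn_le.
  have h2 : (n%:R * F)%:E <= ((Num.truncn (n%:R * x)).+1%:R * k)%:E.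
    by rewrite -mu_nat -mnx; apply: mu_le; rewrite ltW// truncnS_gt.
  move: h1 h2; rewrite -EFinM !lee_fin -natr1 mulrDl mul1r => h1 h2.
  have t1 : ((Num.truncn (n%:R * x))%:R <= n%:R * x)%R by rewrite truncn_le.
  have t2 : (n%:R * x <= (Num.truncn (n%:R * x))%:R + 1)%R.
    by rewrite natr1 ltW// truncnS_gt.
  have := ler_wpM2r k_ge0 t1; have := ler_wpM2r k_ge0 t2; rewrite mulrDl mul1r => t2' t1'.
  rewrite -[n%:R%R]ger0_norm// -normrM ler_norml !mulrBl; apply/andP; split; nra.
apply/eqP; rewrite -subr_eq0 -normr_le0 leNgt; apply/negP => e0.
have := step (Num.truncn (k / `|F - x * k|)%R).+1; apply/negP; rewrite -ltNge.
by rewrite mulrC -ltr_pdivrMr// truncnS_gt.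
Qed.

Lemma translation_invariant_line A : measurable A -> mu A = k%:E * lebesgue_measure A.
Proof.
move=> mA; pose K := NngNum k_ge0.
rewrite -[RHS]/(mscale K (@lebesgue_measure R) A).
apply: (@measure_unique _ R (measurableTypeR R) (@ocitv R)
  (fun n => `](- n%:R)%R, n%:R]%classic) _ _ _ _ mu (mscale K (@lebesgue_measure R))) => //.
- exact: ocitvI.
- by move=> n; exact: is_ocitv.
- exact: bigcup_itvT.
- move=> _ [[a b] _ <-] /=; rewrite /mscale/=.
  rewrite lebesgue_measure_itv/= lte_fin.
  case: ifPn => [ab|]; last by move=> ab; rewrite set_itv_ge ?measure0 ?mule0.
  by rewrite mu_itv mu_len ?subr_ge0 1?ltW// mulrC -EFinD -EFinM.
- by move=> n; rewrite mu_itv mu_len ?ltry// opprK addr_ge0.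
Qed.

End translation_invariance_line.

(** Packaged as an existence statement with a formula for the values, so that later measures are
    handled through their values alone. *)
Lemma pushforward_measureP d1 d2 (T1 : measurableType d1) (T2 : measurableType d2)
    (R : realType) (m : {measure set T1 -> \bar R}) (f : T1 -> T2) :
  measurable_fun setT f ->
  exists nu : {measure set T2 -> \bar R}, forall A, nu A = m (f @^-1` A).
Proof.
move=> mf; suff [nu nuE] : exists nu : {measure set T2 -> \bar R}, pushforward m f = nu.
  by exists nu => A; rewrite -nuE.
eexists; refine (erefl _).
Unshelve. exact: mf.
Qed.

Notation plane R := (measurableTypeR R * measurableTypeR R)%type.

Notation lebesgue2 := (lebesgue_measure \x lebesgue_measure)%E.

Section translation_invariance_plane.
Context {R : realType}.
Variable mu : {measure set (plane R) -> \bar R}.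
Variable k : R.
Hypothesis mu1 : mu (`]0%R, 1%R]%classic `*` `]0%R, 1%R]%classic) = k%:E.
Hypothesis muT : forall (A B : set (measurableTypeR R)) x y,
  measurable A -> measurable B ->
  mu (((fun s : R => s + x) @^-1` A) `*` ((fun s : R => s + y) @^-1` B)) = mu (A `*` B).
Local Open Scope ereal_scope.

Let k_ge0 : (0 <= k)%R.
Proof. by rewrite -lee_fin -mu1. Qed.

Let strip1 (B : set (measurableTypeR R)) (mB : measurable B) :
  exists nu : {measure set (measurableTypeR R) -> \bar R},
    forall A, nu A = mu (A `*` B).
Proof.
have mTB : measurable ([set: measurableTypeR R] `*` B) by exact: measurableX.
have [nu nuE] := pushforward_measureP (mrestr mu mTB) (@measurable_fst _ _ _ _).
exists nu => A; rewrite nuE /mrestr; congr (mu _).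
by apply/seteqP; split => -[x y] /= [] // ? [].
Qed.

Let strip2 (A : set (measurableTypeR R)) (mA : measurable A) :
  exists nu : {measure set (measurableTypeR R) -> \bar R},
    forall B, nu B = mu (A `*` B).
Proof.
have mAT : measurable (A `*` [set: measurableTypeR R]) by exact: measurableX.
have [nu nuE] := pushforward_measureP (mrestr mu mAT) (@measurable_snd _ _ _ _).
exists nu => B; rewrite nuE /mrestr; congr (mu _).
by apply/seteqP; split => -[x y] /= [] // ? [].
Qed.

Let mu_rect1 A : measurable A ->
  mu (A `*` `]0%R, 1%R]%classic) = k%:E * lebesgue_measure A.
Proof.
move=> mA; have [nu nuE] := strip1 (measurable_itv `]0%R, 1%R]).
rewrite -nuE; apply: translation_invariant_line => //; first by rewrite nuE.
move=> B x mB; rewrite !nuE -(@muT B `]0%R, 1%R]%classic x 0%R)//; congr (mu (_ `*` _)).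
by rewrite (_ : (fun s => _) = id) ?preimage_id//; apply/funext => s; rewrite addr0.
Qed.

(** One factor at a time: for fixed [A] the measure of [A] times [B] is translation invariant in
    [B], and [mu_rect1] gives its value on the unit interval, a real number because [A] has finite
    measure. *)
Let mu_rect_fin A B : measurable A -> measurable B -> lebesgue_measure A < +oo ->
  mu (A `*` B) = k%:E * (lebesgue_measure A * lebesgue_measure B).
Proof.
move=> mA mB Aoo; have [nu nuE] := strip2 mA.
have fA : lebesgue_measure A = (fine (lebesgue_measure A))%:E.
  by rewrite fineK// ge0_fin_numE.
rewrite -nuE muleA fA -EFinM; apply: translation_invariant_line => //.
  by rewrite nuE mu_rect1// fA EFinM.
move=> C x mC; rewrite !nuE -(@muT A C 0%R x)//; congr (mu (_ `*` _)).
by rewrite (_ : (fun s => _) = id) ?preimage_id//; apply/funext => s; rewrite addr0.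
Qed.

Let K := NngNum k_ge0.

Let Q n : set (measurableTypeR R) := `](- n%:R)%R, n%:R]%classic.

Let mQ n : measurable (Q n).
Proof. exact: measurable_itv. Qed.

Let Q_nd m n : (m <= n)%N -> Q m `<=` Q n.
Proof.
move=> mn s; rewrite /Q /= !in_itv/= => /andP[s1 s2].
have : (m%:R <= n%:R :> R)%R by rewrite ler_nat.
by move=> ?; apply/andP; split; lra.
Qed.

Let Qoo n : lebesgue_measure (Q n) < +oo.
Proof. by rewrite lebesgue_measure_itv/=; case: ifP => // _; rewrite -EFinD ltry. Qed.

Let mu_rect A B : measurable A -> measurable B ->
  mu (A `*` B) = mscale K lebesgue2 (A `*` B).
Proof.
move=> mA mB.
pose F n := (A `&` Q n) `*` (B `&` Q n).
have mF n : measurable (F n) by apply: measurableX; apply: measurableI => //; exact: mQ.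
have UF : \bigcup_n F n = A `*` B.
  have QT : \bigcup_n Q n = setT by exact: bigcup_itvT.
  apply/seteqP; split => [[x y] [n _ [[? _] [? _]]]//|[x y] [/= Ax By]].
  have [m _ mx] : (\bigcup_n Q n) x by rewrite QT.
  have [n _ ny] : (\bigcup_n Q n) y by rewrite QT.
  exists (maxn m n) => //; split; split => //=.
    exact: (Q_nd (leq_maxl m n) mx).
  exact: (Q_nd (leq_maxr m n) ny).
have ndF : nondecreasing_seq F.
  move=> m n mn; apply/subsetPset => -[x y] [[/= ? Qx] [/= ? Qy]].
  by split; split => //=; [exact: (Q_nd mn Qx)|exact: (Q_nd mn Qy)].
have mUF : measurable (\bigcup_n F n) by rewrite UF; exact: measurableX.
have FE : mscale K lebesgue2 \o F = mu \o F.
  apply/funext => n /=; rewrite /mscale/= mu_rect_fin.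
  - rewrite product_measure1E//; apply: measurableI => //; exact: mQ.
  - by apply: measurableI => //; exact: mQ.
  - by apply: measurableI => //; exact: mQ.
  - rewrite (le_lt_trans _ (Qoo n))//; apply: le_measure; rewrite ?inE; last by move=> ? [].
      by apply: measurableI => //; exact: mQ.
    exact: mQ.
have := @nondecreasing_cvg_mu _ _ _ mu F mF mUF ndF.
have := @nondecreasing_cvg_mu _ _ _ (mscale K lebesgue2) F mF mUF ndF.
rewrite FE UF.
by move=> /(cvg_lim (@ereal_hausdorff R)) <- /(cvg_lim (@ereal_hausdorff R)) <-.
Qed.

Lemma translation_invariant_plane E : measurable E -> mu E = k%:E * lebesgue2 E.
Proof.
move=> mE; rewrite -[RHS]/(mscale K lebesgue2 E).
pose C : set (set (plane R)) := [set A `*` B | A in measurable & B in measurable].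
apply: (@measure_unique _ R (plane R) C (fun n => Q n `*` Q n) _ _ _ _ mu
  (mscale K lebesgue2)) => //.
- exact: measurable_prod_measurableType.
- move=> _ _ [A1 mA1 [B1 mB1 <-]] [A2 mA2 [B2 mB2 <-]]; rewrite -setXI.
  exists (A1 `&` A2); first exact: measurableI.
  by exists (B1 `&` B2) => //; exact: measurableI.
- by move=> n; exists (Q n) => //; exists (Q n).
- have QT : \bigcup_n Q n = setT by exact: bigcup_itvT.
  apply/seteqP; split => // -[x y] _.
  have [m _ mx] : (\bigcup_n Q n) x by rewrite QT.
  have [n _ ny] : (\bigcup_n Q n) y by rewrite QT.
  exists (maxn m n) => //; split => /=.
    exact: (Q_nd (leq_maxl m n) mx).
  exact: (Q_nd (leq_maxr m n) ny).
- by move=> _ [A mA [B mB <-]]; exact: mu_rect.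
- move=> n; rewrite mu_rect_fin// lte_mul_pinfty ?lee_fin//.
  by rewrite lte_mul_pinfty// ge0_fin_numE.
Qed.

End translation_invariance_plane.

(** * Borel sets of the plane and of R^3, and areas carried by a surface *)

Section borel_sets.
Context {R : realType}.

Lemma open_measurable3 (U : set 'rV[R]_3) : open U -> measurable (U : set (borelR3 R)).
Proof. by move=> oU; exact: sub_sigma_algebra. Qed.

Lemma closed_measurable3 (F : set 'rV[R]_3) : closed F -> measurable (F : set (borelR3 R)).
Proof. by move=> /closed_openC/open_measurable3/measurableC; rewrite setCK. Qed.

(** The plane carries the product sigma-algebra, so an open set has to be exhausted by countably
    many rectangles: those with rational centre and half-width 1 / (n + 1) that it contains. *)
Lemma open_measurable_plane (U : set (R * R)) : open U -> measurable (U : set (plane R)).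
Proof.
move=> oU.
pose S (n : nat) (p q : rat) : set (plane R) :=
  `](ratr p - n.+1%:R^-1 : R), ratr p + n.+1%:R^-1[%classic `*`
  `](ratr q - n.+1%:R^-1 : R), ratr q + n.+1%:R^-1[%classic.
pose T n p q := if `[< S n p q `<=` U >] then S n p q else set0.
have -> : U = \bigcup_n \bigcup_p \bigcup_q T n p q.
  apply/seteqP; split => [[x y] Uxy|[x y] [n _ [p _ [q _]]]]; last first.
    by rewrite /T; case: asboolP => // + Sxy; exact.
  have := oU; rewrite openE => /(_ _ Uxy) /nbhs_ballP[e /= e0 xyU].
  pose n := Num.truncn (2 / e).
  (* Twice the half-width is below [e], so a square of this size around a rational point close to
     (x, y) stays in the ball. *)
  have n0 : 0 < n.+1%:R^-1 :> R by rewrite invr_gt0.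
  have ne : n.+1%:R^-1 + n.+1%:R^-1 < e :> R.
    rewrite -mulr2n -(mulr_natl n.+1%:R^-1) ltr_pdivrMr// mulrC -ltr_pdivrMr//.
    exact: truncnS_gt.
  have rx (s : R) : exists p : rat, ratr p - n.+1%:R^-1 < s < ratr p + n.+1%:R^-1.
    have [|r [/= rs [p _ pr]]] := dense_rat _ (ball_open s n.+1%:R^-1).
      by exists s; exact: ballxx.
    by exists p; rewrite pr; move: rs; rewrite /ball/= ltr_distl.
  have near2 (a b c i : R) : a - i < b < a + i -> a - i < c < a + i -> i + i < e ->
      `|b - c| < e.
    by move=> /andP[? ?] /andP[? ?] ?; rewrite ltr_norml; apply/andP; split; lra.
  have [p px] := rx x; have [q qy] := rx y.
  exists n => //; exists p => //; exists q => //.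
  rewrite /T; case: asboolP => [_|[]]; first by split; rewrite /= in_itv.
  move=> [x' y'] [/=]; rewrite !in_itv/= => px' qy'.
  by apply: xyU; split; [exact: near2 px px' ne|exact: near2 qy qy' ne].
apply: bigcupT_measurable => n; apply: bigcupT_measurable_rat => p.
apply: bigcupT_measurable_rat => q; rewrite /T; case: asboolP => // _.
by apply: measurableX; exact: measurable_itv.
Qed.

Lemma continuous_measurable3 (f : 'rV[R]_3 -> R) :
  continuous f -> measurable_fun [set: borelR3 R] f.
Proof.
move=> /continuousP cf; apply: (measurability _ (RGenOpens.measurableE R)).
move=> _ [_ [a [b ->] <-]]; rewrite setTI; apply: open_measurable3.
exact/cf/interval_open.
Qed.

Lemma continuous_measurable_plane (f : R * R -> R) :
  continuous f -> measurable_fun [set: plane R] f.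
Proof.
move=> /continuousP cf; apply: (measurability _ (RGenOpens.measurableE R)).
move=> _ [_ [a [b ->] <-]]; rewrite setTI; apply: open_measurable_plane.
exact/cf/interval_open.
Qed.

Lemma measurable_plane_to_R3 (f : R * R -> 'rV[R]_3) :
  continuous f -> measurable_fun [set: plane R] (f : plane R -> borelR3 R).
Proof.
move=> /continuousP cf; apply: (@measurability _ _ (plane R) (borelR3 R) setT f (@open 'rV[R]_3)) => //.
by move=> _ [U oU <-]; rewrite setTI; apply: open_measurable_plane; exact: cf.
Qed.

(** On the closed surface [F = 0] the map [psi] inverts the projection by [pr1] and [pr2]. Images
    under [psi] are thus preimages under a Borel map, and the area of images is a pushforward of the
    restricted Hausdorff measure. *)
Lemma image_area_measure (psi : plane R -> 'rV[R]_3) (pr1 pr2 F : 'rV[R]_3 -> R) :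
  continuous pr1 -> continuous pr2 -> continuous F ->
  (forall p, pr1 (psi p) = p.1) -> (forall p, pr2 (psi p) = p.2) ->
  (forall p, F (psi p) = 0) -> (forall r, F r = 0 -> psi (pr1 r, pr2 r) = r) ->
  exists mu : {measure set (plane R) -> \bar R}, forall E, mu E = area (psi @` E).
Proof.
move=> c1 c2 cF p1 p2 F0 FK.
have mF : measurable ([set r | F r = 0] : set (borelR3 R)).
  by apply: closed_measurable3; apply: (@closed_comp _ _ F [set 0]) => // *; exact: cF.
pose pr (r : borelR3 R) : plane R := (pr1 r, pr2 r).
have mpr : measurable_fun [set: borelR3 R] pr.
  by apply: measurable_fun_pair; exact: continuous_measurable3.
have [nu nuE] := pushforward_measureP (mrestr (@hausdorff2 R) mF) mpr.
exists nu => E; rewrite nuE /mrestr; congr (area _).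
apply/seteqP; split => [r [/= Er Fr]|_ [[x z] Exz <-]].
  by exists (pr r) => //; exact: FK.
by split; [rewrite /= /pr p1 p2|exact: F0].
Qed.

End borel_sets.

(** * The area of planar sets, up to one constant *)

Section planar_area.
Context {R : realType}.
Implicit Types (o a b : 'rV[R]_3) (E : set (plane R)).

Definition affine2 o a b (p : plane R) : 'rV[R]_3 := o + p.1 *: a + p.2 *: b.

Lemma affine2B o a b p q :
  affine2 o a b p - affine2 o a b q = (p.1 - q.1) *: a + (p.2 - q.2) *: b.
Proof. by apply/rowP => i; rewrite !mxE; ring. Qed.

Lemma enorm_affine2B o a b p q : dot a b = 0 ->
  enorm (affine2 o a b p - affine2 o a b q) =
  Num.sqrt ((p.1 - q.1) ^+ 2 * enorm a ^+ 2 + (p.2 - q.2) ^+ 2 * enorm b ^+ 2).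
Proof.
move=> ab; rewrite affine2B /enorm !sqr_enorm; congr Num.sqrt.
by rewrite !dot_lin (dotC b a) ab; ring.
Qed.

Let ex : 'rV[R]_3 := delta_mx 0 0.
Let ey : 'rV[R]_3 := delta_mx 0 1.

Let emb (s t : R) := affine2 0 (s *: ex) (t *: ey).

Let embE s t p : [/\ emb s t p 0 0 = p.1 * s, emb s t p 0 1 = p.2 * t &
  emb s t p 0 2%:R = 0].
Proof.
by split; rewrite /emb /affine2 !mxE/= !(mulr0, mulr1, addr0, add0r).
Qed.

Let dot_exy : dot ex ey = 0.
Proof. by rewrite dotE !mxE /= !(mulr0, mulr1, mul0r, mul1r, addr0). Qed.

Let enorm_ex : enorm ex = 1.
Proof. by rewrite /enorm dotE !mxE/= !(mulr0, mulr1, mul0r, addr0) sqrtr1. Qed.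

Let enorm_ey : enorm ey = 1.
Proof. by rewrite /enorm dotE !mxE/= !(mulr0, mulr1, mul0r, addr0, add0r) sqrtr1. Qed.

Let area_emb s t : 0 < s -> 0 < t ->
  exists mu : {measure set (plane R) -> \bar R}, forall E, mu E = area (emb s t @` E).
Proof.
move=> s0 t0; apply: (@image_area_measure _ (emb s t)
  (fun r => r 0 0 * s^-1) (fun r => r 0 1 * t^-1) (fun r => r 0 2%:R)).
- by apply: continuous_mul; [move=> ?; exact: coord_continuous|exact: continuous_const].
- by apply: continuous_mul; [move=> ?; exact: coord_continuous|exact: continuous_const].
- by move=> ?; exact: coord_continuous.
- by move=> p; have [-> _ _] := embE s t p; rewrite mulfK// gt_eqF.
- by move=> p; have [_ -> _] := embE s t p; rewrite mulfK// gt_eqF.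
- by move=> p; have [_ _ ->] := embE s t p.
move=> r r2; apply/rowP => i; have [h0 h1 h2] := embE s t (r 0 0 * s^-1, r 0 1 * t^-1).
case: i => -[|[|[|//]]] ilt.
- rewrite (_ : Ordinal ilt = 0) ?h0/=; last exact: val_inj.
  by rewrite mulfVK// gt_eqF.
- rewrite (_ : Ordinal ilt = 1) ?h1/=; last exact: val_inj.
  by rewrite mulfVK// gt_eqF.
- by rewrite (_ : Ordinal ilt = 2%:R) ?h2 ?r2//; exact: val_inj.
Qed.

Let unit_square : set (plane R) := `]0%R, 1%R]%classic `*` `]0%R, 1%R]%classic.

Let area_square : \bar R := area (emb 1 1 @` unit_square).

Let enorm_embB p q : enorm (emb 1 1 p - emb 1 1 q) <= `|p.1 - q.1| + `|p.2 - q.2|.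
Proof.
rewrite /emb !scale1r enorm_affine2B// enorm_ex enorm_ey expr1n !mulr1.
rewrite -[leRHS]ger0_norm ?addr_ge0// -sqrtr_sqr ler_wsqrtr//.
rewrite -(real_normK (num_real (p.1 - q.1))) -(real_normK (num_real (p.2 - q.2))).
have := normr_ge0 (p.1 - q.1); have := normr_ge0 (p.2 - q.2); nra.
Qed.

Let abs_embB p q : `|p.1 - q.1| <= enorm (emb 1 1 p - emb 1 1 q) /\
  `|p.2 - q.2| <= enorm (emb 1 1 p - emb 1 1 q).
Proof.
rewrite /emb !scale1r enorm_affine2B// enorm_ex enorm_ey expr1n !mulr1.
by rewrite -2!sqrtr_sqr; split; apply: ler_wsqrtr; rewrite ?lerDl ?lerDr sqr_ge0.
Qed.

(** A piece of diameter d lies in a square of side 2 d, of Lebesgue measure 4 d^2, which is 16 / pi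
    times its cost; these squares must cover the unit square. *)
Let area_square_ge : ((pi / 16)%:E <= area_square)%E.
Proof.
apply: le_trans (area_delta_le_area _ (@ltr01 R)).
apply: le_ereal_inf_tmp => _ [U /= [QU Ud] <-].
have d0 i : (diam (U i) \is a fin_num).
  by rewrite ge0_fin_numE ?diam_ge0// (le_lt_trans (Ud i))// ltry.
pose d i := fine (diam (U i)).
have d_ge0 i : 0 <= d i by rewrite fine_ge0// diam_ge0.
pose V i := emb 1 1 @^-1` U i.
pose box i (p : plane R) : set (plane R) :=
  `[p.1 - d i, p.1 + d i]%classic `*` `[p.2 - d i, p.2 + d i]%classic.
pose B i := if pselect (V i !=set0) is left h then box i (projT1 (cid h)) else set0.
have mB i : measurable (B i).
  by rewrite /B; case: pselect => // h; apply: measurableX; exact: measurable_itv.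
have QB : unit_square `<=` \bigcup_i B i.
  move=> p Qp; have [i _ Uip] := QU _ (imageP (emb 1 1) Qp); exists i => //.
  rewrite /B; case: pselect => [h|[]]; last by exists p.
  case: (cid h) => q /= Vq; have [h1 h2] := abs_embB p q.
  have := diam_ubound Uip Vq; rewrite -(fineK (d0 i)) lee_fin -/(d i) => pq.
  have := le_trans h1 pq; have := le_trans h2 pq; rewrite !ler_norml.
  move=> /andP[? ?] /andP[? ?].
  by split; rewrite /= in_itv/=; apply/andP; split; rewrite ?lerBlDr -?lerBlDl; lra.
have B_le i : (lebesgue2 (B i) <= (16 / pi)%:E * diam_cost (U i))%E.
  have -> : ((16 / pi)%:E * diam_cost (U i) = (4 * d i ^+ 2)%:E)%E.
    rewrite /diam_cost -(fineK (d0 i)) -/(d i) expe2 -!EFinM; congr EFin.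
    by move: (pi : R) (pi_gt0 R) => w w0; field; exact: lt0r_neq0.
  rewrite /B; case: pselect => h; last by rewrite measure0 lee_fin mulr_ge0 ?sqr_ge0.
  rewrite /box product_measure1E; [|exact: measurable_itv|exact: measurable_itv].
  rewrite /= !lebesgue_measure_itv/= !lte_fin.
  have [di|] := ltP 0 (d i); last first.
    move=> di; rewrite !ifF ?mule0 ?lee_fin ?mulr_ge0 ?sqr_ge0//.
      by apply/negP; lra.
    by apply/negP; lra.
  rewrite !ifT; [|lra|lra].
  rewrite -!EFinD -EFinM lee_fin le_eqVlt; apply/orP; left; apply/eqP; ring.
have : (lebesgue2 unit_square <= \sum_(i <oo) lebesgue2 (B i))%E.
  apply: measure_sigma_subadditive => //.
  by apply: measurableX; exact: measurable_itv.
rewrite product_measure1E; [|exact: measurable_itv|exact: measurable_itv].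
rewrite /= lebesgue_measure_itv/= lte_fin ltr01 -EFinB subr0 mule1.
move=> /le_trans/(_ (lee_nneseries _ (fun i _ => B_le i))).
rewrite nneseriesZl; last by move=> *; exact: diam_cost_ge0.
have p0 : 0 < 16 / pi :> R by rewrite divr_gt0// pi_gt0.
move=> /(_ _); rewrite -lee_pdivrMl// mule1 invf_div; apply => //.
Qed.

(** A grid of N^2 cells, each of diameter at most 2 / N and cost at most pi / N^2, has bounded total
    cost as the mesh shrinks. Finiteness is what matters. *)
Let area_square_le : (area_square <= (4 * pi)%:E)%E.
Proof.
apply: ge_ereal_sup => _ [delta /= delta0 <-].
pose N := (Num.truncn (2 / delta)).+1.
have N0 : 0 < N%:R :> R by rewrite ltr0n.
have Nd : 2 / N%:R <= delta.
  by rewrite ler_pdivrMr// mulrC -ler_pdivrMr// ltW// truncnS_gt.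
(* The row and the column are the quotient and the remainder of [i] by [N]. They are counted from
   the corner (1, 1): for a coordinate [s] in ]0, 1], the truncation of (1 - s) N is below N. *)
pose cell i : set (plane R) := [set p | (i %/ N)%:R <= (1 - p.1) * N%:R <= (i %/ N).+1%:R /\
  (i %% N)%:R <= (1 - p.2) * N%:R <= (i %% N).+1%:R].
pose U i := if (i < N * N)%N then emb 1 1 @` cell i else set0.
have Ud i : (diam (U i) <= (2 / N%:R)%:E)%E.
  rewrite /U; case: ifP => _; last by rewrite diam0 lee_fin divr_ge0.
  apply: diam_le => [|_ _ [p [p1 p2] <-] [q [q1 q2] <-]]; first by rewrite lee_fin divr_ge0.
  rewrite lee_fin (le_trans (enorm_embB p q))// ler_pdivlMr// mulrDl.
  rewrite -[X in _ * X + _](ger0_norm (ltW N0)) -[X in _ + _ * X](ger0_norm (ltW N0)).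
  rewrite -!normrM; move: p1 p2 q1 q2; rewrite -2!natr1.
  move: (i %/ N)%:R (i %% N)%:R => a b /andP[? ?] /andP[? ?] /andP[? ?] /andP[? ?].
  have h1 : `|(p.1 - q.1) * N%:R| <= 1 by rewrite ler_norml; apply/andP; split; lra.
  have h2 : `|(p.2 - q.2) * N%:R| <= 1 by rewrite ler_norml; apply/andP; split; lra.
  lra.
have QU : emb 1 1 @` unit_square `<=` \bigcup_i U i.
  move=> _ [[x y] [/= + +] <-]; rewrite !in_itv/= => /andP[x0 x1] /andP[y0 y1].
  have idx (s : R) : 0 < s -> s <= 1 -> exists2 k, (k < N)%N & k%:R <= (1 - s) * N%:R <= k.+1%:R.
    move=> s0 s1; have sN : 0 <= (1 - s) * N%:R by rewrite mulr_ge0// subr_ge0.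
    exists (Num.truncn ((1 - s) * N%:R)); last first.
      by apply/andP; split; [rewrite truncn_le|exact/ltW/truncnS_gt].
    rewrite -(ltr_nat R); apply: (@le_lt_trans _ _ ((1 - s) * N%:R)); first by rewrite truncn_le.
    by rewrite gtr_pMl//; lra.
  have [k kN kx] := idx _ x0 x1; have [l lN ly] := idx _ y0 y1.
  exists (k * N + l)%N => //; rewrite /U ifT.
    exists (x, y) => //; split => /=.
      by rewrite divnMDl// divn_small// addn0.
    by rewrite modnMDl modn_small.
  by rewrite (@leq_trans (k * N + N))// ?ltn_add2l// -mulSnr leq_mul2r kN orbT.
have cost i : (diam_cost (U i) <= (if (i < N * N)%N then pi / N%:R ^+ 2 else 0)%:E)%E.
  case: ifP => iN; last by rewrite /U iN /diam_cost diam0 expe2 !mule0.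
  have -> : pi / N%:R ^+ 2 = pi / 4 * (2 / N%:R) ^+ 2 :> R.
    by move: (pi : R) => w; field; rewrite gt_eqF.
  rewrite /diam_cost (EFinM (pi / 4)); apply: lee_wpmul2l.
    by rewrite lee_fin divr_ge0 ?pi_ge0.
  by rewrite EFin_expe !expe2 lee_pmul ?diam_ge0.
apply: (@le_trans _ _ (\sum_(i <oo) diam_cost (U i))%E).
  apply: ereal_inf_lbound; exists U => //; split => // i.
  by rewrite (le_trans (Ud i))// lee_fin.
apply: le_trans (lee_nneseries (fun i _ _ => diam_cost_ge0 (U i)) (fun i _ => cost i)) _.
rewrite (nneseries_split _ (N * N)); last first.
  by move=> i _; rewrite lee_fin; case: ifP => // _; rewrite divr_ge0 ?sqr_ge0 ?pi_ge0.
rewrite [X in (_ + X)%E]eseries0 ?adde0; last first.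
  by move=> i /= Ni _; rewrite ifF// ltnNge Ni.
rewrite add0n big_mkord (eq_bigr (fun=> (pi / N%:R ^+ 2)%:E)); last first.
  by move=> i _; rewrite ltn_ord.
rewrite sumEFin lee_fin sumr_const card_ord -(mulr_natl _ (N * N)) natrM.
have -> : N%:R * N%:R * (pi / N%:R ^+ 2) = pi :> R.
  by move: (pi : R) => w; field; rewrite gt_eqF.
have := pi_gt0 R; lra.
Qed.

(** Stretching the axes turns the unit square into a rectangle of the standard embedding, where
    translation invariance makes area a multiple of Lebesgue measure. *)
Let area_emb_square s t : 0 < s -> 0 < t ->
  area (emb s t @` unit_square) = (area_square * (s * t)%:E)%E.
Proof.
move=> s0 t0; have [mu muE] := area_emb ltr01 ltr01.
have fin : area_square \is a fin_num.
  rewrite ge0_fin_numE ?outer_measure_ge0//.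
  by rewrite (le_lt_trans area_square_le)// ltry.
rewrite (_ : emb s t @` unit_square = emb 1 1 @` (`]0%R, s]%classic `*` `]0%R, t]%classic)).
  rewrite -muE (@translation_invariant_plane _ mu (fine area_square)).
  - rewrite fineK// product_measure1E; [|exact: measurable_itv|exact: measurable_itv].
    by rewrite /= !lebesgue_measure_itv/= !lte_fin s0 t0 -!EFinB !subr0 -EFinM.
  - by rewrite fineK// muE.
  - move=> A B x y mA mB; rewrite !muE.
    transitivity (area ((fun p => emb 1 1 (p.1 + x, p.2 + y)) @`
        (((fun s : R => s + x) @^-1` A) `*` ((fun s : R => s + y) @^-1` B)))).
      apply: area_isometry => p q _ _; congr enorm; rewrite !affine2B/=.
      by congr (_ *: _ + _ *: _); ring.
    congr area; apply/seteqP; split => [_ [[p q] [/= Ap Bq] <-]|_ [[p q] [/= Ap Bq] <-]].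
      by exists (p + x, q + y).
    by exists (p - x, q - y); rewrite /= ?subrK.
  - by apply: measurableX; exact: measurable_itv.
apply/seteqP; split => [_ [[p q] [/= + +] <-]|_ [[p q] [/= + +] <-]];
  rewrite !in_itv/= => /andP[p0 p1] /andP[q0 q1].
  exists (p * s, q * t).
    by split; rewrite /= in_itv/= mulr_gt0//= ler_piMl// ltW.
  by rewrite /emb /affine2 /= !scale1r !scalerA.
exists (p / s, q / t).
  by split; rewrite /= in_itv/= divr_gt0//= ler_pdivrMr// mul1r.
by rewrite /emb /affine2 /= !scale1r !scalerA !divfK ?gt_eqF.
Qed.

(** An orthogonal affine chart is isometric to a stretched coordinate plane, where translation
    invariance applies. One constant serves all charts; its finiteness and positivity come from the
    two bounds on the unit square. *)
Lemma area_affine : exists2 c : R, 0 < c & forall o a b E, dot a b = 0 ->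
  0 < enorm a -> 0 < enorm b -> measurable E ->
  area (affine2 o a b @` E) = ((c * enorm a * enorm b)%:E * lebesgue2 E)%E.
Proof.
have fin : area_square \is a fin_num.
  rewrite ge0_fin_numE ?outer_measure_ge0//.
  by rewrite (le_lt_trans area_square_le)// ltry.
exists (fine area_square).
  rewrite -lte_fin fineK// (lt_le_trans _ area_square_ge)// lte_fin.
  by rewrite divr_gt0// pi_gt0.
move=> o a b E ab a0 b0 mE.
have [mu muE] := area_emb a0 b0.
transitivity (area (emb (enorm a) (enorm b) @` E)).
  apply: area_isometry => p q _ _; rewrite !enorm_affine2B//; last first.
    by rewrite !dot_lin dot_exy !mulr0.
  by rewrite !enormZ enorm_ex enorm_ey !mulr1 !ger0_norm ?enorm_ge0.
rewrite -muE; apply: translation_invariant_plane => //.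
- by rewrite muE area_emb_square// -mulrA (EFinM (fine _)) fineK.
- move=> A B x y mA mB; rewrite !muE.
  transitivity (area ((fun p => emb (enorm a) (enorm b) (p.1 + x, p.2 + y)) @`
      (((fun s : R => s + x) @^-1` A) `*` ((fun s : R => s + y) @^-1` B)))).
    apply: area_isometry => p q _ _; congr enorm; rewrite !affine2B/=.
    by congr (_ *: _ + _ *: _); ring.
  congr area; apply/seteqP; split => [_ [[p q] [/= Ap Bq] <-]|_ [[p q] [/= Ap Bq] <-]].
    by exists (p + x, q + y).
  by exists (p - x, q - y); rewrite /= ?subrK.
Qed.

End planar_area.

(** * The envelope of a family of parabolas *)

(** The extreme slopes belong to the set because the two given unit vectors belong to the prescribed
    support; they produce the two faces of the tangent wedge. *)
Record slope_set (R : realType) := SlopeSet {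
  slopes : set R;
  smax : R;
  smax_gt0 : 0 < smax;
  slopes_compact : compact slopes;
  slopes_smax : slopes smax;
  slopes_Nsmax : slopes (- smax);
  slopes_le : forall k, slopes k -> `|k| <= smax }.

Section envelope.
Context {R : realType}.
Variable K : slope_set R.
Local Notation q := (smax K).
Let cK := @slopes_compact _ K.
Let Kq := slopes_smax K.
Let K_le := @slopes_le _ K.

(* This choice makes [k x + hgt k z^2] equal to z^2 times
   q^2 + 1 + (w^2 - (k - w)^2) / 2 with w = x / z^2, so that the maximizing slopes
   are the points of [slopes] nearest to w. *)
Definition hgt k : R := q ^+ 2 + 1 - k ^+ 2 / 2.

Definition line k (p : plane R) : R := k * p.1 + hgt k * p.2 ^+ 2.

Definition active (p : plane R) k := slopes K k /\ forall l, slopes K l -> line l p <= line k p.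

Let hmax := q ^+ 2 + 1.

(** A uniform lower bound on the curvature along the edge: it makes every parabola convex in z and
    bounds the cap in that direction. *)
Lemma hgt_ge1 k : `|k| <= q -> 1 <= hgt k.
Proof.
rewrite /hgt ler_norml => /andP[kq qk].
have k2 : 0 <= (q - k) * (q + k) by rewrite mulr_ge0//; lra.
have := sqr_ge0 k; nra.
Qed.

Lemma hgt_le k : hgt k <= hmax.
Proof. by rewrite /hgt /hmax gerBl divr_ge0// sqr_ge0. Qed.

Lemma line_continuous p (S : set R) : {within S, continuous (line^~ p)}.
Proof.
apply: continuous_subspaceT.
change (continuous (fun k : R => k * p.1 + (q ^+ 2 + 1 - k ^+ 2 * 2^-1) * p.2 ^+ 2)).
apply: continuous_add; apply: continuous_mul; try exact: continuous_const.
  by move=> ?; exact: cvg_id.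
apply: continuous_add; first exact: continuous_const.
apply: continuous_opp; apply: continuous_mul; last exact: continuous_const.
by apply: continuous_pow => ?; exact: cvg_id.
Qed.

Lemma active_exists p : exists k, active p k.
Proof.
have [|k kK kmax] := compact_EVT_max _ cK (@line_continuous p (slopes K)); first by exists q.
by exists k; split => [|l Kl]; [exact: set_mem|exact: (kmax l (mem_set Kl))].
Qed.

Definition slope p : R := xget 0 (active p).

Definition env p : R := line (slope p) p.

Lemma slope_active p : active p (slope p).
Proof. exact: (xgetPex 0 (active_exists p)). Qed.

Lemma env_ge p k : slopes K k -> line k p <= env p.
Proof. by move: k; exact: (slope_active p).2. Qed.

Lemma envE p k : active p k -> env p = line k p.
Proof.
by move=> [Kk kmax]; apply/eqP; rewrite eq_le env_ge// andbT; exact: kmax _ (slope_active p).1.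
Qed.

Lemma lineB k p p' : line k p - line k p' = k * (p.1 - p'.1) + hgt k * (p.2 ^+ 2 - p'.2 ^+ 2).
Proof. by rewrite /line; ring. Qed.

Lemma envB_le p p' k : active p k ->
  env p - env p' <= k * (p.1 - p'.1) + hgt k * (p.2 ^+ 2 - p'.2 ^+ 2).
Proof.
by move=> pk; rewrite (envE pk) -lineB lerD2l lerN2 env_ge//; case: pk.
Qed.

(** The upper bound uses the slope active at [p], the lower bound the one at [p']. Nothing is asked
    of the points between, so the estimate applies on slope windows of any shape. *)
Lemma envB_abs p p' c (eps : R) k k' : active p k -> active p' k' ->
  `|k - c| <= eps -> `|k' - c| <= eps ->
  `|env p - env p' - c * (p.1 - p'.1)| <=
    eps * `|p.1 - p'.1| + hmax * `|p.2 ^+ 2 - p'.2 ^+ 2|.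
Proof.
have step l : slopes K l -> `|l - c| <= eps ->
    `|(l - c) * (p.1 - p'.1) + hgt l * (p.2 ^+ 2 - p'.2 ^+ 2)| <=
    eps * `|p.1 - p'.1| + hmax * `|p.2 ^+ 2 - p'.2 ^+ 2|.
  move=> Kl lc; rewrite (le_trans (ler_normD _ _))// !normrM lerD// ler_wpM2r//.
  by rewrite ger0_norm ?hgt_le// (le_trans ler01)// hgt_ge1// K_le.
move=> pk pk' kc kc'.
have u := envB_le p' pk; have l := envB_le p pk'.
have := step _ pk.1 kc; have := step _ pk'.1 kc'; rewrite !ler_norml => /andP[? ?] /andP[? ?].
by apply/andP; split; nra.
Qed.

Lemma env_lipschitz p p' :
  `|env p - env p'| <= q * `|p.1 - p'.1| + hmax * `|p.2 ^+ 2 - p'.2 ^+ 2|.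
Proof.
have [k pk] := active_exists p; have [k' pk'] := active_exists p'.
have := @envB_abs p p' 0 q k k' pk pk'; rewrite !subr0 mul0r subr0; apply; apply: K_le.
  exact: pk.1.
exact: pk'.1.
Qed.

Lemma env_continuous : continuous (env : R * R -> R).
Proof.
move=> p0; apply/cvgrPdist_le => e e0.
pose B (p : R * R) : R := q * `|p0.1 - p.1| + hmax * `|p0.2 ^+ 2 - p.2 ^+ 2|.
have cB : continuous B.
  apply: continuous_add; apply: continuous_mul;
    (try exact: continuous_const); apply: continuous_abs; apply: continuous_add;
    (try exact: continuous_const); apply: continuous_opp.
    by move=> p; exact: cvg_fst.
  by apply: continuous_pow => p; exact: cvg_snd.
have B0 : B p0 = 0 by rewrite /B !subrr normr0 !mulr0 addr0.
have := cB p0; rewrite /continuous_at B0 => /cvgrPdist_le/(_ e e0); apply: filterS => p.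
rewrite sub0r normrN => Be; rewrite (le_trans (env_lipschitz p0 p))//.
exact: le_trans (ler_norm _) Be.
Qed.

Lemma env_scale s x z : env (s ^+ 2 * x, s * z) = s ^+ 2 * env (x, z).
Proof.
have ls l : line l (s ^+ 2 * x, s * z) = s ^+ 2 * line l (x, z) by rewrite /line /=; ring.
have ak := slope_active (x, z); rewrite -ls; apply: envE; split; first exact: ak.1.
by move=> l Kl; rewrite !ls ler_wpM2l ?sqr_ge0//; exact: ak.2.
Qed.

Lemma active_scale s p k : 0 < s -> active (s ^+ 2 * p.1, s * p.2) k <-> active p k.
Proof.
move=> s0; have ls l : line l (s ^+ 2 * p.1, s * p.2) = s ^+ 2 * line l p.
  by rewrite /line /=; ring.
split=> -[Kk km]; split=> // l /km; rewrite !ls ler_pM2l ?exprn_gt0//.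
Qed.

(** Adding the two optimality inequalities gives (k - k') (x' - x) <= 0. *)
Lemma active_monotone x x' z k k' : active (x, z) k -> active (x', z) k' -> x < x' -> k <= k'.
Proof.
move=> [Kk km] [Kk' km'] xx'; rewrite leNgt; apply/negP => kk'.
have : 0 < (k - k') * (x' - x) by rewrite mulr_gt0// subr_gt0.
have := km _ Kk'; have := km' _ Kk; rewrite /line /=; lra.
Qed.

Lemma active_near x z k l : z != 0 -> active (x, z) k -> slopes K l ->
  `|k - x / z ^+ 2| <= `|l - x / z ^+ 2|.
Proof.
move=> z0 [_ km] /km.
have z2 : 0 < z ^+ 2 by rewrite exprn_even_gt0.
rewrite /line /hgt /=; set w := x / z ^+ 2.
have -> : x = w * z ^+ 2 by rewrite /w divfK ?gt_eqF.
move=> h; rewrite -ler_sqr ?nnegrE// !real_normK ?num_real//.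
have : 0 <= z ^+ 2 * ((k * w - k ^+ 2 / 2) - (l * w - l ^+ 2 / 2)) by lra.
by rewrite pmulr_rge0//; lra.
Qed.

(* Danskin's argument: by compactness, the slopes away from the unique active one
   miss the maximum by a positive gap. *)
Lemma active_unique_near p k (eps : R) : active p k -> (forall l, active p l -> l = k) ->
  0 < eps -> exists2 delta, 0 < delta & forall p' k',
    q * `|p.1 - p'.1| + hmax * `|p.2 ^+ 2 - p'.2 ^+ 2| < delta -> active p' k' -> `|k' - k| < eps.
Proof.
move=> pk uk e0; pose S := slopes K `&` [set l | eps <= `|l - k|].
have cS : compact S.
  apply: compact_closedI => //.
  apply: (@closed_comp _ _ (fun l : R => `|l - k|) [set x | eps <= x]); last exact: closed_ge.
  move=> l _; apply: (@continuous_abs _ _ (fun l => l - k)); apply: continuous_add.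
    by move=> ?; exact: cvg_id.
  exact: continuous_const.
have [[s0 Ss0]|S0] := pselect (S !=set0); last first.
  exists 1 => // p' k' _ [Kk' _]; rewrite ltNge; apply/negP => ek'.
  by apply: S0; exists k'.
have [|s /set_mem[Ks /= es] smax] := compact_EVT_max _ cS (@line_continuous p S).
  by exists s0.
have gap : 0 < line k p - line s p.
  rewrite subr_gt0 lt_neqAle pk.2// andbT; apply/negP => /eqP sk.
  have : s = k by apply: uk; split=> // l Kl; rewrite sk; exact: pk.2.
  by move=> sk'; move: es; rewrite sk' subrr normr0 leNgt e0.
have cont l p' : slopes K l -> `|line l p - line l p'| <= q * `|p.1 - p'.1| + hmax * `|p.2 ^+ 2 - p'.2 ^+ 2|.
  move=> Kl; rewrite lineB (le_trans (ler_normD _ _))// !normrM lerD// ler_wpM2r//.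
    exact: K_le.
  by rewrite ger0_norm ?hgt_le// (le_trans ler01)// hgt_ge1// K_le.
(* Moving from [p] to [p'] changes each of the two competing lines by less than [delta]; half the
   gap keeps [k] strictly ahead. *)
exists ((line k p - line s p) / 2); first by rewrite divr_gt0.
move=> p' k' pp' pk'; rewrite ltNge; apply/negP => ek'.
have ks : line k' p <= line s p by apply: (smax k' (mem_set _)); split=> //; exact: pk'.1.
have := cont _ p' pk'.1; have := cont _ p' pk.1; have := pk'.2 _ pk.1.
rewrite !ler_norml => h /andP[? ?] /andP[? ?]; lra.
Qed.

End envelope.

(** * A Borel choice of the active slope, and the null set where it is not unique *)

Section envelope_measurability.
Context {R : realType}.
Variable K : slope_set R.
Local Notation q := (smax K).
Let Kq := slopes_smax K.
Let KNq := slopes_Nsmax K.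
Let K_le := @slopes_le _ K.

(** The quotient x / z^2 off z = 0, written with the power function so that measurability follows by
    composition. *)
Let w (p : plane R) : R := p.1 * (p.2 ^+ 2) `^ (-1).

Let wE p : p.2 != 0 -> w p = p.1 / p.2 ^+ 2.
Proof. by move=> p2; rewrite /w powR_inv1 ?sqr_ge0. Qed.

Let w_measurable : measurable_fun setT w.
Proof.
apply: measurable_funM => //.
apply: (measurableT_comp (measurable_powR _)).
by apply: (@measurable_funX _ _ _ _ snd 2) => //; exact: measurable_snd.
Qed.

Let active_w p k : p.2 != 0 -> active K p k <-> active K (w p, 1) k.
Proof.
move=> p2; have z2 : 0 < p.2 ^+ 2 by rewrite exprn_even_gt0.
have lE l : line K l p = p.2 ^+ 2 * line K l (w p, 1).
  by rewrite /line wE//=; field.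
by split=> -[Kk km]; split=> // l /km; rewrite !lE ler_pM2l.
Qed.

(** Off z = 0 the active slopes depend on x / z^2 alone, by homogeneity. Along z = 1 any selection
    is monotone, hence Borel. *)
Let S x := slope K (x, 1).

Let S_nondecreasing : nondecreasing_fun S.
Proof.
move=> x y; rewrite le_eqVlt => /predU1P[->//|].
apply: active_monotone; exact: slope_active.
Qed.

(* A Borel selection of an active slope. On [z = 0] the slopes of [K] are compared
   on the line [k x] alone, so one of [q], [- q] is active. *)
Definition sel (p : plane R) : R :=
  if p.2 == 0 then (if 0 <= p.1 then q else - q) else S (w p).

Lemma sel_active p : active K p (sel p).
Proof.
rewrite /sel; case: ifPn => [/eqP p2|p2]; last first.
  by apply/active_w => //; exact: slope_active.
have lE l : line K l p = l * p.1 by rewrite /line p2 expr0n mulr0 addr0.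
case: ifPn => p1; split => // l /K_le; rewrite ler_norml !lE => /andP[? ?].
  by rewrite ler_wpM2r.
by rewrite ler_wnM2r// ltW// ltNge.
Qed.

Lemma sel_measurable : measurable_fun setT sel.
Proof.
apply: measurable_fun_ifT.
- apply: (measurable_fun_bool true); rewrite setTI.
  rewrite (_ : _ @^-1` _ = [set: measurableTypeR R] `*` [set (0 : R)]).
    by apply: measurableX => //; exact: measurable_set1.
  by apply/seteqP; split => [[x z] /= /eqP ->|[x z] /= [_ ->]]; rewrite ?eqxx.
- apply: measurable_fun_ifT; [|exact: measurable_cst|exact: measurable_cst].
  apply: (measurable_fun_bool true); rewrite setTI.
  rewrite (_ : _ @^-1` _ = `[0%R, +oo[%classic `*` [set: measurableTypeR R]).
    by apply: measurableX => //; exact: measurable_itv.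
  by apply/seteqP; split => [[x z] /=|[x z] /= []]; rewrite in_itv/= andbT => // ->.
- apply: (measurableT_comp _ w_measurable).
  exact: nondecreasing_measurable.
Qed.

Lemma sel_le p : `|sel p| <= q.
Proof. by have [/K_le] := sel_active p. Qed.

Let branching : set R :=
  [set x | exists k l, [/\ k < l, active K (x, 1) k & active K (x, 1) l]].

(* Distinct branching points have disjoint gaps of active slopes. *)
Let branching_countable : countable branching.
Proof.
pose B (r : rat) := [set x | exists k l, [/\ active K (x, 1) k,
  active K (x, 1) l & k < ratr r < l]].
apply: (@sub_countable _ _ _ (\bigcup_r B r)).
  apply: subset_card_le => x [k [l [kl xk xl]]].
  have [r] := rat_in_itvoo kl; rewrite in_itv/= => rkl.
  by exists r => //; exists k, l.
apply: bigcup_countable => // r _.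
have [[x Bx]|B0] := pselect (B r !=set0); last first.
  by rewrite (_ : B r = set0) // -subset0 => x Bx; apply: B0; exists x.
apply: (@sub_countable _ _ _ [set x]) => //; apply: subset_card_le => y By.
have lt_le x' y' : B r x' -> B r y' -> y' <= x'.
  move=> [k [l [xk xl /andP[kr rl]]]] [k' [l' [yk yl /andP[kr' rl']]]].
  rewrite leNgt; apply/negP => xy.
  by have := active_monotone xl yk xy; rewrite leNgt (lt_trans kr' rl).
by apply/eqP; rewrite eq_le !lt_le.
Qed.

Let branching_measurable : measurable branching.
Proof. by apply: countable_measurable. Qed.

Definition nonsmooth : set (plane R) := [set p | p.2 == 0 \/ branching (w p)].

Lemma active_unique p k l : ~ nonsmooth p ->
  active K p k -> active K p l -> k = l.
Proof.
move=> /not_orP[/negP p2 np] /active_w -/(_ p2) pk /active_w -/(_ p2) pl.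
apply/eqP; rewrite eq_le !leNgt; apply/andP; split; apply/negP => kl; apply: np.
  by exists l, k.
by exists k, l.
Qed.

Let z0 : set (plane R) := [set: measurableTypeR R] `*` [set (0 : R)].

Let mz0 : measurable z0.
Proof. by apply: measurableX => //; exact: measurable_set1. Qed.

Let nonsmoothE : nonsmooth = z0 `|` (w @^-1` branching).
Proof.
by apply/seteqP; split => [p [/eqP ?|?]|p [[_ ?]|?]]; [left|right|left; apply/eqP|right].
Qed.

Let mwb : measurable (w @^-1` branching).
Proof. by rewrite -[X in measurable X]setTI; exact: w_measurable. Qed.

Lemma nonsmooth_measurable : measurable nonsmooth.
Proof. by rewrite nonsmoothE; exact: measurableU. Qed.

Lemma lebesgue2_nonsmooth : lebesgue2 nonsmooth = 0%E.
Proof.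
rewrite nonsmoothE.
have -> : z0 `|` w @^-1` branching = z0 `|` (w @^-1` branching `\` z0).
  apply/seteqP; split => [p [?|wp]|p [?|[? _]]]; [by left| |by left|by right].
  by have [?|?] := pselect (z0 p); [left|right].
have mD : measurable (w @^-1` branching `\` z0) by exact: measurableD.
have h1 : lebesgue2 z0 = 0%E.
  rewrite product_measure1E//.
  by rewrite /= lebesgue_measure_set1 mule0.
suff h2 : lebesgue2 (w @^-1` branching `\` z0) = 0%E.
  by apply: null_set_setU.
(* Integration over z comes last: for z nonzero, the section in x consists of the branching points
   multiplied by z^2, a countable set. *)
rewrite (product_measure_unique (m' := (@lebesgue_measure R \x^ @lebesgue_measure R)%E))//; last first.
  by move=> A B mA mB; exact: product_measure2E.
apply: integral0_eq => z _ /=; apply: countable_lebesgue_measure0.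
have [->|zn0] := eqVneq z 0.
  rewrite (_ : ysection _ _ = set0) // -subset0 => x; rewrite ysectionE/= => -[_].
  by apply.
apply: (@sub_countable _ _ _ ((fun b => b * z ^+ 2) @` branching)).
  apply: subset_card_le => x; rewrite ysectionE/= => -[bx _].
  by exists (w (x, z)) => //; rewrite wE//= divfK// expf_neq0.
by apply: sub_countable branching_countable; exact: card_image_le.
Qed.

End envelope_measurability.

(** * The convex body and its normals *)

(* The body is cut out below the graph over the floor spanned by [axis1] and
   [axis3]; [axis3] is along the edge, and dir1 axis1 + dir2 axis2 is the vector e
   of the paper. *)
Record wedge (R : realType) := Wedge {
  slope_set_of :> slope_set R;
  axis1 : 'rV[R]_3;
  axis2 : 'rV[R]_3;
  axis3 : 'rV[R]_3;
  dir1 : R;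
  dir2 : R;
  dot_axis11 : dot axis1 axis1 = 1;
  dot_axis22 : dot axis2 axis2 = 1;
  dot_axis33 : dot axis3 axis3 = 1;
  dot_axis12 : dot axis1 axis2 = 0;
  dot_axis13 : dot axis1 axis3 = 0;
  dot_axis23 : dot axis2 axis3 = 0;
  axes_span : forall r,
    r = dot r axis1 *: axis1 + dot r axis2 *: axis2 + dot r axis3 *: axis3;
  dir2_gt0 : 0 < dir2;
  dir_inside : `|dir1| < smax slope_set_of * dir2;
  dir_unit : dir1 ^+ 2 + dir2 ^+ 2 = 1 }.

Section axes.
Context {R : realType}.
Variable W : wedge R.

Lemma dot_axis21 : dot (axis2 W) (axis1 W) = 0.
Proof. by rewrite dotC dot_axis12. Qed.

Lemma dot_axis31 : dot (axis3 W) (axis1 W) = 0.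
Proof. by rewrite dotC dot_axis13. Qed.

Lemma dot_axis32 : dot (axis3 W) (axis2 W) = 0.
Proof. by rewrite dotC dot_axis23. Qed.

Definition dot_axes := (dot_axis11 W, dot_axis22 W, dot_axis33 W, dot_axis12 W,
  dot_axis13 W, dot_axis23 W, dot_axis21, dot_axis31, dot_axis32).

End axes.

Section wedge_geometry.
Context {R : realType}.
Variable W : wedge R.
Local Notation a := (axis1 W).
Local Notation d := (axis2 W).
Local Notation u := (axis3 W).
Local Notation q := (smax W).
Local Notation c1 := (dir1 W).
Local Notation c2 := (dir2 W).

Definition combine3 x y z : 'rV[R]_3 := x *: a + y *: d + z *: u.

Lemma combine3_dot x y z : (dot (combine3 x y z) a = x) * (dot (combine3 x y z) d = y) *
  (dot (combine3 x y z) u = z).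
Proof. by rewrite /combine3 !dot_lin !dot_axes !(mulr0, mulr1, addr0, add0r). Qed.

Lemma combine3K r : combine3 (dot r a) (dot r d) (dot r u) = r.
Proof. by rewrite [RHS](axes_span W). Qed.

Lemma dot_coords r s : dot r s = dot r a * dot s a + dot r d * dot s d + dot r u * dot s u.
Proof. by rewrite {1}(axes_span W r) !dot_lin !(dotC _ s). Qed.

Lemma combine3_inj r s : dot r a = dot s a -> dot r d = dot s d -> dot r u = dot s u -> r = s.
Proof. by move=> ea ed eu; rewrite -(combine3K r) ea ed eu combine3K. Qed.

Definition dir : 'rV[R]_3 := c1 *: a + c2 *: d.

Lemma dot_dir r : dot r dir = c1 * dot r a + c2 * dot r d.
Proof. by rewrite /dir !dot_lin. Qed.

Definition floor_coords (r : 'rV[R]_3) : plane R := (dot r a, dot r u).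

Definition excess (r : 'rV[R]_3) : R := dot r d + env W (floor_coords r).

(** The half-space truncates the region below the graph to a compact set; caps at levels t < 1 do
    not reach the cut. *)
Definition body : set 'rV[R]_3 := [set r | excess r <= 0 /\ - 1 <= dot r dir].

(** Turns the region below the graph into an intersection over the slopes, so that convexity and
    membership are checked one parabola at a time. *)
Lemma excess_le0P r : excess r <= 0 <->
  forall k, slopes W k -> line W k (floor_coords r) + dot r d <= 0.
Proof.
rewrite /excess; split => [r0 k kK|H].
  by rewrite addrC (le_trans _ r0)// lerD2l env_ge.
by have := H _ (slope_active W (floor_coords r)).1; rewrite addrC.
Qed.

Lemma env0 : env W (0, 0) = 0.
Proof. by rewrite /env /line /= expr0n !mulr0 addr0. Qed.

Lemma floor_continuous (f : R * R -> R) :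
  continuous f -> continuous (fun r => f (floor_coords r)).
Proof.
move=> cf r; apply: (@continuous_comp _ _ _ (fun r => (dot r a, dot r u)) f); last exact: cf.
exact: (cvg_pair (@dot_continuous _ a r) (@dot_continuous _ u r)).
Qed.

Lemma excess_continuous : continuous excess.
Proof.
by apply: continuous_add; [exact: dot_continuous|apply: floor_continuous; exact: env_continuous].
Qed.

Lemma env_lower p : q * `|p.1| + p.2 ^+ 2 <= env W p.
Proof.
have h1 := env_ge p (slopes_smax W); have h2 := env_ge p (slopes_Nsmax W).
have q0 := smax_gt0 W.
have hq : 1 <= hgt W q by apply: hgt_ge1; rewrite ger0_norm// ltW.
have hNq : hgt W (- q) = hgt W q by rewrite /hgt sqrrN.
have z2 : p.2 ^+ 2 <= hgt W q * p.2 ^+ 2 by rewrite ler_peMl ?sqr_ge0.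
move: h1 h2; rewrite /line hNq.
by have [?|?] := ger0P p.1; nra.
Qed.

(** The factor q c2 - |c1| is positive because [dir] is interior to the cone of outward normals at
    the edge. Hence a level bounds both |x| and z^2, which gives the compactness of the body and the
    boundedness of the chart domain. *)
Lemma dir_level_le p t : - t <= c1 * p.1 - c2 * env W p ->
  (q * c2 - `|c1|) * `|p.1| + c2 * p.2 ^+ 2 <= t.
Proof.
move=> pt; have c20 := dir2_gt0 W.
have : c1 * p.1 <= `|c1| * `|p.1| by rewrite -normrM ler_norm.
have : c2 * (q * `|p.1| + p.2 ^+ 2) <= c2 * env W p by rewrite ler_pM2l// env_lower.
lra.
Qed.

Let slack_gt0 : 0 < q * c2 - `|c1|.
Proof. by rewrite subr_gt0 dir_inside. Qed.

Lemma body_le_dir r : body r ->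
  - 1 <= c1 * (floor_coords r).1 - c2 * env W (floor_coords r).
Proof.
move=> [r0]; rewrite dot_dir => /le_trans; apply.
rewrite lerD2l lerNr -mulrN ler_pM2l ?(dir2_gt0 W)// /excess in r0 *; lra.
Qed.

Lemma body_bounded : bounded_set body.
Proof.
(* [M1], [M2] and [M3] bound the coordinates along [a], [u] and [d]. [M2] comes from z^2 <= 1 / c2
   and |z| <= 1 + z^2, which avoids a square root. *)
pose M1 := 1 / (q * c2 - `|c1|); pose M2 := 1 + 1 / c2.
pose M3 := (1 + `|c1| * M1) / c2.
have c20 := dir2_gt0 W.
exists (M1 + M3 + M2); split=> [|M MM r rC /=]; first exact: num_real.
apply: le_trans (ltW MM).
have := dir_level_le (body_le_dir rC) => /= rM.
have z0 : 0 <= c2 * dot r u ^+ 2 by rewrite mulr_ge0 ?sqr_ge0// ltW.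
have x0 : 0 <= (q * c2 - `|c1|) * `|dot r a| by rewrite mulr_ge0// ltW.
have rx : `|dot r a| <= M1 by rewrite /M1 ler_pdivlMr// mulrC; lra.
have rz : `|dot r u| <= M2.
  have : dot r u ^+ 2 <= 1 / c2 by rewrite ler_pdivlMr// mulrC; lra.
  rewrite /M2 -real_normK ?num_real// => h; have := sqr_ge0 (`|dot r u| - 1); have := sqr_ge0 `|dot r u|; lra.
have ry : `|dot r d| <= M3.
  have [r0 r1] := rC; rewrite dot_dir in r1.
  have e0 : 0 <= env W (floor_coords r).
    apply: le_trans (env_lower _); rewrite addr_ge0 ?sqr_ge0// mulr_ge0//.
    exact/ltW/smax_gt0.
  have d0 : dot r d <= 0 by move: r0; rewrite /excess; lra.
  rewrite ler0_norm// /M3 ler_pdivlMr//.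
  have : c1 * dot r a <= `|c1| * M1.
    by rewrite (le_trans (ler_norm _))// normrM ler_wpM2l.
  lra.
rewrite (le_trans (norm_le_enorm r))// -{1}(combine3K r) /combine3.
rewrite (le_trans (enormD _ _))// lerD//.
  rewrite (le_trans (enormD _ _))// !enormZ /enorm dot_axis11 dot_axis22 sqrtr1 !mulr1 lerD//.
by rewrite enormZ /enorm dot_axis33 sqrtr1 mulr1.
Qed.

Lemma body_closed : closed body.
Proof.
apply: closedI.
  by apply: (@closed_comp _ _ excess [set x | x <= 0]) => [r _|]; [exact: excess_continuous|exact: closed_le].
by apply: (@closed_comp _ _ (fun r => dot r dir) [set x | -1 <= x]) => [r _|];
  [exact: dot_continuous|exact: closed_ge].
Qed.

Lemma line_convex k (p p' : plane R) (l : R) : 0 <= hgt W k -> 0 <= l <= 1 ->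
  line W k (l * p.1 + (1 - l) * p'.1, l * p.2 + (1 - l) * p'.2) <=
  l * line W k p + (1 - l) * line W k p'.
Proof.
move=> hk /andP[l0 l1]; rewrite /line /=; set h := hgt _ _.
have l1' : 0 <= 1 - l by lra.
have : 0 <= h * (l * (1 - l)) * (p.2 - p'.2) ^+ 2.
  by rewrite mulr_ge0 ?sqr_ge0// mulr_ge0// mulr_ge0.
lra.
Qed.

Lemma body_convex : @convex_set R 'rV[R]_3 body.
Proof.
move=> r s l /set_mem[r0 r1] /set_mem[s0 s1]; apply: mem_set.
have l01 : 0 <= l%:num <= 1 by rewrite ge0 le1.
change (body (l%:num *: r + (1 - l%:num) *: s)).
move: (l%:num) l01 => m m01; have [m0 m1] := andP m01; split; last first.
  have h1 : 0 <= m * (dot r dir + 1) by rewrite mulr_ge0//; lra.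
  have h2 : 0 <= (1 - m) * (dot s dir + 1) by rewrite mulr_ge0//; lra.
  rewrite dotDl !dotZl; lra.
apply/excess_le0P => k kK.
move/excess_le0P/(_ k kK) in r0; move/excess_le0P/(_ k kK) in s0.
have hk : 0 <= hgt W k by rewrite (le_trans ler01)// hgt_ge1// slopes_le.
have := line_convex (floor_coords r) (floor_coords s) hk m01.
rewrite /floor_coords /= !dotDl !dotZl; set A := line W k _ ; set B := line W k _; set B' := line W k _.
rewrite -/A -/B -/B' in r0 s0 *.
have h1 : 0 <= m * - (B + dot r d) by rewrite mulr_ge0//; lra.
have h2 : 0 <= (1 - m) * - (B' + dot s d) by rewrite mulr_ge0//; lra.
lra.
Qed.

Lemma interior_body r : excess r < 0 -> - 1 < dot r dir -> body° r.
Proof.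
move=> r0 r1; pose U := [set r | excess r < 0] `&` [set r | - 1 < dot r dir].
have UC : U `<=` body by move=> s [s0 s1]; split; exact: ltW.
apply: (interiorS UC); rewrite ((interior_id U).1 _)//.
apply: openI.
  by apply: (@open_comp _ _ excess [set x | x < 0]) => [s _|]; [exact: excess_continuous|exact: open_lt].
by apply: (@open_comp _ _ (fun r => dot r dir) [set x | -1 < x]) => [s _|];
  [exact: dot_continuous|exact: open_gt].
Qed.

Lemma body_convex_body : convex_body body.
Proof.
split; [exact: body_convex|exact: bounded_closed_compact body_bounded body_closed|].
exists (combine3 0 (- (1 / 2)) 0); apply: interior_body.
  rewrite /excess /floor_coords !combine3_dot env0; lra.
rewrite dot_dir !combine3_dot.
have : c2 <= 1 by have := dir_unit W; have := dir2_gt0 W; have := sqr_ge0 c1; nra.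
lra.
Qed.

Lemma excess_shift r (s : R) : excess (r + s *: d) = excess r + s.
Proof.
by rewrite /excess /floor_coords !dot_lin !dot_axes !(mulr0, mulr1, addr0) addrAC.
Qed.

Lemma not_interior_body r : excess r = 0 -> ~ body° r.
Proof.
move=> r0 rI.
have [e e0 eC] := open_enormP (@open_interior _ body) rI.
have := interior_subset (eC (r + (e / 2) *: d) _).
rewrite (addrC r) addrK enormZ /enorm dot_axis22 sqrtr1 mulr1 ger0_norm ?divr_ge0 ?ltW//.
move=> /(_ _)[]; first by lra.
rewrite addrC excess_shift r0; lra.
Qed.

Lemma boundary_body r : - 1 < dot r dir -> boundary body r <-> excess r = 0.
Proof.
move=> r1; rewrite /boundary -(closure_id body).1; last exact: body_closed.
split => [[[r0 _] rI]|r0].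
  apply/eqP; rewrite eq_le r0 leNgt; apply/negP => r0'; apply: rI; exact: interior_body.
split; last exact: not_interior_body.
by split; [rewrite r0|exact: ltW].
Qed.

End wedge_geometry.

(** * Normals and regular points of the body *)

Section wedge_boundary.
Context {R : realType}.
Variable W : wedge R.
Local Notation a := (axis1 W).
Local Notation d := (axis2 W).
Local Notation u := (axis3 W).
Local Notation q := (smax W).
Local Notation c1 := (dir1 W).
Local Notation c2 := (dir2 W).
Local Notation env := (@env R W).
Local Notation active := (@active R W).

Local Notation combine3 := (combine3 W).
Local Notation dir := (dir W).
Local Notation body := (body W).

(** A unique support plane fixes the normal only up to sign. If both signs were outward, [C] would
    lie in that plane, which an interior point excludes. *)
Lemma outward_normal_unique (C : set 'rV[R]_3) r n n' : C° !=set0 ->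
  regular_points C r -> outward_unit_normals C r n -> outward_unit_normals C r n' -> n = n'.
Proof.
move=> [x0 Cx0] [_ [P [_ PU]]] nr n'r.
have planes : [set x | dot (x - r) n = 0] = [set x | dot (x - r) n' = 0].
  by rewrite -(PU [set x | dot (x - r) n = 0]) ?(PU [set x | dot (x - r) n' = 0])//;
    [exists n'|exists n].
have [n1 nC] := nr; have [n1' nC'] := n'r.
have nn : dot n n = 1 by rewrite -sqr_enorm n1 expr1n.
have nn' : dot n' n' = 1 by rewrite -sqr_enorm n1' expr1n.
(* The part of [n'] orthogonal to [n] is tangent to the common plane, hence orthogonal to [n'] too;
   so the two unit vectors have scalar product 1 or - 1. *)
pose v := n' - dot n' n *: n.
have : [set x | dot (x - r) n' = 0] (r + v).
  by rewrite -planes /= (addrC r) addrK /v dotBl dotZl nn mulr1 subrr.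
rewrite /= (addrC r) addrK /v dotBl dotZl nn' (dotC n n') => c2E.
have : (dot n' n - 1) * (dot n' n + 1) = 0 by lra.
move=> /eqP; rewrite mulf_eq0 => /orP[/eqP cE|/eqP cE].
  apply/eqP; rewrite -subr_eq0 -dotvv_eq0 !(dotBl, dotBr) nn nn' (dotC n n').
  by apply/eqP; lra.
have n'N : n' = - n.
  apply/eqP; rewrite -subr_eq0 -dotvv_eq0 !(dotBl, dotBr) !(dotNl, dotNr) nn nn' (dotC n n').
  by apply/eqP; lra.
have C0 x : C x -> dot (x - r) n = 0.
  move=> Cx; apply/eqP; rewrite eq_le nC//=; have := nC' _ Cx.
  by rewrite n'N dotNr oppr_le0.
have [e e0 eC] := open_enormP (@open_interior _ C) Cx0.
have Ce : C (x0 + (e / 2) *: n).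
  apply: interior_subset; apply: eC; rewrite (addrC x0) addrK enormZ n1 mulr1.
  by rewrite ger0_norm; lra.
exfalso; have := C0 _ Ce; rewrite addrAC dotDl dotZl nn mulr1 (C0 _ (interior_subset Cx0)); lra.
Qed.

(** The normalised gradient of y + [line] k at height z. *)
Definition normal_vec k z : 'rV[R]_3 :=
  (Num.sqrt (k ^+ 2 + 1 + (2 * hgt W k * z) ^+ 2))^-1 *: combine3 k 1 (2 * hgt W k * z).

Let rad_gt0 k z : 0 < k ^+ 2 + 1 + (2 * hgt W k * z) ^+ 2.
Proof. by rewrite -addrA ltr_wpDl ?sqr_ge0// ltr_pwDl// sqr_ge0. Qed.

Let enorm_combine3 x y z : enorm (combine3 x y z) = Num.sqrt (x ^+ 2 + y ^+ 2 + z ^+ 2).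
Proof. by rewrite /enorm (dot_coords W) !combine3_dot !expr2. Qed.

Lemma enorm_normal_vec k z : enorm (normal_vec k z) = 1.
Proof.
rewrite /normal_vec enormZ enorm_combine3 expr1n ger0_norm ?invr_ge0 ?sqrtr_ge0//.
by rewrite mulVf// gt_eqF// sqrtr_gt0.
Qed.

(** The body lies below the parabolic surface of the active slope, which passes through [r]. The
    region below that surface is convex, so its tangent plane at [r] supports the body. *)
Lemma normal_vec_outward r k : excess W r = 0 -> active (floor_coords W r) k ->
  outward_unit_normals body r (normal_vec k (dot r u)).
Proof.
move=> r0 kr; split=> [|x [/excess_le0P xK _]]; first exact: enorm_normal_vec.
rewrite /normal_vec dotZr pmulr_rle0 ?invr_gt0 ?sqrtr_gt0//.
rewrite (dot_coords W) !combine3_dot !dotBl.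
have := xK _ kr.1; move: r0; rewrite /excess (envE kr) /line /floor_coords /=.
have h0 : 0 <= hgt W k by rewrite (le_trans ler01)// hgt_ge1// slopes_le//; case: kr.
have : 0 <= hgt W k * (dot x u - dot r u) ^+ 2 by rewrite mulr_ge0// sqr_ge0.
lra.
Qed.

(* The hypothesis on (A, B, G) says that it is normal to the graph of - env at p;
   it is tested along the rays p + tau v, where the slope active at the moved point
   stays close to [k]. *)
Lemma env_unique_supergradient p k A B G :
  active p k -> (forall l, active p l -> l = k) -> 0 <= B ->
  - 1 < c1 * p.1 - c2 * env p ->
  (forall p', - 1 <= c1 * p'.1 - c2 * env p' ->
    A * (p'.1 - p.1) - B * (env p' - env p) + G * (p'.2 - p.2) <= 0) ->
  A = B * k /\ G = B * (2 * hgt W k * p.2).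
Proof.
move=> pk pu B0 lev H.
pose hm := q ^+ 2 + 1.
have q0 := smax_gt0 W; have c20 := dir2_gt0 W.
have hm0 : 0 < hm by rewrite /hm ltr_wpDl ?sqr_ge0.
suff dirs v1 v2 : A * v1 + G * v2 <= B * (k * v1 + 2 * hgt W k * p.2 * v2).
  have := dirs 1 0; have := dirs (-1) 0; have := dirs 0 1; have := dirs 0 (-1).
  by rewrite !(mulr0, mulr1, addr0, add0r, mulrN, mulrN1); split; lra.
rewrite leNgt; apply/negP; rewrite -subr_gt0; set D := (X in 0 < X) => D0.
(* [c] collects the coefficients of [eps] in the error bounds [b1], [b2], [b3]; the extra 1 makes
   the total error strictly smaller than [D = eps * c]. *)
pose c := B * (`|v1| + 2 * q * `|p.2 * v2| + hm * v2 ^+ 2) + 1.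
have c_gt0 : 0 < c.
  rewrite ltr_wpDl// mulr_ge0//; apply: addr_ge0; last by rewrite mulr_ge0 ?sqr_ge0// ltW.
  by apply: addr_ge0 => //; rewrite mulr_ge0// mulr_ge0// ltW.
pose eps := D / c; have eps0 : 0 < eps by rewrite divr_gt0.
have [delta delta0 near] := active_unique_near pk pu eps0.
pose E := q * `|v1| + hm * (2 * `|p.2 * v2| + v2 ^+ 2).
have E0 : 0 <= E.
  apply: addr_ge0; first by rewrite mulr_ge0// ltW.
  by rewrite mulr_ge0 ?(ltW hm0)//; apply: addr_ge0; rewrite ?sqr_ge0// mulr_ge0.
pose E' := `|c1 * v1| + c2 * E.
have E'0 : 0 <= E' by apply: addr_ge0 => //; rewrite mulr_ge0// ltW.
pose L := c1 * p.1 - c2 * env p + 1; have L0 : 0 < L by rewrite /L; lra.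
(* The bounds 1 and [eps] control the quadratic term, the one with [delta] keeps the active slope
   near [k], and the one with [L] keeps the moved point above the cut. *)
pose tau := Num.min (Num.min 1 eps) (Num.min (delta / (E + 1)) (L / (E' + 1))).
have tau0 : 0 < tau.
  by rewrite /tau !lt_min ltr01 eps0 !divr_gt0// ltr_wpDl.
have tau1 : tau <= 1 by rewrite /tau !ge_min lexx.
have tau_eps : tau <= eps by rewrite /tau !ge_min lexx orbT.
have tauE : tau * (E + 1) <= delta.
  by rewrite -ler_pdivlMr ?ltr_wpDl// /tau !ge_min lexx !orbT.
have tauL : tau * (E' + 1) <= L.
  by rewrite -ler_pdivlMr ?ltr_wpDl// /tau !ge_min lexx !orbT.
pose p' : plane R := (p.1 + tau * v1, p.2 + tau * v2).
have dist : q * `|p.1 - p'.1| + hm * `|p.2 ^+ 2 - p'.2 ^+ 2| <= tau * E.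
  have -> : p.1 - p'.1 = - (tau * v1) by rewrite /=; ring.
  have -> : p.2 ^+ 2 - p'.2 ^+ 2 = - (tau * (2 * (p.2 * v2) + tau * v2 ^+ 2)).
    by rewrite /=; ring.
  rewrite !normrN !(normrM tau) (ger0_norm (ltW tau0)) /E mulrDr.
  apply: lerD; first by rewrite mulrCA.
  rewrite (mulrCA hm) ler_wpM2l ?(ltW tau0)// ler_wpM2l ?(ltW hm0)//.
  rewrite (le_trans (ler_normD _ _))// lerD//.
    by rewrite (normrM 2) ger0_norm.
  by rewrite (normrM tau) (ger0_norm (ltW tau0)) (ger0_norm (sqr_ge0 v2)) ler_piMl ?sqr_ge0.
have distd : q * `|p.1 - p'.1| + hm * `|p.2 ^+ 2 - p'.2 ^+ 2| < delta.
  by apply: (le_lt_trans dist); lra.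
have [l pl] := active_exists W p'.
have lk := near _ _ distd pl.
have lev' : - 1 <= c1 * p'.1 - c2 * env p'.
  have := le_trans (env_lipschitz W p p') dist; rewrite ler_norml => /andP[e1 e2].
  have t1 : - (tau * `|c1 * v1|) <= c1 * (tau * v1).
    by rewrite mulrCA -mulrN ler_wpM2l ?(ltW tau0)// lerNl -normrN ler_norm.
  have : c2 * (env p' - env p) <= c2 * (tau * E) by rewrite ler_wpM2l ?(ltW c20)//; lra.
  rewrite /= mulrDr; move: tauL; rewrite /L /E'; lra.
have := H _ lev'.
have eu := envB_le p pl.
have -> : p'.1 - p.1 = tau * v1 by rewrite /=; ring.
have -> : p'.2 - p.2 = tau * v2 by rewrite /=; ring.
move: eu.
have -> : p'.1 - p.1 = tau * v1 by rewrite /=; ring.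
have -> : p'.2 ^+ 2 - p.2 ^+ 2 = tau * (2 * (p.2 * v2) + tau * v2 ^+ 2) by rewrite /=; ring.
move=> eu Hp.
have eu' := ler_wpM2l B0 eu.
have key : tau * (A * v1 + G * v2) <= tau * (B * (l * v1 + hgt W l * (2 * (p.2 * v2) + tau * v2 ^+ 2))).
  lra.
rewrite ler_pM2l// in key.
have b1 : (l - k) * v1 <= eps * `|v1|.
  by rewrite (le_trans (ler_norm _))// normrM ler_wpM2r// ltW.
have b2 : (hgt W l - hgt W k) * (2 * (p.2 * v2)) <= eps * (2 * q * `|p.2 * v2|).
  rewrite (le_trans (ler_norm _))// (normrM (_ - _)) (normrM 2) (@ger0_norm _ 2)//.
  have : `|hgt W l - hgt W k| <= eps * q.
    have -> : hgt W l - hgt W k = (k - l) * ((k + l) / 2) by rewrite /hgt; field.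
    rewrite normrM ler_pM// ?normr_ge0//; first by rewrite distrC ltW.
    have := slopes_le pk.1; have := slopes_le pl.1; rewrite !ler_norml => /andP[? ?] /andP[? ?].
    by apply/andP; split; lra.
  by move=> h; rewrite mulrA [leRHS](_ : _ = (eps * q) * 2 * `|p.2 * v2|); [rewrite ler_wpM2r// ler_wpM2r|ring].
have b3 : hgt W l * (tau * v2 ^+ 2) <= eps * (hm * v2 ^+ 2).
  rewrite [leRHS]mulrCA ler_pM ?hgt_le//.
  - by rewrite (le_trans ler01)// hgt_ge1// slopes_le//; case: pl.
  - by rewrite mulr_ge0 ?sqr_ge0// ltW.
  - by rewrite ler_wpM2r ?sqr_ge0.
have : l * v1 + hgt W l * (2 * (p.2 * v2) + tau * v2 ^+ 2) <=
    k * v1 + 2 * hgt W k * p.2 * v2 + eps * (`|v1| + 2 * q * `|p.2 * v2| + hm * v2 ^+ 2) by lra.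
move=> /(ler_wpM2l B0) fin.
have eD : eps * c = D by rewrite /eps divfK// gt_eqF.
have contra (x b y z S e : R) : x <= b * y -> b * y <= b * (z + e * S) ->
    e * (b * S + 1) = x - b * z -> 0 < e -> False by lra.
exact: contra key fin eD eps0.
Qed.

Lemma outward_normalE r k n : excess W r = 0 -> - 1 < dot r dir ->
  active (floor_coords W r) k -> (forall l, active (floor_coords W r) l -> l = k) ->
  outward_unit_normals body r n -> n = normal_vec k (dot r u).
Proof.
move=> r0 r1 rk ru [n1 nC].
have c20 := dir2_gt0 W.
have rd : dot r d = - env (floor_coords W r) by move: r0; rewrite /excess; lra.
(* Going down from [r] by [tau] ends on the cutting plane, still in the body; an outward normal
   cannot point that way. *)
have B0 : 0 <= dot n d.
  pose tau := (dot r dir + 1) / c2.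
  have tau0 : 0 < tau by rewrite divr_gt0//; lra.
  have : body (r - tau *: d).
    rewrite -scaleNr; split; first by rewrite excess_shift r0; lra.
    rewrite dot_dir !dotDl !dotZl dot_axis21 dot_axis22 mulr0 addr0 mulr1.
    have : tau * c2 = dot r dir + 1 by rewrite /tau divfK// gt_eqF.
    rewrite dot_dir; lra.
  move=> /nC; rewrite (addrC r) addrK dotNl dotZl oppr_le0 pmulr_rge0//.
  by rewrite dotC.
have lev : - 1 < c1 * (floor_coords W r).1 - c2 * env (floor_coords W r).
  by move: r1; rewrite dot_dir rd /=; lra.
(* Testing [n] against points of the graph fixes its direction; its length being 1 then fixes the
   factor. *)
have [|An Gn] := env_unique_supergradient (A := dot n a) (G := dot n u) rk ru B0 lev.
  move=> p' lev'; have : body (combine3 p'.1 (- env p') p'.2).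
    split; rewrite ?dot_dir /excess /floor_coords !combine3_dot; last lra.
    by case: (p') => x z /=; rewrite addNr.
  by move=> /nC; rewrite (dot_coords W) !dotBl !combine3_dot rd /=; lra.
have nE : n = dot n d *: combine3 k 1 (2 * hgt W k * dot r u).
  by apply: (combine3_inj (W := W)); rewrite !dotZl !combine3_dot ?mulr1 ?An ?Gn.
have nd : dot n d * Num.sqrt (k ^+ 2 + 1 + (2 * hgt W k * dot r u) ^+ 2) = 1.
  by move: n1; rewrite {1}nE enormZ enorm_combine3 expr1n ger0_norm.
rewrite {1}nE /normal_vec; congr (_ *: _).
have sn0 : Num.sqrt (k ^+ 2 + 1 + (2 * hgt W k * dot r u) ^+ 2) != 0.
  by rewrite gt_eqF// sqrtr_gt0.
by apply: (mulIf sn0); rewrite nd mulVf.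
Qed.

Lemma regular_body r k : excess W r = 0 -> - 1 < dot r dir ->
  active (floor_coords W r) k -> (forall l, active (floor_coords W r) l -> l = k) ->
  regular_points body r.
Proof.
move=> r0 r1 rk ru; split; first exact/boundary_body.
exists [set x | dot (x - r) (normal_vec k (dot r u)) = 0]; split.
  by exists (normal_vec k (dot r u)) => //; exact: normal_vec_outward.
by move=> _ [n rn ->]; rewrite (outward_normalE r0 r1 rk ru rn).
Qed.

Lemma normal_body r k : excess W r = 0 -> active (floor_coords W r) k ->
  regular_points body r -> normal body r = normal_vec k (dot r u).
Proof.
move=> r0 rk rreg; have rn := normal_vec_outward r0 rk.
apply: (outward_normal_unique (C := body) (r := r)) => //.
  by have [] := body_convex_body W.
exact: xgetI rn.
Qed.

End wedge_boundary.

(** * Cap, slice and tangent cone at the chosen edge point *)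

Section wedge_cap.
Context {R : realType}.
Variable W : wedge R.
Local Notation a := (axis1 W).
Local Notation d := (axis2 W).
Local Notation u := (axis3 W).
Local Notation q := (smax W).
Local Notation c1 := (dir1 W).
Local Notation c2 := (dir2 W).
Local Notation env := (@env R W).
Local Notation hgt := (@hgt R W).

Local Notation dir := (dir W).
Local Notation body := (body W).

Definition base : set (plane R) := [set p | - 1 <= c1 * p.1 - c2 * env p].

(* The surface of the body at the scale [t = s ^+ 2]: by homogeneity of [env] the
   domain [base] of the chart does not depend on [s]. *)
Definition chart s (p : plane R) : 'rV[R]_3 :=
  combine3 W (s ^+ 2 * p.1) (- (s ^+ 2 * env p)) (s * p.2).

Lemma chart_floor s p : floor_coords W (chart s p) = (s ^+ 2 * p.1, s * p.2).
Proof. by rewrite /floor_coords !combine3_dot. Qed.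

Lemma excess_chart s p : excess W (chart s p) = 0.
Proof.
rewrite /excess chart_floor combine3_dot env_scale.
by case: p => x z; rewrite /= addNr.
Qed.

Lemma chart_level s p : dot (chart s p) dir = s ^+ 2 * (c1 * p.1 - c2 * env p).
Proof. by rewrite dot_dir !combine3_dot; ring. Qed.

Lemma chartK s r : s != 0 -> excess W r = 0 -> chart s (dot r a / s ^+ 2, dot r u / s) = r.
Proof.
move=> s0 r0; have s20 : s ^+ 2 != 0 by rewrite expf_neq0.
apply: (combine3_inj (W := W)); rewrite !combine3_dot /=.
- by rewrite mulrC divfK.
- rewrite -env_scale !(mulrC s) (mulrC (s ^+ 2)) !divfK//.
  by move: r0; rewrite /excess => /eqP; rewrite addrC addr_eq0 => /eqP ->; rewrite opprK.
- by rewrite mulrC divfK.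
Qed.

Lemma cap_body s : 0 < s < 1 -> cap body 0 dir (s ^+ 2) = chart s @` base.
Proof.
move=> /andP[s0 s1]; have s20 : 0 < s ^+ 2 by rewrite exprn_gt0.
have s21 : s ^+ 2 < 1 by rewrite exprn_ilt1// ltW.
apply/seteqP; split=> [r [br]|_ [p bp <-]]; rewrite /= ?subr0.
  move=> rs; have r1 : - 1 < dot r dir by lra.
  have r0 := (boundary_body r1).1 br.
  exists (dot r a / s ^+ 2, dot r u / s); last by apply: chartK => //; rewrite gt_eqF.
  have := chart_level s (dot r a / s ^+ 2, dot r u / s).
  rewrite chartK// ?gt_eqF// => lev; move: rs; rewrite lev /base /=.
  by rewrite -{1}(mulr1 (s ^+ 2)) -mulrN ler_pM2l.
have lev : - (s ^+ 2) <= dot (chart s p) dir.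
  by rewrite chart_level -{1}(mulr1 (s ^+ 2)) -mulrN ler_pM2l.
split; last by rewrite /= subr0.
by apply/boundary_body; [lra|exact: excess_chart].
Qed.

(** The vector orthogonal to [dir] and to the edge whose component along [a] is 1, so that slice and
    cap are parametrised by the same floor coordinates. *)
Definition slice_axis : 'rV[R]_3 := a - (c1 / c2) *: d.

(** On the plane at level - s^2, the inequality [excess <= 0] rescales to the one defining [base]:
    slice and cap have the same projection to the floor along [d]. *)
Lemma slice_body s : 0 < s <= 1 -> slice body 0 dir (s ^+ 2) =
  affine2 (- (s ^+ 2 / c2) *: d) (s ^+ 2 *: slice_axis) (s *: u) @` base.
Proof.
move=> /andP[s0 s1]; have s20 : 0 < s ^+ 2 by rewrite exprn_gt0.
have s21 : s ^+ 2 <= 1 by rewrite exprn_ile1// ltW.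
have c20 := dir2_gt0 W; have c2n : c2 != 0 by rewrite gt_eqF.
have affE p : affine2 (- (s ^+ 2 / c2) *: d) (s ^+ 2 *: slice_axis) (s *: u) p =
    combine3 W (s ^+ 2 * p.1) (- s ^+ 2 / c2 - s ^+ 2 * p.1 * (c1 / c2)) (s * p.2).
  rewrite /affine2 /slice_axis /combine3; apply/rowP => i; rewrite !mxE; ring.
have exE p : excess W (affine2 (- (s ^+ 2 / c2) *: d) (s ^+ 2 *: slice_axis) (s *: u) p) =
    s ^+ 2 / c2 * (- 1 - (c1 * p.1 - c2 * env p)).
  rewrite affE /excess /floor_coords !combine3_dot env_scale.
  by case: p => x z /=; field.
apply/seteqP; split=> [r [[r0 r1]]|_ [p bp <-]]; rewrite /= ?subr0.
  move=> rl; pose p : plane R := (dot r a / s ^+ 2, dot r u / s).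
  have pr : affine2 (- (s ^+ 2 / c2) *: d) (s ^+ 2 *: slice_axis) (s *: u) p = r.
    rewrite affE; apply: (combine3_inj (W := W)); rewrite !combine3_dot /=.
    - by rewrite mulrC divfK// gt_eqF.
    - rewrite (_ : s ^+ 2 * (dot r a / s ^+ 2) = dot r a); last first.
        by rewrite mulrC divfK// gt_eqF.
      move: rl; rewrite dot_dir => rl; apply: (mulIf c2n).
      rewrite (_ : - s ^+ 2 / c2 - dot r a * (c1 / c2) = (- s ^+ 2 - c1 * dot r a) / c2); last by field.
      by rewrite divfK//; lra.
    - by rewrite mulrC divfK// gt_eqF.
  exists p => //; move: r0; rewrite -pr exE /base /=.
  by rewrite pmulr_rle0 ?divr_gt0//; lra.
have lev : dot (affine2 (- (s ^+ 2 / c2) *: d) (s ^+ 2 *: slice_axis) (s *: u) p) dir = - s ^+ 2.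
  by rewrite affE dot_dir !combine3_dot; field.
split; last by rewrite /= subr0.
split; last by rewrite lev lerN2.
by rewrite exE pmulr_rle0 ?divr_gt0//; move: bp; rewrite /base /=; lra.
Qed.

Lemma slice_axes s : 0 < s -> [/\ dot (s ^+ 2 *: slice_axis) (s *: u) = 0,
  enorm (s ^+ 2 *: slice_axis) = s ^+ 2 / c2 & enorm (s *: u) = s].
Proof.
move=> s0; have c20 := dir2_gt0 W; have c2n : c2 != 0 by rewrite gt_eqF.
have sE : dot slice_axis slice_axis = c2^-1 ^+ 2.
  rewrite /slice_axis !(dotBl, dotBr) !(dotZl, dotZr) !dot_axes !(mulr0, mulr1, subr0, sub0r, opprK).
  have -> : c2^-1 ^+ 2 = c2^-1 ^+ 2 * (c1 ^+ 2 + c2 ^+ 2) by rewrite dir_unit mulr1.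
  by field.
split.
- by rewrite /slice_axis dotZl dotZr dotBl dotZl !dot_axes !(mulr0, subr0).
- rewrite enormZ ger0_norm ?sqr_ge0// /enorm sE sqrtr_sqr ger0_norm ?invr_ge0//.
  exact: ltW.
- by rewrite enormZ /enorm dot_axis33 sqrtr1 mulr1 ger0_norm// ltW.
Qed.

Section edges.
Variables (e1 e2 : 'rV[R]_3) (al : R).
Hypothesis al0 : 0 < al.
Hypothesis e1E : e1 = al *: (d + q *: a).
Hypothesis e2E : e2 = al *: (d - q *: a).

Let dot_e1 r : dot r e1 = al * (dot r d + q * dot r a).
Proof. by rewrite e1E dotZr dotDr dotZr. Qed.

Let dot_e2 r : dot r e2 = al * (dot r d - q * dot r a).
Proof. by rewrite e2E dotZr dotBr dotZr. Qed.

Lemma tangent_cone_body : tangent_cone body 0 = dihedral 0 e1 e2.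
Proof.
apply/seteqP; split.
  have cD : closed (dihedral (0 : 'rV[R]_3) e1 e2).
    have -> : dihedral 0 e1 e2 = [set r | dot r e1 <= 0] `&` [set r | dot r e2 <= 0].
      by apply/seteqP; split => r; rewrite /dihedral /= subr0.
    apply: closedI.
      apply: (@closed_comp _ _ (fun r => dot r e1) [set x | x <= 0]); last exact: closed_le.
      by move=> r _; exact: dot_continuous.
    apply: (@closed_comp _ _ (fun r => dot r e2) [set x | x <= 0]); last exact: closed_le.
    by move=> r _; exact: dot_continuous.
  rewrite [X in _ `<=` X](closure_id _).1//; apply: closure_subset.
  move=> _ [x [[x0 x1] _] [s s0 <-]]; rewrite /dihedral /= subr0 add0r subr0 !dotZl.
  have q1 := (excess_le0P W x).1 x0 _ (slopes_smax W).
  have q2 := (excess_le0P W x).1 x0 _ (slopes_Nsmax W).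
  have h k : slopes W k -> 0 <= hgt k * dot x u ^+ 2.
    by move=> kK; rewrite mulr_ge0 ?sqr_ge0// (le_trans ler01)// hgt_ge1// slopes_le.
  have := h _ (slopes_smax W); have := h _ (slopes_Nsmax W); move: q1 q2; rewrite /line /=.
  move=> ? ? ? ?; have f1 : dot x d + q * dot x a <= 0 by lra.
  have f2 : dot x d - q * dot x a <= 0 by lra.
  by rewrite dot_e1 dot_e2; split; rewrite mulr_ge0_le0// pmulr_rle0.
move=> r [r1 r2] B.
rewrite subr0 dot_e1 pmulr_rle0// in r1; rewrite subr0 dot_e2 pmulr_rle0// in r2.
move=> Br; have [e e0 eB] := open_enormP (@open_interior _ B) Br.
(* Pushing [r] down leaves a slack [e / 2] for every slope, which will absorb the quadratic term of
   the parabolas after shrinking. *)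
pose x := r - (e / 2) *: d.
have Bx : B x.
  apply: interior_subset; apply: eB; rewrite /x (addrC r) addrK enormN enormZ /enorm dot_axis22 sqrtr1 mulr1.
  by rewrite ger0_norm; lra.
have xa : dot x a = dot r a by rewrite /x dotBl dotZl dot_axis21 mulr0 subr0.
have xd : dot x d = dot r d - e / 2 by rewrite /x dotBl dotZl dot_axis22 mulr1.
have xk k : slopes W k -> k * dot x a + dot x d <= - (e / 2).
  move=> /slopes_le; rewrite xa xd ler_norml => /andP[k1 k2].
  have [ra|ra] := leP 0 (dot r a).
    have := ler_wpM2r ra k2; lra.
  have := ler_wnM2r (ltW ra) k1; lra.
pose hm := q ^+ 2 + 1; have hm0 : 0 < hm by rewrite /hm ltr_wpDl ?sqr_ge0.
pose Z := hm * dot x u ^+ 2; have Z0 : 0 <= Z by rewrite mulr_ge0 ?sqr_ge0// ltW.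
(* The first bound makes the quadratic term at most the slack, the second keeps [s *: x] above the
   cut. *)
pose s := Num.min ((e / 2) / (Z + 1)) (1 / (`|dot x dir| + 1)).
have s0 : 0 < s by rewrite /s lt_min !divr_gt0 ?ltr_wpDl.
have sZ : s * (Z + 1) <= e / 2 by rewrite -ler_pdivlMr ?ltr_wpDl// /s ge_min lexx.
have sl : s * (`|dot x dir| + 1) <= 1 by rewrite -ler_pdivlMr ?ltr_wpDl// /s ge_min lexx orbT.
have sx : body (s *: x).
  split; last first.
    rewrite dotZl; have : - `|dot x dir| <= dot x dir by rewrite lerNl -normrN ler_norm.
    by move=> /(ler_wpM2l (ltW s0)); lra.
  apply/excess_le0P => k kK; rewrite /line /floor_coords /= !dotZl.
  have h1 : hgt k * dot x u ^+ 2 <= Z by rewrite /Z ler_wpM2r ?sqr_ge0// hgt_le.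
  have h2 := xk _ kK.
  have h3 : s * (k * dot x a + dot x d + s * (hgt k * dot x u ^+ 2)) <= 0.
    rewrite pmulr_rle0//; have := ler_wpM2l (ltW s0) h1; lra.
  by move: h3; rewrite exprMn; lra.
exists x; split=> //; exists (s *: x).
  split=> // sx0; have := xk _ (slopes_smax W).
  have x0 : x = 0 by apply/eqP; move/eqP: sx0; rewrite scaler_eq0 gt_eqF.
  by rewrite x0 !dot0l mulr0; lra.
exists s^-1; first by rewrite /= invr_ge0 ltW.
by rewrite add0r subr0 scalerA mulVf ?scale1r// gt_eqF.
Qed.

Lemma boundary_body0 : boundary body 0.
Proof.
apply/boundary_body; first by rewrite dot0l; lra.
by rewrite /excess /floor_coords !dot0l env0 addr0.
Qed.

End edges.
End wedge_cap.

Lemma density_measureP d (T : measurableType d) (R : realType)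
    (mu : {measure set T -> \bar R}) (f : T -> \bar R) :
  measurable_fun setT f -> (forall x, 0 <= f x)%E ->
  exists nu : {measure set T -> \bar R}, forall A, nu A = (\int[mu]_(x in A) f x)%E.
Proof.
move=> mf f0; pose m (A : set T) := (\int[mu]_(x in A) f x)%E.
have m0 : m set0 = 0%E by rewrite /m integral_set0.
have m_ge0 A : (0 <= m A)%E by apply: integral_ge0.
have m_add : semi_sigma_additive m.
  move=> F mF tF mUF; rewrite /m ge0_integral_bigcup//; last exact: measurable_funTS.
  by apply: is_cvg_nneseries => n _ _; exact: m_ge0.
pose M := isMeasure.Build _ _ _ m m0 m_ge0 m_add.
by exists (HB.pack m M : {measure set T -> \bar R}).
Qed.

(** * The area of the chart compared with a weighted Lebesgue measure *)

Section chart_area.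
Context {R : realType}.
Variable W : wedge R.
Local Notation a := (axis1 W).
Local Notation d := (axis2 W).
Local Notation u := (axis3 W).
Local Notation q := (smax W).
Local Notation c1 := (dir1 W).
Local Notation c2 := (dir2 W).
Local Notation env := (@env R W).
Local Notation sel := (@sel R W).
Local Notation base := (base W).

Variable c : R.
Hypothesis c_gt0 : 0 < c.
Hypothesis area_affineE : forall (o e f : 'rV[R]_3) (E : set (plane R)), dot e f = 0 ->
  0 < enorm e -> 0 < enorm f -> measurable E ->
  area (affine2 o e f @` E) = ((c * enorm e * enorm f)%:E * lebesgue2 E)%E.

Let c20 := dir2_gt0 W.

Lemma base_closed : closed (base : set (R * R)).
Proof.
apply: (@closed_comp _ _ (fun p : R * R => c1 * p.1 - c2 * env p) [set x | -1 <= x]); last exact: closed_ge.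
move=> p _; move: p; apply: continuous_add; last apply: continuous_opp; apply: continuous_mul;
  try exact: continuous_const; first by move=> p; exact: cvg_fst.
exact: env_continuous.
Qed.

Lemma base_measurable : measurable base.
Proof.
by rewrite -[X in measurable X]setCK; apply: measurableC; apply: open_measurable_plane;
  apply: closed_openC; exact: base_closed.
Qed.

Definition height_bound : R := 1 + 1 / c2.

Lemma base_height p : base p -> `|p.2| <= height_bound.
Proof.
move=> bp; have h := dir_level_le bp.
have x0 : 0 <= (q * c2 - `|c1|) * `|p.1| by rewrite mulr_ge0// subr_ge0 ltW// dir_inside.
have : p.2 ^+ 2 <= 1 / c2 by rewrite ler_pdivlMr// mulrC; lra.
rewrite /height_bound -real_normK ?num_real// => z2.
by have := sqr_ge0 (`|p.2| - 1); have := sqr_ge0 `|p.2|; lra.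
Qed.

Let width_bound := 1 / (q * c2 - `|c1|).

Let base_width p : base p -> `|p.1| <= width_bound.
Proof.
move=> bp; have h := dir_level_le bp.
have sl : 0 < q * c2 - `|c1| by rewrite subr_gt0 dir_inside.
have z0 : 0 <= c2 * p.2 ^+ 2 by rewrite mulr_ge0 ?sqr_ge0// ltW.
by rewrite /width_bound ler_pdivlMr// mulrC; lra.
Qed.

Lemma lebesgue2_base_lt : (lebesgue2 base < +oo)%E.
Proof.
pose B : set (plane R) :=
  `[- width_bound, width_bound]%classic `*` `[- height_bound, height_bound]%classic.
apply: (@le_lt_trans _ _ (lebesgue2 B)).
  apply: le_measure; rewrite ?inE; [exact: base_measurable|by apply: measurableX; exact: measurable_itv|].
  move=> p bp; split; rewrite /= in_itv/= -ler_norml; [exact: base_width|exact: base_height].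
rewrite product_measure1E; [|exact: measurable_itv|exact: measurable_itv].
rewrite /= !lebesgue_measure_itv/= !lte_fin.
by do 2 case: ifP => _; rewrite ?mule0 ?mul0e ?ltry// -!EFinD -EFinM ltry.
Qed.

Definition rectangle (x z r : R) : set (plane R) :=
  `](x - r), (x + r)[%classic `*` `](z - r), (z + r)[%classic.

Lemma lebesgue2_rectangle x z r : 0 < r -> (0 < lebesgue2 (rectangle x z r))%E.
Proof.
move=> r0; rewrite product_measure1E; [|exact: measurable_itv|exact: measurable_itv].
have lt s : (s - r)%R < s + r by lra.
by rewrite /= !lebesgue_measure_itv/= !lte_fin !lt -!EFinD -EFinM lte_fin mulr_gt0//; lra.
Qed.

Lemma chart_measureP s : 0 < s ->
  exists mu : {measure set (plane R) -> \bar R}, forall E, mu E = area (chart W s @` E).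
Proof.
move=> s0; have s20 : 0 < s ^+ 2 by rewrite exprn_gt0.
apply: (@image_area_measure _ (chart W s) (fun r => dot r a * (s ^+ 2)^-1)
  (fun r => dot r u * s^-1) (excess W)).
- by apply: continuous_mul; [exact: dot_continuous|exact: continuous_const].
- by apply: continuous_mul; [exact: dot_continuous|exact: continuous_const].
- exact: excess_continuous.
- by move=> p; rewrite combine3_dot mulrC mulKf// gt_eqF.
- by move=> p; rewrite combine3_dot mulrC mulKf// gt_eqF.
- by move=> p; exact: excess_chart.
- by move=> r r0; apply: chartK => //; rewrite gt_eqF.
Qed.

(* The area density of the plane of slope [sel p], which the surface approaches
   after rescaling. *)
Definition weight (p : plane R) : R := Num.sqrt (1 + sel p ^+ 2).

Lemma weight_measurable : measurable_fun setT weight.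
Proof.
apply: (measurableT_comp (continuous_measurable_fun (@sqrt_continuous R))).
apply: measurable_funD; first exact: measurable_cst.
by apply: measurable_funX; exact: sel_measurable.
Qed.

Lemma weight_ge1 p : 1 <= weight p.
Proof.
by rewrite /weight -[leLHS]sqrtr1 ler_wsqrtr// lerDl sqr_ge0.
Qed.

Lemma weight_le p : weight p <= Num.sqrt (1 + q ^+ 2).
Proof.
rewrite /weight ler_wsqrtr// lerD2l -(real_normK (num_real (sel p))).
by rewrite lerXn2r ?nnegrE ?sel_le// ltW// smax_gt0.
Qed.

Let sqrt_close (k l eps : R) : `|k - l| <= eps ->
  Num.sqrt (1 + k ^+ 2) <= (1 + eps) * Num.sqrt (1 + l ^+ 2).
Proof.
move=> kl; have e0 : 0 <= eps by rewrite (le_trans _ kl).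
set S := Num.sqrt (1 + l ^+ 2).
have S2 : S ^+ 2 = 1 + l ^+ 2 by rewrite sqr_sqrtr// addr_ge0// sqr_ge0.
have S1 : 1 <= S by rewrite /S -[leLHS]sqrtr1 ler_wsqrtr// lerDl sqr_ge0.
have lS : `|l| <= S.
  by rewrite -[leLHS]sqrtr_sqr /S ler_wsqrtr// lerDr.
have kS : `|k| <= `|l| + eps by have := ler_dist_dist k l; rewrite ler_norml => /andP[_ ?]; lra.
have S0 : 0 <= (1 + eps) * S by rewrite mulr_ge0//; lra.
rewrite -[leRHS](ger0_norm S0) -sqrtr_sqr ler_wsqrtr//.
have k2 : k ^+ 2 <= (`|l| + eps) ^+ 2.
  by rewrite -(real_normK (num_real k)) lerXn2r ?nnegrE ?addr_ge0.
have l2 : `|l| ^+ 2 = l ^+ 2 by rewrite real_normK// num_real.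
have h1 : eps * `|l| <= eps * S by rewrite ler_wpM2l.
have h2 : eps * S <= eps * S ^+ 2 by rewrite ler_wpM2l// expr2 ler_peMl//; lra.
have h3 : eps ^+ 2 <= eps ^+ 2 * S ^+ 2.
  by rewrite ler_peMr ?sqr_ge0// expr2; nra.
rewrite exprMn; nra.
Qed.

Let hm := q ^+ 2 + 1.

(** The two charts differ only along [d]. There a change of z^2 is scaled by s^2, while the affine
    chart stretches z by s only; this is the factor s in the second error term. *)
Let chart_close k0 eps s p p' : 0 < s -> base p -> base p' ->
  `|sel p - k0| <= eps -> `|sel p' - k0| <= eps ->
  let L := affine2 0 (s ^+ 2 *: (a - k0 *: d)) (s *: u) in
  enorm (chart W s p - chart W s p' - (L p - L p')) <=
    (eps + 2 * hm * height_bound * s) * enorm (L p - L p').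
Proof.
move=> s0 bp bp' pk pk'; cbv zeta; set L := affine2 _ _ _.
have s20 : 0 < s ^+ 2 by rewrite exprn_gt0.
have eps0 : 0 <= eps by rewrite (le_trans _ pk).
have hm0 : 0 <= hm by rewrite addr_ge0// sqr_ge0.
have -> : chart W s p - chart W s p' - (L p - L p') =
    - (s ^+ 2 * (env p - env p' - k0 * (p.1 - p'.1))) *: d.
  by rewrite /L /affine2 /chart /combine3; apply/rowP => i; rewrite !mxE; ring.
have nd : enorm d = 1 by rewrite /enorm dot_axis22 sqrtr1.
have na : enorm a = 1 by rewrite /enorm dot_axis11 sqrtr1.
have nu : enorm u = 1 by rewrite /enorm dot_axis33 sqrtr1.
rewrite enormZ nd mulr1 normrN normrM (ger0_norm (ltW s20)).
have Lx : s ^+ 2 * `|p.1 - p'.1| <= enorm (L p - L p').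
  have := abs_dot_le (L p - L p') a; rewrite na mulr1; apply: le_trans.
  rewrite /L affine2B !dot_lin dot_axis11 (dotC d a) dot_axis12 (dotC u a) dot_axis13.
  rewrite !(mulr0, mulr1, addr0, subr0, oppr0) normrM mulrC.
  by rewrite (ger0_norm (ltW s20)).
have Lz : s * `|p.2 - p'.2| <= enorm (L p - L p').
  have := abs_dot_le (L p - L p') u; rewrite nu mulr1; apply: le_trans.
  rewrite /L affine2B !dot_lin dot_axis13 dot_axis23 dot_axis33.
  rewrite !(mulr0, mulr1, addr0, add0r, subr0, oppr0) normrM mulrC.
  by rewrite (ger0_norm (ltW s0)).
have := envB_abs (sel_active W p) (sel_active W p') pk pk' => H.
have z2 : `|p.2 ^+ 2 - p'.2 ^+ 2| <= 2 * height_bound * `|p.2 - p'.2|.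
  rewrite subr_sqr normrM mulrC ler_wpM2r//.
  rewrite (le_trans (ler_normD _ _))//.
  by have := base_height bp; have := base_height bp'; lra.
apply: (@le_trans _ _ (eps * (s ^+ 2 * `|p.1 - p'.1|) +
    2 * hm * height_bound * s * (s * `|p.2 - p'.2|))).
  have := ler_wpM2l (ltW s20) H; have := ler_wpM2l (ltW s20) (ler_wpM2l hm0 z2).
  rewrite -/hm; lra.
rewrite [leRHS]mulrDl; apply: lerD; first by rewrite ler_wpM2l.
have hb0 : 0 <= height_bound by rewrite addr_ge0// divr_ge0// ltW.
by rewrite ler_wpM2l// mulr_ge0 ?(ltW s0)// mulr_ge0// mulr_ge0.
Qed.

Variable Wm : {measure set (plane R) -> \bar R}.
Hypothesis WmE : forall E, Wm E = (\int[lebesgue2]_(p in E) (weight p)%:E)%E.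

Let Wm_window k0 eps E : measurable E -> (forall p, E p -> `|sel p - k0| <= eps) ->
  0 <= eps ->
  (Wm E <= ((1 + eps) * Num.sqrt (1 + k0 ^+ 2))%:E * lebesgue2 E)%E /\
  ((Num.sqrt (1 + k0 ^+ 2))%:E * lebesgue2 E <= (1 + eps)%:E * Wm E)%E.
Proof.
move=> mE Ek e0; have mw : measurable_fun E (EFin \o weight).
  by apply/measurable_EFinP; apply: measurable_funTS; exact: weight_measurable.
have w0 p : (0 <= (weight p)%:E)%E by rewrite lee_fin (le_trans ler01)// weight_ge1.
have e1 : 0 <= 1 + eps by lra.
split; rewrite WmE.
  rewrite -(integral_cst lebesgue2 mE); apply: ge0_le_integral => //.
  by move=> p Ep; rewrite lee_fin sqrt_close// Ek.
have -> : ((1 + eps)%:E * \int[lebesgue2]_(p in E) (weight p)%:E =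
    \int[lebesgue2]_(p in E) ((1 + eps)%:E * (weight p)%:E))%E.
  by rewrite ge0_integralZl.
rewrite -(integral_cst lebesgue2 mE); apply: ge0_le_integral => //.
- by move=> p _; rewrite lee_fin sqrtr_ge0.
- exact: measurable_funeM.
by move=> p Ep; rewrite -EFinM lee_fin sqrt_close// distrC Ek.
Qed.

(* Where the slopes are within [eps] of [k0], the chart is a small Lipschitz
   perturbation of the affine chart of the plane of slope [k0]. *)
Let chart_window k0 eps eta s E : 0 < s -> 0 <= eps -> eta < 1 -> measurable E -> E `<=` base ->
  (forall p, E p -> `|sel p - k0| <= eps) ->
  eps + 2 * hm * height_bound * s <= eta ->
  (area (chart W s @` E) <= ((1 + eta) ^+ 2 * (1 + eps) * (c * s ^+ 3))%:E * Wm E)%E /\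
  ((c * s ^+ 3)%:E * Wm E <= ((1 + eps) / (1 - eta) ^+ 2)%:E * area (chart W s @` E))%E.
Proof.
move=> s0 e0 eta1 mE Eb Ek heta.
have s20 : 0 < s ^+ 2 by rewrite exprn_gt0.
pose L := affine2 0 (s ^+ 2 *: (a - k0 *: d)) (s *: u).
set S := Num.sqrt (1 + k0 ^+ 2).
have S0 : 0 < S by rewrite sqrtr_gt0 ltr_pwDl// sqr_ge0.
have hm0 : 0 <= hm by rewrite addr_ge0// sqr_ge0.
have hb0 : 0 <= height_bound by rewrite addr_ge0// divr_ge0// ltW.
have eta0 : 0 <= eta.
  apply: le_trans heta; rewrite addr_ge0// mulr_ge0 ?(ltW s0)// mulr_ge0// mulr_ge0//.
have close p p' : E p -> E p' ->
    enorm (chart W s p - chart W s p' - (L p - L p')) <= eta * enorm (L p - L p').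
  move=> Ep Ep'; apply: le_trans (chart_close s0 (Eb _ Ep) (Eb _ Ep') (Ek _ Ep) (Ek _ Ep')) _.
  by rewrite ler_wpM2r// enorm_ge0.
have areaL : area (L @` E) = ((c * s ^+ 3 * S)%:E * lebesgue2 E)%E.
  have en1 : enorm (s ^+ 2 *: (a - k0 *: d)) = s ^+ 2 * S.
    rewrite enormZ (ger0_norm (ltW s20)) /S /enorm; congr (_ * Num.sqrt _).
    rewrite !(dotBl, dotBr, dotZl, dotZr) (dotC d a) dot_axis11 dot_axis12 dot_axis22.
    by ring.
  have en2 : enorm (s *: u) = s by rewrite enormZ (ger0_norm (ltW s0)) /enorm dot_axis33 sqrtr1 mulr1.
  rewrite /L area_affineE// ?en1 ?en2 ?mulr_gt0//.
    by congr (_ %:E * _)%E; ring.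
  by rewrite dotZl dotZr dotBl dotZl dot_axis13 dot_axis23 !mulr0 subrr !mulr0.
have up : (area (chart W s @` E) <= ((1 + eta) ^+ 2)%:E * area (L @` E))%E.
  apply: area_lipschitz => [|p p' Ep Ep']; first by lra.
  have := close _ _ Ep Ep'.
  have := enormD (chart W s p - chart W s p' - (L p - L p')) (L p - L p'); rewrite subrK; lra.
have down : (area (L @` E) <= ((1 - eta)^-1 ^+ 2)%:E * area (chart W s @` E))%E.
  apply: area_lipschitz => [|p p' Ep Ep']; first by rewrite invr_gt0; lra.
  rewrite ler_pdivlMl; last by lra.
  have := close _ _ Ep Ep'; rewrite enormB.
  have := enormD (L p - L p' - (chart W s p - chart W s p')) (chart W s p - chart W s p').
  rewrite subrK; lra.
have [W1 W2] := Wm_window mE Ek e0.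
have cs0 : 0 <= c * s ^+ 3 by rewrite mulr_ge0 ?exprn_ge0// ltW.
split.
  apply: le_trans up _; rewrite areaL (EFinM (c * s ^+ 3)) -muleA.
  have -> : (((1 + eta) ^+ 2 * (1 + eps) * (c * s ^+ 3))%:E * Wm E =
      ((1 + eta) ^+ 2)%:E * ((c * s ^+ 3)%:E * ((1 + eps)%:E * Wm E)))%E.
    by rewrite !muleA -!EFinM; congr (_ %:E * _)%E; ring.
  apply: lee_wpmul2l; first by rewrite lee_fin sqr_ge0.
  by apply: lee_wpmul2l => //; rewrite lee_fin.
apply: (@le_trans _ _ ((1 + eps)%:E * area (L @` E))%E).
  rewrite areaL muleA -EFinM; apply: le_trans (lee_wpmul2l _ W1) _; first by rewrite lee_fin.
  rewrite muleA -EFinM le_eqVlt; apply/orP; left; apply/eqP; congr (_ %:E * _)%E.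
  by rewrite -/S; ring.
rewrite (EFinM (1 + eps)) -muleA; apply: lee_wpmul2l; first by rewrite lee_fin addr_ge0.
by rewrite -exprVn.
Qed.

(** [E] is cut by slope into finitely many windows, each compared with its plane. Since [s0] is
    independent of [E], this is a comparison of measures and passes to integrals. *)
Lemma chart_compare rho : 1 < rho -> exists2 s0, 0 < s0 & forall s, 0 < s < s0 ->
  forall E, measurable E -> E `<=` base ->
  (area (chart W s @` E) <= (rho * (c * s ^+ 3))%:E * Wm E)%E /\
  ((c * s ^+ 3)%:E * Wm E <= rho%:E * area (chart W s @` E))%E.
Proof.
(* [eta] is chosen so that both factors of [chart_window] are at most [rho]. Half of it is the width
   of a window, the other half bounds the curvature term [B * s]. *)
move=> rho1; pose eta := (rho - 1) / (8 * rho).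
have rho0 : 0 < rho by lra.
have eta0 : 0 < eta by rewrite divr_gt0// ?mulr_gt0//; lra.
have etaE : eta * (8 * rho) = rho - 1 by rewrite /eta divfK// gt_eqF// mulr_gt0.
have eta1 : eta < 1 / 8 by rewrite /eta ltr_pdivrMr ?mulr_gt0//; lra.
pose eps := eta / 2; have eps0 : 0 < eps by rewrite divr_gt0.
have hm0 : 0 <= hm by rewrite addr_ge0// sqr_ge0.
have hb0 : 0 <= height_bound by rewrite addr_ge0// divr_ge0// ltW.
pose B := 2 * hm * height_bound; have B0 : 0 <= B by rewrite !mulr_ge0.
exists (eps / (B + 1)) => [|s /andP[s0 ss]]; first by rewrite divr_gt0// ltr_wpDl.
have heta : eps + B * s <= eta.
  have : s * (B + 1) <= eps by rewrite -ler_pdivlMr ?ltr_wpDl// ltW.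
  rewrite /eps; lra.
have r1 : (1 + eta) ^+ 2 * (1 + eps) <= rho.
  have : (1 + eta) ^+ 2 * (1 + eps) <= (1 + eta) ^+ 3.
    by rewrite [leRHS]exprSr ler_wpM2l ?sqr_ge0// /eps; lra.
  have : (1 + eta) ^+ 3 <= 1 + 7 * eta by nra.
  have : 7 * eta <= rho - 1 by nra.
  lra.
have r2 : (1 + eps) / (1 - eta) ^+ 2 <= rho.
  rewrite ler_pdivrMr ?exprn_gt0//; last by lra.
  have : 1 - 2 * eta <= (1 - eta) ^+ 2 by nra.
  move=> /(ler_wpM2l (ltW rho0)); rewrite /eps; nra.
have cs0 : 0 <= c * s ^+ 3 by rewrite mulr_ge0 ?exprn_ge0// ltW.
have [mu muE] := chart_measureP s0.
have q0 := smax_gt0 W.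
have msel (x : R) : measurable [set p | sel p < x].
  rewrite -[X in measurable X]setTI; have := sel_measurable W measurableT (measurable_itv `]-oo, x[).
  by congr (measurable (_ `&` _)); apply/seteqP; split => p /=; rewrite in_itv.
(* Induction on the number of windows, splitting off the topmost one, whose lower end serves as
   reference slope. With no window left, [E] is empty because [sel] is at least [- q]. *)
have P n : forall E, measurable E -> E `<=` base -> (forall p, E p -> sel p < - q + n%:R * eps) ->
    (mu E <= (rho * (c * s ^+ 3))%:E * Wm E)%E /\ ((c * s ^+ 3)%:E * Wm E <= rho%:E * mu E)%E.
  elim: n => [|n IHn] E mE Eb En.
    rewrite (_ : E = set0) ?measure0 ?mule0//.
    rewrite -subset0 => p /En; rewrite mul0r addr0 => selp.
    by have := sel_le W p; rewrite ler_norml => /andP[h _]; move: selp; rewrite ltNge h.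
  pose A := [set p | sel p < - q + n%:R * eps].
  have mA : measurable A by exact: msel.
  have [||h1 h2] := IHn _ (measurableI _ _ mE mA).
  - by move=> p [/Eb].
  - by move=> p [].
  have [||||h3 h4] := @chart_window (- q + n%:R * eps) eps eta s _ s0 (ltW eps0) _ (measurableD mE mA).
  - by lra.
  - by move=> p [/Eb].
  - move=> p [Ep /negP]; rewrite -leNgt => pl; rewrite ger0_norm ?subr_ge0//.
    by have := En _ Ep; rewrite -natr1; lra.
  - by rewrite -/B.
  rewrite -muE in h3; rewrite -muE in h4.
  rewrite (measureDI mu mE mA) (measureDI Wm mE mA); split.
    rewrite muleDr ?ge0_adde_def ?inE//; apply: leeD => //; apply: le_trans h3 _.
    by apply: lee_wpmul2r => //; rewrite lee_fin ler_wpM2r.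
  rewrite !muleDr ?ge0_adde_def ?inE//; apply: leeD => //; apply: le_trans h4 _.
  by apply: lee_wpmul2r => //; rewrite lee_fin.
move=> E mE Eb; rewrite -muE; apply: (P (Num.truncn (2 * q / eps)).+1) => // p _.
have : 2 * q < (Num.truncn (2 * q / eps)).+1%:R * eps.
  by rewrite -ltr_pdivrMr// truncnS_gt.
by have := sel_le W p; rewrite ler_norml => /andP[_ ?]; lra.
Qed.

End chart_area.

(** * Weak convergence of the normal distributions *)

Section integral_transfer.
Context {R : realType} d1 d2 (T1 : measurableType d1) (T2 : measurableType d2).
Variables (m : {measure set T1 -> \bar R}) (nu : {measure set T2 -> \bar R}).
Variables (D : set T1) (S : set T2) (phi : T1 -> T2) (k : R).
Hypotheses (mD : measurable D) (mS : measurable S) (mphi : measurable_fun setT phi).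
Hypotheses (k0 : 0 <= k) (phiS : forall p, S (phi p)).
Hypothesis nuE : forall A, measurable A -> nu A = (k%:E * m (D `&` phi @^-1` A))%E.

Lemma ge0_integral_transfer (f : T2 -> \bar R) : measurable_fun S f ->
  (forall x, S x -> 0 <= f x)%E ->
  (\int[nu]_(x in S) f x = k%:E * \int[m]_(p in D) f (phi p))%E.
Proof.
move=> mf f0; pose K := NngNum k0.
have [pf pfE] := pushforward_measureP (mrestr m mD) mphi.
rewrite (eq_measure_integral (mscale K pf)); last first.
  move=> A mA _; rewrite nuE// /mscale /=; congr (_ * _)%E.
  by rewrite pfE /mrestr setIC.
rewrite ge0_integral_mscale//; congr (_ * _)%E.
transitivity (\int[mrestr m mD]_(p in phi @^-1` S) (f \o phi) p)%E.
  rewrite -(ge0_integral_pushforward mphi)//; last by move=> x /set_mem; exact: f0.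
  by apply: eq_measure_integral => A mA _; exact: pfE.
(* The preimage of [S] is the whole space, and the complement of [D] is null for the restricted
   measure. *)
have -> : phi @^-1` S = D `|` ~` D.
  by rewrite setUv; apply/seteqP; split => // p _; exact: phiS.
have mfphi : measurable_fun setT (f \o phi).
  apply: (measurable_comp mS _ mf mphi) => _ [p _ <-]; exact: phiS.
have mDC : measurable (~` D) by exact: measurableC.
rewrite ge0_integral_setU//; last 3 first.
- exact: measurable_funTS.
- by move=> p _; apply: f0; exact: phiS.
- by rewrite disj_set2E setICr.
rewrite [X in (_ + X)%E](_ : _ = 0%E) ?adde0; last first.
  apply: null_set_integral => //; last by rewrite /= /mrestr setICl measure0.
  exact: measurable_funTS.
by apply: eq_measure_integral => A mA AD; rewrite /= /mrestr setIidl.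
Qed.
End integral_transfer.

Lemma continuous_scale_vec {R : realType} {T : topologicalType} (f : T -> R) (v : 'rV[R]_3) :
  continuous f -> continuous (fun x => f x *: v).
Proof. by move=> cf x; apply: cvgZl; exact: cf. Qed.

Lemma continuous_add_vec {R : realType} {T : topologicalType} (f g : T -> 'rV[R]_3) :
  continuous f -> continuous g -> continuous (fun x => f x + g x).
Proof. by move=> cf cg x; apply: (@continuousD R 'rV[R]_3 T f g x); [exact: cf|exact: cg]. Qed.

Section sphere_functions.
Context {R : realType}.

Lemma sphere_closed : closed (sphere R).
Proof.
apply: (@closed_comp _ _ (fun v => enorm v) [set x | x = 1]) => [v _|]; first exact: enorm_continuous.
exact: closed_eq.
Qed.

Lemma sphere_compact : compact (sphere R).
Proof.
apply: bounded_closed_compact; last exact: sphere_closed.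
exists 1; split=> [|M M1 v /= v1]; first exact: num_real.
by rewrite (le_trans (norm_le_enorm v))// v1 ltW.
Qed.

Lemma sphere_measurable : measurable (sphere R : set (borelR3 R)).
Proof. by apply: closed_measurable3; exact: sphere_closed. Qed.

Lemma within_continuous_measurable3 (D : set 'rV[R]_3) (f : 'rV[R]_3 -> R) : closed D ->
  {within D, continuous f} -> measurable_fun (D : set (borelR3 R)) f.
Proof.
move=> cD /continuousP cf; apply: (measurability _ (RGenOpens.measurableE R)).
move=> _ [_ [x [y ->] <-]].
have oI : open (`]x, y[%classic : set R) by exact: interval_open.
have /open_subspaceP[V oV VD] := cf _ oI.
rewrite setIC -VD; apply: measurableI; first exact: open_measurable3.
exact: closed_measurable3.
Qed.
End sphere_functions.

Section weak_limit.
Context {R : realType}.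
Variable W : wedge R.
Local Notation a := (axis1 W).
Local Notation d := (axis2 W).
Local Notation u := (axis3 W).
Local Notation q := (smax W).
Local Notation c2 := (dir2 W).
Local Notation sel := (@sel R W).
Local Notation base := (base W).

(** At [s = 0] this is the limit normal, orthogonal to the edge. *)
Definition normal_chart s (p : plane R) : 'rV[R]_3 := normal_vec W (sel p) (s * p.2).

Lemma normal_vec_continuous : continuous (fun p : R * R => normal_vec W p.1 p.2).
Proof.
have c_1 : continuous (fst : R * R -> R) by move=> p; exact: cvg_fst.
have c_2 : continuous (snd : R * R -> R) by move=> p; exact: cvg_snd.
have ch : continuous (fun p : R * R => 2 * hgt W p.1 * p.2).
  apply: continuous_mul => //; apply: continuous_mul; first exact: continuous_const.
  apply: continuous_add; first exact: continuous_const.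
  apply: continuous_opp; apply: continuous_mul; last exact: continuous_const.
  exact: continuous_pow.
pose r (p : R * R) : R := p.1 ^+ 2 + 1 + (2 * hgt W p.1 * p.2) ^+ 2.
have r0 p : 0 < r p by rewrite /r -addrA ltr_wpDl ?sqr_ge0// ltr_pwDl// sqr_ge0.
have cr : continuous (fun p => (Num.sqrt (r p))^-1).
  move=> p; apply: cvgV; first by rewrite gt_eqF// sqrtr_gt0.
  apply: (@continuous_comp _ _ _ r Num.sqrt); last exact: sqrt_continuous.
  move: p; apply: continuous_add; last exact: continuous_pow.
  by apply: continuous_add; [exact: continuous_pow|exact: continuous_const].
have -> : (fun p : R * R => normal_vec W p.1 p.2) = fun p =>
    ((Num.sqrt (r p))^-1 * p.1) *: a + (Num.sqrt (r p))^-1 *: d +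
    ((Num.sqrt (r p))^-1 * (2 * hgt W p.1 * p.2)) *: u.
  by apply/funext => p; rewrite /normal_vec /combine3 !scalerDr !scalerA mulr1.
apply: continuous_add_vec; first apply: continuous_add_vec;
  apply: continuous_scale_vec => //; exact: continuous_mul.
Qed.

Lemma normal_chart_measurable s :
  measurable_fun setT (normal_chart s : plane R -> borelR3 R).
Proof.
have m1 := measurable_plane_to_R3 normal_vec_continuous.
have mg : measurable_fun setT (fun p : plane R => (sel p, s * p.2) : plane R).
  apply: measurable_fun_pair; first exact: sel_measurable.
  by apply: measurable_funM; [exact: measurable_cst|exact: measurable_snd].
exact: (measurableT_comp m1 mg).
Qed.

Lemma normal_chart_sphere s p : sphere R (normal_chart s p).
Proof. exact: enorm_normal_vec. Qed.

Variable c : R.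
Hypothesis c_gt0 : 0 < c.
Hypothesis area_affineE : forall (o e f : 'rV[R]_3) (E : set (plane R)), dot e f = 0 ->
  0 < enorm e -> 0 < enorm f -> measurable E ->
  area (affine2 o e f @` E) = ((c * enorm e * enorm f)%:E * lebesgue2 E)%E.
Variable Wm : {measure set (plane R) -> \bar R}.
Hypothesis WmE : forall E, Wm E = (\int[lebesgue2]_(p in E) (weight W p)%:E)%E.

Let mb := base_measurable W.

Let mw E : measurable_fun E (EFin \o weight W).
Proof. by apply/measurable_EFinP; apply: measurable_funTS; exact: weight_measurable. Qed.

Let weight_ge0 p : (0 <= (weight W p)%:E)%E.
Proof. by rewrite lee_fin (le_trans ler01)// weight_ge1. Qed.

Lemma Wm_le E : measurable E -> (Wm E <= (Num.sqrt (1 + q ^+ 2))%:E * lebesgue2 E)%E.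
Proof.
move=> mE; rewrite WmE -(integral_cst lebesgue2 mE); have mwE := @mw E.
apply: ge0_le_integral => //.
by move=> p _; rewrite lee_fin weight_le.
Qed.

Lemma Wm_ge E : measurable E -> (lebesgue2 E <= Wm E)%E.
Proof.
move=> mE; rewrite WmE -[leLHS]mul1e -(integral_cst lebesgue2 mE); have mwE := @mw E.
apply: ge0_le_integral => //.
by move=> p _; rewrite lee_fin weight_ge1.
Qed.

Lemma Wm_base_lt : (Wm base < +oo)%E.
Proof.
apply: le_lt_trans (Wm_le mb) _; rewrite lte_mul_pinfty ?lee_fin ?sqrtr_ge0//.
exact: lebesgue2_base_lt.
Qed.

Lemma lebesgue2_open (U : set (R * R)) p : open U -> U p -> (0 < lebesgue2 (U : set (plane R)))%E.
Proof.
move=> oU Up; have := oU; rewrite openE => /(_ _ Up) /nbhs_ballP[e /= e0 pU].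
apply: lt_le_trans (lebesgue2_rectangle p.1 p.2 e0) _.
apply: le_measure; rewrite ?inE; [|exact: open_measurable_plane|].
  by apply: measurableX; exact: measurable_itv.
move=> [x z] [/=]; rewrite !in_itv/= => xp zp; apply: pU.
by split; rewrite /ball/= distrC ltr_distl.
Qed.

Lemma base_interior_open : open ([set p | - 1 < dir1 W * p.1 - c2 * env W p] : set (R * R)).
Proof.
apply: (@open_comp _ _ (fun p : R * R => dir1 W * p.1 - c2 * env W p) [set x | -1 < x]); last exact: open_gt.
move=> p _; move: p; apply: continuous_add; last apply: continuous_opp; apply: continuous_mul;
  try exact: continuous_const; first by move=> p; exact: cvg_fst.
exact: env_continuous.
Qed.

Definition base_area : R := fine (lebesgue2 base).

Lemma base_areaE : lebesgue2 base = base_area%:E.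
Proof. by rewrite /base_area fineK// ge0_fin_numE// lebesgue2_base_lt. Qed.

Lemma base_area_gt0 : 0 < base_area.
Proof.
rewrite -lte_fin -base_areaE; apply: lt_le_trans (lebesgue2_open base_interior_open (p := (0, 0)) _) _.
  by rewrite /= env0 !mulr0 subr0; lra.
apply: le_measure; rewrite ?inE; [exact: open_measurable_plane base_interior_open|exact: mb|].
by move=> p /= /ltW.
Qed.

Definition slice_factor s : R := c * s ^+ 3 * base_area / c2.

Lemma slice_factor_gt0 s : 0 < s -> 0 < slice_factor s.
Proof.
by move=> s0; rewrite divr_gt0 ?(dir2_gt0 W)// mulr_gt0 ?base_area_gt0// mulr_gt0// exprn_gt0.
Qed.

(** The limit measure. Its constant is the ratio of [c * s ^+ 3] to [slice_factor s], in which both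
    [c] and [s] cancel. *)
Variable nus : {measure set (borelR3 R) -> \bar R}.
Hypothesis nusE : forall A, measurable A ->
  nus A = ((c2 / base_area)%:E * Wm (base `&` normal_chart 0 @^-1` A))%E.

Section test_function.
Variable f : 'rV[R]_3 -> R.
Hypothesis cf : {within sphere R, continuous f}.
Hypothesis f0 : forall x, sphere R x -> 0 <= f x.

(** Separates two limits: here the density is already the limit one and only the normals depend on
    [s]; the areas are replaced by means of [chart_compare], whose multiplicative form calls for
    nonnegative [f]. *)
Let G s := (\int[Wm]_(p in base) (f (normal_chart s p))%:E)%E.

Let mf s : measurable_fun setT (fun p => (f (normal_chart s p))%:E).
Proof.
apply/measurable_EFinP.
apply: (measurable_comp sphere_measurable _ (within_continuous_measurable3 sphere_closed cf)
  (normal_chart_measurable s)).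
by move=> _ [p _ <-]; exact: normal_chart_sphere.
Qed.

Let f_bound : exists2 B, 0 <= B & forall x, sphere R x -> f x <= B.
Proof.
have [|x /set_mem Sx xmax] := compact_EVT_max _ sphere_compact cf.
  by exists (normal_chart 0 (0, 0)); exact: normal_chart_sphere.
by exists (f x) => [|y Sy]; [exact: f0|apply: xmax; exact: mem_set].
Qed.

Let G_cvg (v : R^nat) : v @ \oo --> 0 -> G (v n) @[n --> \oo] --> G 0.
Proof.
move=> v0; have [B B0 fB] := f_bound.
have [] := @dominated_convergence _ _ _ Wm _ mb (fun n p => (f (normal_chart (v n) p))%:E)
  (fun p => (f (normal_chart 0 p))%:E) (fun=> B%:E).
- by move=> n; apply: measurable_funTS; exact: mf.
- by apply: measurable_funTS; exact: mf.
- apply: aeW => p _; apply: cvg_EFin; first by apply: nearW.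
  have nc : normal_chart (v n) p @[n --> \oo] --> normal_chart 0 p.
    have pc : (sel p, v n * p.2) @[n --> \oo] --> ((sel p, 0 * p.2) : R * R).
      have h1 : (fun=> sel p) @ \oo --> sel p by exact: cvg_cst.
      have h2 : v n * p.2 @[n --> \oo] --> 0 * p.2 by apply: cvgM => //; exact: cvg_cst.
      exact: (cvg_pair h1 h2).
    exact: (cvg_comp _ _ pc (@normal_vec_continuous (sel p, 0 * p.2))).
  (* [f] is continuous only along the sphere, on which all these normals lie. *)
  move/subspace_continuousP : cf => /(_ _ (normal_chart_sphere 0 p)) cfp.
  move=> A /cfp; rewrite /within /= => fA.
  have [N _ HN] := nc _ fA; exists N => // n /HN; apply; exact: normal_chart_sphere.
- apply/integrableP; split; first exact: measurable_cst.
  rewrite (eq_integral (cst B%:E)); last by move=> p _; rewrite /= ger0_norm.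
  by rewrite integral_cst// lte_mul_pinfty// Wm_base_lt.
- apply: aeW => p n _; rewrite /= lee_fin ger0_norm ?f0//; last exact: normal_chart_sphere.
  by apply: fB; exact: normal_chart_sphere.
by [].
Qed.

Let G_fin s : G s \is a fin_num.
Proof.
have [B B0 fB] := f_bound; rewrite ge0_fin_numE; last first.
  by apply: integral_ge0 => p _; rewrite lee_fin f0//; exact: normal_chart_sphere.
apply: (@le_lt_trans _ _ (\int[Wm]_(p in base) (cst B%:E p))%E).
  apply: ge0_le_integral => //.
  - by move=> p _; rewrite lee_fin f0//; exact: normal_chart_sphere.
  - by apply: measurable_funTS; exact: mf.
  - by move=> p _; rewrite lee_fin fB//; exact: normal_chart_sphere.
by rewrite integral_cst// lte_mul_pinfty// Wm_base_lt.
Qed.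

Let G_cvg0 : fine (G s) @[s --> 0^'+] --> fine (G 0).
Proof.
apply/cvg_at_rightP => v [_ v0].
by apply: fine_cvg; rewrite fineK ?G_fin//; exact: G_cvg.
Qed.

Let G_ge0 s : 0 <= fine (G s).
Proof.
by rewrite fine_ge0//; apply: integral_ge0 => p _; rewrite lee_fin f0//; exact: normal_chart_sphere.
Qed.

Let integral_nus : (\int[nus]_(x in sphere R) (f x)%:E)%E = (c2 / base_area * fine (G 0))%:E.
Proof.
rewrite (ge0_integral_transfer mb sphere_measurable (normal_chart_measurable 0) _
  (normal_chart_sphere 0) nusE).
- by rewrite (EFinM (c2 / base_area)) fineK ?G_fin.
- by rewrite divr_ge0// ltW ?base_area_gt0 ?(dir2_gt0 W).
- apply/measurable_EFinP; apply: within_continuous_measurable3 => //; exact: sphere_closed.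
- by move=> x Sx; rewrite lee_fin f0.
Qed.

Lemma test_function_fin : (\int[nus]_(x in sphere R) (f x)%:E)%E \is a fin_num.
Proof. by rewrite integral_nus. Qed.

Lemma test_function_cvg e : 0 < e -> exists2 s0, 0 < s0 & forall s, 0 < s < s0 ->
  forall nu : {measure set (borelR3 R) -> \bar R},
  (forall A, measurable A ->
    nu A = (((slice_factor s)^-1)%:E * area (chart W s @` (base `&` normal_chart s @^-1` A)))%E) ->
  (\int[nu]_(x in sphere R) (f x)%:E)%E \is a fin_num /\
  `|fine (\int[nu]_(x in sphere R) (f x)%:E)%E - fine (\int[nus]_(x in sphere R) (f x)%:E)%E| <= e.
Proof.
move=> e0; have ba0 := base_area_gt0; have c20 := dir2_gt0 W.
pose k := c2 / base_area; have k0 : 0 < k by rewrite divr_gt0.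
pose M := k * fine (G 0) + e; have M0 : 0 < M by rewrite ltr_wpDl// mulr_ge0 ?G_ge0// ltW.
(* Half of the error comes from the area factor, as (rho - 1) M <= e / 2, the other half from [G s]
   tending to [G 0]. *)
pose rho := 1 + e / (2 * (M + 1)).
have rho1 : 1 < rho by rewrite ltrDl divr_gt0// mulr_gt0//; lra.
have [s1 s10 cmp] := chart_compare c_gt0 area_affineE WmE rho1.
have ek : 0 < e / 2 / k by rewrite !divr_gt0.
have /cvgrPdist_le/(_ _ ek) [s2 /= s20 Gs2] := G_cvg0.
exists (Num.min s1 s2) => [|s /andP[s0]]; first by rewrite lt_min s10.
rewrite lt_min => /andP[ss1 ss2] nu nuE.
have Gs : `|fine (G 0) - fine (G s)| <= e / 2 / k.
  by apply: Gs2 => //=; rewrite sub0r normrN ger0_norm// ltW.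
have {}cmp := cmp s; rewrite s0 ss1 in cmp; have {}cmp := cmp isT.
have [mu muE] := chart_measureP W s0.
have cs0 : 0 < c * s ^+ 3 by rewrite mulr_gt0// exprn_gt0.
have nuE' A : measurable A ->
    nu A = (((slice_factor s)^-1)%:E * mu (base `&` normal_chart s @^-1` A))%E.
  by move=> mA; rewrite nuE// muE.
have sf0 := slice_factor_gt0 s0.
pose g (p : plane R) : \bar R := (f (normal_chart s p))%:E.
have g0 p : (0 <= g p)%E by rewrite lee_fin f0//; exact: normal_chart_sphere.
have mg : measurable_fun setT g by exact: mf.
have mgb : measurable_fun base g by exact: measurable_funTS.
have intE : (\int[nu]_(x in sphere R) (f x)%:E =
    ((slice_factor s)^-1)%:E * \int[mu]_(p in base) g p)%E.
  apply: (ge0_integral_transfer mb sphere_measurable (normal_chart_measurable s) _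
    (normal_chart_sphere s) nuE').
  - by rewrite invr_ge0 ltW.
  - apply/measurable_EFinP; apply: within_continuous_measurable3 => //; exact: sphere_closed.
  - by move=> x Sx; rewrite lee_fin f0.
(* The area comparison concerns subsets of [base]; restricting the measures turns it into one for
   all measurable sets. *)
have restrict (m : {measure set (plane R) -> \bar R}) :
    (\int[mrestr m mb]_(p in base) g p = \int[m]_(p in base) g p)%E.
  by apply: eq_measure_integral => A mA Ab; rewrite /= /mrestr setIidl.
have GE : G s = (\int[mrestr Wm mb]_(p in base) g p)%E by rewrite restrict.
have cmp' A : measurable A -> measurable (A `&` base) /\ A `&` base `<=` base.
  by move=> mA; split; [exact: measurableI|move=> ? []].
have rc0 : 0 <= rho * (c * s ^+ 3) by rewrite mulr_ge0 ?(ltW cs0)//; lra.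
have up : (\int[mu]_(p in base) g p <= (rho * (c * s ^+ 3))%:E * G s)%E.
  rewrite -restrict GE.
  rewrite -(ge0_integral_mscale (mrestr Wm mb) mb (NngNum rc0))//.
  apply: ge0_le_measure_integral => //.
  move=> A mA; have [mAb Ab] := cmp' A mA.
  by rewrite /mscale /= /mrestr muE; have [] := cmp _ mAb Ab.
have rho0 : 0 <= rho by lra.
have down : ((c * s ^+ 3)%:E * G s <= rho%:E * \int[mu]_(p in base) g p)%E.
  rewrite -restrict GE.
  rewrite -(ge0_integral_mscale (mrestr Wm mb) mb (NngNum (ltW cs0)))//.
  rewrite -(ge0_integral_mscale (mrestr mu mb) mb (NngNum rho0))//.
  apply: ge0_le_measure_integral => //.
  move=> A mA; have [mAb Ab] := cmp' A mA.
  by have [_] := cmp _ mAb Ab; rewrite -muE.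
have Jfin : (\int[mu]_(p in base) g p)%E \is a fin_num.
  rewrite ge0_fin_numE ?integral_ge0// (le_lt_trans up)//.
  by rewrite -(fineK (G_fin s)) -EFinM ltry.
move: up down; rewrite -(fineK (G_fin s)) -(fineK Jfin) -!EFinM !lee_fin.
set J := fine (integral _ _ _) => up down.
rewrite intE -(fineK Jfin) -/J -EFinM integral_nus; split => //=.
have sfE : (slice_factor s)^-1 = k / (c * s ^+ 3).
  by rewrite /slice_factor /k invf_div (mulrC (c * s ^+ 3)) invfM mulrA.
rewrite sfE -/k.
pose j := k / (c * s ^+ 3) * J.
pose h := k * fine (G s).
have jh : j <= rho * h.
  rewrite /j /h -mulrA (mulrC _ J) mulrA ler_pdivrMr//.
  have := ler_wpM2l (ltW k0) up; lra.
have hj : h <= rho * j.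
  have -> : rho * j = k * (rho * J) / (c * s ^+ 3) by rewrite /j; ring.
  rewrite /h ler_pdivlMr//; have := ler_wpM2l (ltW k0) down; lra.
have hg : `|k * fine (G 0) - h| <= e / 2.
  by rewrite /h -mulrBr normrM (ger0_norm (ltW k0)) mulrC -ler_pdivlMr.
have h0 : 0 <= h by rewrite mulr_ge0 ?G_ge0// ltW.
have hM : h <= M by move: hg; rewrite /M ler_norml => /andP[? ?]; lra.
have rM : (rho - 1) * h <= e / 2.
  have r1e : (rho - 1) * (2 * (M + 1)) = e.
    by rewrite /rho addrC addKr divfK// gt_eqF// mulr_gt0//; lra.
  have : 0 <= rho - 1 by lra.
  nra.
rewrite -/j; move: hg; rewrite ler_norml => /andP[hg1 hg2].
have j0 : 0 <= j by rewrite -(pmulr_rge0 _ (lt_trans ltr01 rho1)); lra.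
have : h - j <= (rho - 1) * h by nra.
by rewrite ler_norml => hj2; apply/andP; split; lra.
Qed.

End test_function.
End weak_limit.

Section finite_measure_of.
Context d (T : measurableType d) (R : realType).
Variables (mu : {measure set T -> \bar R}) (muT : (mu setT < +oo)%E).

Let mu' : set T -> \bar R := mu.

HB.instance Definition _ := Measure.copy mu' mu.

Let fin : fin_num_fun mu'.
Proof.
by move=> A mA; rewrite ge0_fin_numE// (le_lt_trans _ muT)// le_measure ?inE.
Qed.

HB.instance Definition _ := @Measure_isFinite.Build _ T R mu' fin.

Lemma finite_measureP : exists nu : {finite_measure set T -> \bar R}, forall A, nu A = mu A.
Proof. by exists mu'. Qed.

End finite_measure_of.

Section wedge_measures.
Context {R : realType}.
Variable W : wedge R.
Local Notation sel := (@sel R W).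
Local Notation body := (body W).
Local Notation dir := (dir W).
Local Notation chart := (chart W).

Variable c : R.
Hypothesis c_gt0 : 0 < c.
Hypothesis area_affineE : forall (o e f : 'rV[R]_3) (E : set (plane R)), dot e f = 0 ->
  0 < enorm e -> 0 < enorm f -> measurable E ->
  area (affine2 o e f @` E) = ((c * enorm e * enorm f)%:E * lebesgue2 E)%E.
Variable Wm : {measure set (plane R) -> \bar R}.
Hypothesis WmE : forall E, Wm E = (\int[lebesgue2]_(p in E) (weight W p)%:E)%E.

Let mb := base_measurable W.

Lemma area_slice s : 0 < s <= 1 ->
  area (slice body 0 dir (s ^+ 2)) = (slice_factor W c s)%:E.
Proof.
move=> s01; have [s0 s1] := andP s01; have c20 := dir2_gt0 W.
have [ab na nb] := slice_axes W s0.
rewrite slice_body// area_affineE ?na ?nb ?divr_gt0 ?exprn_gt0//.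
rewrite base_areaE -EFinM /slice_factor; congr EFin.
by ring.
Qed.

(* A regular point of the cap has the chart normal, and all points of the chart
   off the null set [nonsmooth] are regular. *)
Lemma cap_normal_subset s (A : set 'rV[R]_3) : 0 < s < 1 ->
  (chart s @` ((base W `\` nonsmooth W) `&` normal_chart W s @^-1` A) `<=`
  [set r | (cap body 0 dir (s ^+ 2) `&` regular_points body) r /\ A (normal body r)]) /\
  ([set r | (cap body 0 dir (s ^+ 2) `&` regular_points body) r /\ A (normal body r)] `<=`
  chart s @` (base W `&` normal_chart W s @^-1` A)).
Proof.
move=> s01; have [s0 s1] := andP s01.
have act p k : active W p k <-> active W (floor_coords W (chart s p)) k.
  by rewrite chart_floor; split => /active_scale; apply.
have chart_normal p : regular_points body (chart s p) ->
    normal body (chart s p) = normal_chart W s p.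
  move=> rp; have := sel_active W p; rewrite act => /(normal_body (excess_chart W s p))/(_ rp) ->.
  by rewrite /normal_chart !combine3_dot.
split=> [_ [p [[bp np] Ap] <-]|r [[]]]; last first.
  by rewrite cap_body// => -[p bp <-] /chart_normal ->; exists p.
have lev : - 1 < dot (chart s p) dir.
  rewrite chart_level; move: bp; rewrite /base /= => bp.
  have s21 : s ^+ 2 < 1 by rewrite exprn_ilt1// ltW.
  have s20 : 0 < s ^+ 2 by rewrite exprn_gt0.
  by have := ler_wpM2l (ltW s20) bp; lra.
have rp : regular_points body (chart s p).
  apply: (@regular_body _ _ _ (sel p)) => //; first exact: excess_chart.
    by rewrite -act; exact: sel_active.
  move=> l; rewrite -act => pl; exact: active_unique np pl (sel_active W p).
split; last by rewrite chart_normal.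
by split => //; rewrite cap_body//; exists p.
Qed.

Lemma nu_body : exists2 s0, 0 < s0 & forall s, 0 < s < s0 ->
  (0 < area (slice body 0 dir (s ^+ 2)))%E /\
  forall A : set (borelR3 R), measurable A ->
  nu body 0 dir (s ^+ 2) A = (((slice_factor W c s)^-1)%:E *
    area (chart s @` (base W `&` normal_chart W s @^-1` A)))%E.
Proof.
(* Any ratio above 1 serves: the comparison is used only to carry null sets from Lebesgue measure to
   area. *)
have rho1 : 1 < 2 :> R by lra.
have [s1 s10 cmp] := chart_compare c_gt0 area_affineE WmE rho1.
exists (Num.min 1 s1) => [|s /andP[s0]]; first by rewrite lt_min ltr01.
rewrite lt_min => /andP[ss ss1]; have s01 : 0 < s < 1 by rewrite s0.
have sf0 := slice_factor_gt0 W c_gt0 s0.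
have sarea : area (slice body 0 dir (s ^+ 2)) = (slice_factor W c s)%:E.
  by apply: area_slice; rewrite s0 ltW.
split=> [|A mA]; first by rewrite sarea lte_fin.
rewrite /nu sarea inver gt_eqF//; congr (_ * _)%E.
have [sub1 sub2] := cap_normal_subset A s01.
apply/eqP; rewrite eq_le; apply/andP; split; first exact: le_outer_measure sub2.
apply: le_trans (le_outer_measure (@area R) _ _ sub1).
have [mu muE] := chart_measureP W s0.
have mN := nonsmooth_measurable W.
have mnA : measurable (normal_chart W s @^-1` A).
  by rewrite -[X in measurable X]setTI; exact: normal_chart_measurable.
have mN0 : mu (base W `&` nonsmooth W) = 0%E.
  have mbN : measurable (base W `&` nonsmooth W) by exact: measurableI.
  have [|h _] := cmp s _ _ mbN (@subIsetl _ _ _); first by rewrite s0.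
  apply/eqP; rewrite eq_le measure_ge0 andbT muE (le_trans h)//.
  have -> : Wm (base W `&` nonsmooth W) = 0%E; last by rewrite mule0.
  apply/eqP; rewrite eq_le measure_ge0 andbT (le_trans (Wm_le WmE mbN))//.
  have -> : lebesgue2 (base W `&` nonsmooth W) = 0%E; last by rewrite mule0.
  apply/eqP; rewrite eq_le measure_ge0 andbT -(lebesgue2_nonsmooth W).
  by apply: le_measure; rewrite ?inE//; move=> p [].
rewrite -!muE.
have -> : base W `&` normal_chart W s @^-1` A =
    ((base W `\` nonsmooth W) `&` normal_chart W s @^-1` A) `|`
    ((base W `&` nonsmooth W) `&` normal_chart W s @^-1` A).
  rewrite -setIUl; congr (_ `&` _); apply/seteqP; split=> [p bp|p [[]|[]]//].
  by have [?|?] := pselect (nonsmooth W p); [right|left].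
have m1 : measurable ((base W `\` nonsmooth W) `&` normal_chart W s @^-1` A).
  by apply: measurableI => //; exact: measurableD.
have m2 : measurable ((base W `&` nonsmooth W) `&` normal_chart W s @^-1` A).
  by apply: measurableI => //; exact: measurableI.
apply: le_trans (measureU2 _ m1 m2) _.
rewrite [X in (_ + X <= _)%E](_ : _ = 0%E).
  by rewrite adde0 le_eqVlt; apply/orP; left; apply/eqP; exact: muE.
apply/eqP; rewrite eq_le; apply/andP; split; last exact: measure_ge0.
rewrite -[leRHS]mN0; apply: le_measure; rewrite ?inE; [|exact: measurableI|by move=> p []].
by apply: measurableI => //; exact: measurableI.
Qed.

End wedge_measures.

Lemma restrict_pushforwardP d1 d2 (T1 : measurableType d1) (T2 : measurableType d2)
    (R : realType) (m : {measure set T1 -> \bar R}) (D : set T1) (phi : T1 -> T2) (k : R) :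
  measurable D -> measurable_fun setT phi -> 0 <= k ->
  exists nu : {measure set T2 -> \bar R}, forall A, nu A = (k%:E * m (D `&` phi @^-1` A))%E.
Proof.
move=> mD mphi k0; have [pf pfE] := pushforward_measureP (mrestr m mD) mphi.
by exists (mscale (NngNum k0) pf) => A; rewrite /= /mscale /= pfE /mrestr setIC.
Qed.

(** * The limit measure and its support *)

Section wedge_limit.
Context {R : realType}.
Variable W : wedge R.
Local Notation c2 := (dir2 W).
Local Notation sel := (@sel R W).
Local Notation base := (base W).
Local Notation body := (body W).
Local Notation dir := (dir W).
Local Notation chart := (chart W).

Let mb := base_measurable W.

Lemma sqrt_near0 (s0 : R) : 0 < s0 -> \forall t \near 0^'+, 0 < Num.sqrt t < s0 /\ Num.sqrt t ^+ 2 = t.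
Proof.
move=> s00; near=> t.
have t0 : 0 < t by [].
rewrite sqrtr_gt0 t0 sqr_sqrtr ?ltW//; split => //=.
rewrite -(ger0_norm (ltW s00)) -sqrtr_sqr ltr_sqrt ?exprn_gt0//.
near: t; apply: nbhs_right_lt; exact: exprn_gt0.
Unshelve. all: by end_near.
Qed.

Lemma normal_near k (U : set 'rV[R]_3) : open U -> U (normal_vec W k 0) ->
  exists2 eps, 0 < eps & forall k', `|k' - k| < eps -> U (normal_vec W k' 0).
Proof.
move=> oU Uk.
have cn : continuous (fun k' : R => normal_vec W k' 0).
  move=> x; have pc : (k', 0 : R) @[k' --> x] --> ((x, 0) : R * R).
    by apply: (cvg_pair (cvg_id) (cvg_cst _)).
  exact: (cvg_comp _ _ pc (@normal_vec_continuous _ W (x, 0))).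
have : nbhs (normal_vec W k 0) U by exact: open_nbhs_nbhs.
move=> /cn /nbhs_ballP[e /= e0 eU]; exists e => // k' kk'.
by apply: eU; rewrite /ball/= distrC.
Qed.

(** If x / z^2 is within eps / 2 of the slope [k], the slope nearest to it is within eps of [k].
    Such points form an open set, and homogeneity moves one of them into the interior of [base]. *)
Lemma base_direction k eps (U : set (R * R)) : slopes W k -> 0 < eps ->
  (forall p, base p -> `|sel p - k| < eps -> U p) -> measurable (U : set (plane R)) ->
  (0 < lebesgue2 (base `&` U : set (plane R)))%E.
Proof.
move=> Wk e0 UU mU; pose g (p : R * R) := eps * p.2 ^+ 2 - 2 * `|p.1 - k * p.2 ^+ 2|.
have cg : continuous g.
  have c_2 : continuous (snd : R * R -> R) by move=> p; exact: cvg_snd.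
  apply: continuous_add; first apply: continuous_mul; [exact: continuous_const|exact: continuous_pow|].
  apply: continuous_opp; apply: continuous_mul; first exact: continuous_const.
  apply: continuous_abs; apply: continuous_add; first by move=> p; exact: cvg_fst.
  by apply: continuous_opp; apply: continuous_mul; [exact: continuous_const|exact: continuous_pow].
have oV : open [set p | 0 < g p].
  by apply: (@open_comp _ _ g [set x | 0 < x]); [move=> p _; exact: cg|exact: open_gt].
have oB := openI (@base_interior_open _ W) oV.
(* The point (k, 1) is shrunk along the parabola x = k z^2; its level scales by z^2, and z^2 M < 1
   keeps it above - 1. *)
pose M := `|dir1 W * k - c2 * env W (k, 1)|; pose z := (1 + M)^-1.
have M0 : 0 <= M by exact: normr_ge0.
have z0 : 0 < z by rewrite invr_gt0 ltr_wpDr.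
have zM : z * (1 + M) = 1 by rewrite mulVf// gt_eqF// ltr_wpDr.
have pV : ([set p | - 1 < dir1 W * p.1 - c2 * env W p] `&` [set p | 0 < g p]) (z ^+ 2 * k, z * 1).
  split; rewrite /g /= ?mulr1; last first.
    by rewrite (mulrC k) subrr normr0 mulr0 subr0 mulr_gt0// exprn_gt0.
  rewrite -[X in (_, X)](mulr1 z) env_scale.
  have : - M <= dir1 W * k - c2 * env W (k, 1) by rewrite lerNl /M -normrN ler_norm.
  have z1 : z <= 1 by nra.
  have : z ^+ 2 * M < 1 by nra.
  have : 0 < z ^+ 2 by rewrite exprn_gt0.
  nra.
apply: lt_le_trans (lebesgue2_open oB pV) _.
apply: le_measure; rewrite ?inE; [exact: open_measurable_plane|exact: measurableI|].
move=> p [/ltW bp gp]; split => //; apply: UU => //.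
have p20 : p.2 != 0.
  apply: contraTneq gp => p20; rewrite /g /= p20 expr0n !mulr0 sub0r subr0.
  by rewrite oppr_gt0 -leNgt mulr_ge0.
have p2 : 0 < p.2 ^+ 2 by rewrite exprn_even_gt0.
have := sel_active W p; rewrite [X in active _ X](surjective_pairing p) => /(active_near p20)/(_ Wk).
set w := p.1 / _ => h.
have : 2 * `|k - w| < eps.
  rewrite -(ltr_pM2r p2) -mulrA -[X in _ * (_ * X)](ger0_norm (ltW p2)) -normrM mulrBl.
  by rewrite /w divfK ?gt_eqF// distrC; move: gp; rewrite /g /=; lra.
have -> : sel p - k = (sel p - w) - (k - w) by lra.
move=> h2; have := ler_normB (sel p - w) (k - w); lra.
Qed.

Lemma wedge_limit : closed [set normal_vec W k 0 | k in slopes W] ->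
  exists (nu_ : R -> {measure set (borelR3 R) -> \bar R})
         (nustar : {finite_measure set (borelR3 R) -> \bar R}),
  [/\ \forall t \near 0^'+, (0 < area (slice body 0 dir t))%E /\
        forall A : set (borelR3 R), measurable A -> nu_ t A = nu body 0 dir t A,
      nustar (~` sphere R) = 0%E,
      weak_cvg 0^'+ nu_ nustar &
      spt nustar = [set normal_vec W k 0 | k in slopes W]].
Proof.
move=> cK; have [c c0 area_affineE] := @area_affine R.
have mw : measurable_fun setT (fun p => (weight W p)%:E).
  by apply/measurable_EFinP; exact: weight_measurable.
have w0 p : (0 <= (weight W p)%:E)%E by rewrite lee_fin (le_trans ler01)// weight_ge1.
have [Wm WmE] := density_measureP lebesgue2 mw w0.
have ba0 := base_area_gt0 W; have c20 := dir2_gt0 W.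
have k0 : 0 <= c2 / base_area W by rewrite divr_ge0// ltW.
have [nus nusE] := restrict_pushforwardP Wm mb (@normal_chart_measurable _ W 0) k0.
have nusT : (nus setT < +oo)%E.
  by rewrite nusE preimage_setT setIT lte_mul_pinfty// (Wm_base_lt WmE).
have [nustar nustarE] := finite_measureP nusT.
have nustarE' (A : set (borelR3 R)) : measurable A ->
    nustar A = ((c2 / base_area W)%:E * Wm (base `&` normal_chart W 0 @^-1` A))%E.
  by rewrite nustarE nusE.
(* For [t <= 0] the measure is a dummy: only right neighbourhoods of 0 matter. *)
have ex (t : R) : exists m : {measure set (borelR3 R) -> \bar R}, 0 < t ->
    forall A, m A = (((slice_factor W c (Num.sqrt t))^-1)%:E *
      area (chart (Num.sqrt t) @` (base `&` normal_chart W (Num.sqrt t) @^-1` A)))%E.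
  have [t0|t0] := ltP 0 t; last by exists nus.
  have s0 : 0 < Num.sqrt t by rewrite sqrtr_gt0.
  have [mu muE] := chart_measureP W s0.
  have f0 : 0 <= (slice_factor W c (Num.sqrt t))^-1.
    by rewrite invr_ge0 ltW// slice_factor_gt0.
  have [m mE] := restrict_pushforwardP mu mb (@normal_chart_measurable _ W (Num.sqrt t)) f0.
  by exists m => _ A; rewrite mE muE.
have [nu_ nu_E] := choice ex.
exists nu_, nustar; split.
- have [s0 s00 H] := nu_body c0 area_affineE WmE.
  have := sqrt_near0 s00; apply: filterS => t [ts st].
  have t0 : 0 < t by case/andP: ts; rewrite sqrtr_gt0.
  have := H _ ts; rewrite st => -[h1 h2]; split => // A mA.
  by rewrite h2// nu_E.
- rewrite nustarE' ?[X in Wm X](_ : _ = set0) ?measure0 ?mule0//.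
    rewrite -subset0 => p [_]; apply; exact: normal_chart_sphere.
  by apply: measurableC; exact: sphere_measurable.
- move=> f cf.
  (* Nonnegative functions come first; [f] is then split into its positive and negative parts, whose
     limit integrals are finite, so that the difference converges. *)
  have P (g : 'rV[R]_3 -> R) : {within sphere R, continuous g} -> (forall x, 0 <= g x) ->
      (\int[nu_ t]_(x in sphere R) (g x)%:E)%E @[t --> 0^'+] -->
      (\int[nustar]_(x in sphere R) (g x)%:E)%E /\
      (\int[nustar]_(x in sphere R) (g x)%:E)%E \is a fin_num.
    move=> cg g0; have g0' x : sphere R x -> 0 <= g x by [].
    have gfin := test_function_fin WmE nustarE' cg g0'.
    split => //; rewrite -(fineK gfin); apply/fine_cvgP.
    have near_int e : 0 < e -> \forall t \near 0^'+,
        (\int[nu_ t]_(x in sphere R) (g x)%:E)%E \is a fin_num /\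
        `|fine (\int[nu_ t]_(x in sphere R) (g x)%:E)%E -
          fine (\int[nustar]_(x in sphere R) (g x)%:E)%E| <= e.
      move=> e0.
      have [s0 s00 H] := test_function_cvg c0 area_affineE WmE nustarE' cg g0' e0.
      have := sqrt_near0 s00; apply: filterS => t [ts st].
      apply: (H _ ts) => A mA; apply: nu_E.
      by case/andP: ts; rewrite sqrtr_gt0.
    split; first by have := near_int 1 ltr01; apply: filterS => t [].
    apply/cvgrPdist_le => e e0.
    by have := near_int e e0; apply: filterS => t [_]; rewrite distrC.
  have cabs : {within sphere R, continuous (fun x => `|f x|)}.
    by move=> x; apply: cvg_norm; exact: cf.
  have cpos : {within sphere R, continuous (fun x => (`|f x| + f x) / 2)}.
    by move=> x; apply: cvgMl; apply: cvgD; [exact: cabs|exact: cf].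
  have cneg : {within sphere R, continuous (fun x => (`|f x| - f x) / 2)}.
    by move=> x; apply: cvgMl; apply: cvgB; [exact: cabs|exact: cf].
  have pos0 x : 0 <= (`|f x| + f x) / 2.
    by have := ler_norm (- f x); rewrite normrN; lra.
  have neg0 x : 0 <= (`|f x| - f x) / 2 by have := ler_norm (f x); lra.
  have intE (m : {measure set (borelR3 R) -> \bar R}) : (\int[m]_(x in sphere R) (f x)%:E =
      \int[m]_(x in sphere R) ((`|f x| + f x) / 2)%:E -
      \int[m]_(x in sphere R) ((`|f x| - f x) / 2)%:E)%E.
    rewrite integralE; congr (_ - _)%E; apply: eq_integral => x _.
      rewrite funeposE -EFin_max; congr EFin.
      by have [?|?] := leP (f x) 0; [rewrite ler0_norm|rewrite gtr0_norm]; lra.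
    rewrite funenegE -EFinN -EFin_max; congr EFin.
    by have [?|?] := leP (- f x) 0; [rewrite ger0_norm|rewrite ltr0_norm]; lra.
  have [p1 p2] := P _ cpos pos0; have [n1 n2] := P _ cneg neg0.
  rewrite intE; under eq_fun do rewrite intE.
  by apply: cvgeB => //; rewrite fin_num_adde_defl// fin_numN.
apply/seteqP; split=> [v vspt|_ [k Wk <-] U oU Uk].
  have [//|Kv] := pselect ([set normal_vec W k 0 | k in slopes W] v).
  have := vspt (~` [set normal_vec W k 0 | k in slopes W]) (closed_openC cK) Kv.
  rewrite nustarE' ?[X in Wm X](_ : _ = set0) ?measure0 ?mule0 ?ltxx//; last first.
    by apply: open_measurable3; exact: closed_openC.
  rewrite -subset0 => p [_]; apply; exists (sel p); first by have [] := sel_active W p.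
  by rewrite /normal_chart mul0r.
have mU := open_measurable3 oU.
have mnU : measurable (normal_chart W 0 @^-1` U).
  by rewrite -[X in measurable X]setTI; exact: normal_chart_measurable.
have [eps e0 epsU] := normal_near oU Uk.
rewrite nustarE'// mule_gt0 ?lte_fin ?divr_gt0//.
apply: lt_le_trans (Wm_ge WmE _); last exact: measurableI.
apply: (base_direction Wk e0) => // p _ /epsU.
by rewrite /preimage /= /normal_chart mul0r.
Qed.

End wedge_limit.

(** * The orthonormal frame and the wedge adapted to the given data *)

Section frame.
Context {R : realType}.
Implicit Types v w a d : 'rV[R]_3.

(** Indices add modulo 3, so one cyclic formula gives all components. *)
Definition cross v w : 'rV[R]_3 :=
  \row_i (v 0 (i + 1) * w 0 (i + 1 + 1) - v 0 (i + 1 + 1) * w 0 (i + 1)).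

Let i3 : (1 + 1 + 1 = 0 :> 'I_3) * (0 + 1 = 1 :> 'I_3) * (1 + 1 + 1 + 1 = 1 :> 'I_3).
Proof. by split; first split; apply/val_inj. Qed.

Lemma dot_crossl v w : dot v (cross v w) = 0.
Proof. by rewrite dotE !mxE !i3; ring. Qed.

Lemma dot_crossr v w : dot w (cross v w) = 0.
Proof. by rewrite dotE !mxE !i3; ring. Qed.

Lemma dot_cross_cross v w :
  dot (cross v w) (cross v w) = dot v v * dot w w - dot v w ^+ 2.
Proof. by rewrite !dotE !mxE !i3; ring. Qed.

Lemma cross_cross w a d : cross w (cross a d) = dot w d *: a - dot w a *: d.
Proof.
apply/rowP => i; rewrite !mxE !dotE.
have : [|| i == 0, i == 1 | i == 1 + 1] by case: i => -[|[|[|]]].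
by case/or3P => /eqP ->; rewrite !i3; ring.
Qed.

(** The remainder [w] is orthogonal to [a], [d] and [u]. The double product formula gives a zero
    cross product of [w] and [u], and Lagrange's identity then forces [w] to vanish. *)
Lemma cross_span a d : dot a a = 1 -> dot d d = 1 -> dot a d = 0 ->
  forall r, r = dot r a *: a + dot r d *: d + dot r (cross a d) *: cross a d.
Proof.
move=> aa dd ad r; set u := cross a d.
have uu : dot u u = 1 by rewrite dot_cross_cross aa dd ad expr0n mulr1 subr0.
have au : dot a u = 0 by exact: dot_crossl.
have du : dot d u = 0 by exact: dot_crossr.
pose w := r - (dot r a *: a + dot r d *: d + dot r u *: u).
have wa : dot w a = 0.
  by rewrite /w dotBl !dotDl !dotZl aa (dotC d) ad (dotC u) au; ring.
have wd : dot w d = 0 by rewrite /w dotBl !dotDl !dotZl dd ad (dotC u) du; ring.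
have wu : dot w u = 0 by rewrite /w dotBl !dotDl !dotZl uu au du; ring.
have : dot w w = 0.
  have := dot_cross_cross w u; rewrite cross_cross wa wd !scale0r subr0 dot0l uu wu.
  by rewrite mulr1 expr0n subr0.
by move/eqP; rewrite dotvv_eq0 subr_eq0 => /eqP.
Qed.

End frame.

Lemma wedge_exists (R : realType) (e1 e2 : 'rV[R]_3) (l1 l2 : R) (K : set 'rV[R]_3) :
  enorm e1 = 1 -> enorm e2 = 1 -> e1 <> e2 -> e1 <> - e2 -> 0 < l1 -> 0 < l2 ->
  enorm (l1 *: e1 + l2 *: e2) = 1 -> closed K -> [set e1; e2] `<=` K ->
  K `<=` [set v | enorm v = 1 /\
     exists m1 m2 : R, [/\ 0 <= m1, 0 <= m2 & v = m1 *: e1 + m2 *: e2]] ->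
  exists (W : wedge R) (al : R), [/\ 0 < al, e1 = al *: (axis2 W + smax W *: axis1 W),
    e2 = al *: (axis2 W - smax W *: axis1 W), l1 *: e1 + l2 *: e2 = dir W &
    [set normal_vec W k 0 | k in slopes W] = K].
Proof.
move=> he1 he2 he12 he12N l10 l20 hen cK eK KGamma.
have unit_dot v : enorm v = 1 :> R -> dot v v = 1 by move=> v1; rewrite -sqr_enorm v1 expr1n.
have d11 := unit_dot _ he1; have d22 := unit_dot _ he2.
pose m := enorm (e1 + e2); pose n := enorm (e1 - e2).
have m0 : 0 < m.
  rewrite lt_neqAle enorm_ge0 andbT eq_sym enorm_eq0 addr_eq0.
  exact/eqP.
have n0 : 0 < n.
  rewrite lt_neqAle enorm_ge0 andbT eq_sym enorm_eq0 subr_eq0.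
  exact/eqP.
have mn : m ^+ 2 + n ^+ 2 = 4.
  by rewrite /m /n !sqr_enorm !(dotDl, dotDr, dotNl, dotNr) d11 d22 (dotC e2 e1); ring.
have mN : m != 0 by rewrite gt_eqF. have nN : n != 0 by rewrite gt_eqF.
pose d := m^-1 *: (e1 + e2); pose a := n^-1 *: (e1 - e2).
have dd : dot d d = 1.
  by rewrite /d dotZl dotZr -sqr_enorm -/m mulrA -expr2 -exprMn mulVf// expr1n.
have aa : dot a a = 1.
  by rewrite /a dotZl dotZr -sqr_enorm -/n mulrA -expr2 -exprMn mulVf// expr1n.
have ad : dot a d = 0.
  by rewrite /a /d dotZl dotZr dotBl !dotDr d11 d22 (dotC e2 e1); ring.
(* With theta half the angle between [e1] and [e2], m = 2 cos theta and n = 2 sin theta; so [q] is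
   tan theta and [al] is cos theta. *)
pose q := n / m; have q0 : 0 < q by rewrite divr_gt0.
pose al := m / 2; have al0 : 0 < al by rewrite divr_gt0.
have e1E : e1 = al *: (d + q *: a).
  by apply/rowP => i; rewrite /al /d /q /a !mxE; field; rewrite ?mN ?nN.
have e2E : e2 = al *: (d - q *: a).
  by apply/rowP => i; rewrite /al /d /q /a !mxE; field; rewrite ?mN ?nN.
pose c1 := (l1 - l2) * n / 2; pose c2 := (l1 + l2) * m / 2.
have eE : l1 *: e1 + l2 *: e2 = c1 *: a + c2 *: d.
  by apply/rowP => i; rewrite /c1 /c2 /a /d !mxE; field; rewrite ?mN ?nN.
clearbody a d.
(* The value of [normal_vec] at height 0, written out because the slopes of the wedge are themselves
   defined through it. *)
pose nv (k : R) := (Num.sqrt (k ^+ 2 + 1))^-1 *: (k *: a + d).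
have rad0 k : 0 < k ^+ 2 + 1 :> R by rewrite ltr_wpDl ?sqr_ge0.
have cnv : continuous nv.
  have cid : continuous (id : R -> R) by move=> ?; exact: cvg_id.
  have cs : continuous (fun k : R => (Num.sqrt (k ^+ 2 + 1))^-1).
    move=> k; apply: cvgV; first by rewrite gt_eqF// sqrtr_gt0.
    apply: (@continuous_comp _ _ _ (fun k : R => k ^+ 2 + 1) Num.sqrt); last exact: sqrt_continuous.
    by move: k; apply: continuous_add; [exact: continuous_pow|exact: continuous_const].
  have -> : nv = fun k => ((Num.sqrt (k ^+ 2 + 1))^-1 * k) *: a + (Num.sqrt (k ^+ 2 + 1))^-1 *: d.
    by apply/funext => k; rewrite /nv scalerDr scalerA.
  by apply: continuous_add_vec; apply: continuous_scale_vec => //; exact: continuous_mul.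
have nvq : (Num.sqrt (q ^+ 2 + 1))^-1 = al.
  have -> : q ^+ 2 + 1 = (al^-1) ^+ 2.
    have n2 : n ^+ 2 = 4 - m ^+ 2 by rewrite -mn addrC addKr.
    by rewrite /q /al expr_div_n n2; field.
  by rewrite sqrtr_sqr ger0_norm ?invr_ge0 ?ltW// invrK.
pose S := [set k : R | `|k| <= q] `&` [set k | K (nv k)].
have cS : compact S.
  apply: compact_closedI.
    rewrite (_ : mkset _ = `[- q, q]%classic); first exact: segment_compact.
    by apply/seteqP; split=> k; rewrite /= in_itv/= ler_norml.
  by apply: (@closed_comp _ _ nv K) => // k _; exact: cnv.
have Sq : S q.
  split; first by rewrite /= ger0_norm// ltW.
  by apply: eK; left; rewrite /nv nvq addrC e1E.
have SNq : S (- q).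
  split; first by rewrite /= normrN ger0_norm// ltW.
  by apply: eK; right; rewrite /nv sqrrN nvq scaleNr addrC e2E.
have Sle k : S k -> `|k| <= q by case.
have c20 : 0 < c2 by rewrite divr_gt0// mulr_gt0// addr_gt0.
have c12 : `|c1| < q * c2.
  have -> : q * c2 = (l1 + l2) * n / 2 by rewrite /q /c2; field.
  rewrite /c1 normrM normrM (ger0_norm (ltW n0)) (@ger0_norm _ 2^-1) ?invr_ge0//.
  by rewrite ltr_pM2r ?invr_gt0// ltr_pM2r// ltr_norml; apply/andP; split; lra.
have c1c2 : c1 ^+ 2 + c2 ^+ 2 = 1.
  have := unit_dot _ hen; rewrite eE !(dotDl, dotDr, dotZl, dotZr) aa dd (dotC d a) ad => <-.
  by ring.
pose u := cross a d.
have uu : dot u u = 1 by rewrite dot_cross_cross aa dd ad expr0n mulr1 subr0.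
pose W := Wedge (slope_set_of := SlopeSet q0 cS Sq SNq Sle) aa dd uu ad (dot_crossl a d)
  (dot_crossr a d) (cross_span aa dd ad) c20 c12 c1c2.
exists W, al; split => //.
have nvE k : normal_vec W k 0 = nv k.
  by rewrite /normal_vec /combine3 /= !mulr0 expr0n addr0 scale1r scale0r addr0.
apply/seteqP; split=> [_ [k [_ Kk] <-]|v Kv]; first by rewrite nvE.
have [v1 [m1 [m2 [m10 m20 vE]]]] := KGamma _ Kv.
have M0 : 0 < m1 + m2.
  rewrite lt_neqAle addr_ge0// andbT eq_sym; apply/negP; rewrite paddr_eq0// => /andP[/eqP m1E /eqP m2E].
  by move: (unit_dot _ v1); rewrite vE m1E m2E !scale0r addr0 dot0l => /eqP; rewrite eq_sym oner_eq0.
have MN : m1 + m2 != 0 by rewrite gt_eqF.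
(* In the frame, [v] is [al] times (m1 + m2) d + q (m1 - m2) a, and [k] is the quotient of the two
   coefficients. *)
pose k := q * (m1 - m2) / (m1 + m2).
have kv : v = (al * (m1 + m2)) *: (k *: a + d).
  rewrite vE {1}e1E {1}e2E; apply/rowP => i; rewrite /k !mxE; field.
  exact: MN.
have alM : (Num.sqrt (k ^+ 2 + 1))^-1 = al * (m1 + m2).
  have aM0 : 0 < al * (m1 + m2) by rewrite mulr_gt0.
  have : (al * (m1 + m2)) ^+ 2 * (k ^+ 2 + 1) = 1.
    have := unit_dot _ v1; rewrite {1 2}kv !(dotDl, dotDr, dotZl, dotZr) aa dd (dotC d a) ad => h.
    by apply: etrans h; ring.
  move=> h; have -> : k ^+ 2 + 1 = (al * (m1 + m2))^-1 ^+ 2.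
    apply: (mulfI (expf_neq0 2 (lt0r_neq0 aM0))).
    by rewrite h -exprMn mulfV ?expr1n// gt_eqF.
  by rewrite sqrtr_sqr ger0_norm ?invr_ge0 ?ltW// invrK.
exists k; last by rewrite nvE /nv alM -kv.
split; last by rewrite /= /nv alM -kv.
rewrite /= /k -mulrA normrM (ger0_norm (ltW q0)) ger_pMr// normf_div (gtr0_norm M0).
rewrite ler_pdivrMr// mul1r.
by rewrite ler_norml; apply/andP; split; lra.
Qed.

Theorem theorem3 (R : realType) (e1 e2 e : 'rV[R]_3) (l1 l2 : R)
  (K : set 'rV[R]_3)
  (he1 : enorm e1 = 1) (he2 : enorm e2 = 1)
  (he12 : e1 <> e2) (he12N : e1 <> - e2)
  (hl1 : 0 < l1) (hl2 : 0 < l2)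
  (he : e = l1 *: e1 + l2 *: e2) (hen : enorm e = 1)
  (Kclosed : closed K)
  (eK : [set e1; e2] `<=` K)
  (KGamma : K `<=` [set v | enorm v = 1 /\
     exists m1 m2 : R, [/\ 0 <= m1, 0 <= m2 & v = m1 *: e1 + m2 *: e2]]) :
  exists (C : set 'rV[R]_3) (r0 : 'rV[R]_3),
    [/\ convex_body C,
        ridge_point C r0,
        tangent_cone C r0 = dihedral r0 e1 e2 &
        exists (nu_ : R -> {measure set (borelR3 R) -> \bar R})
               (nustar : {finite_measure set (borelR3 R) -> \bar R}),
          [/\ \forall t \near 0^'+,
                (0 < area (slice C r0 e t))%E /\
                forall A : set (borelR3 R), measurable A ->
                  nu_ t A = nu C r0 e t A,
              nustar (~` sphere R) = 0%E,
              weak_cvg 0^'+ nu_ nustar &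
              spt nustar = K]].
Proof.
rewrite he in hen.
have [W [al [al0 e1E e2E eE KE]]] :=
  wedge_exists he1 he2 he12 he12N hl1 hl2 hen Kclosed eK KGamma.
have tc : tangent_cone (body W) 0 = dihedral 0 e1 e2 by exact: tangent_cone_body al0 e1E e2E.
exists (body W), 0; split => //; first exact: body_convex_body.
  by split; [exact: boundary_body0|exists e1, e2].
rewrite he eE -KE; apply: wedge_limit; rewrite KE//.
Qed.
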